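(* Fix $h\ge 0$ and $D\in\mathbb{R}$. There exists $\beta'>0$ such that for every $\beta\in(0,\beta')$ the following holds. Fix an integer $n\ge1$ and nonnegative integers $\{m(k,l): 1\le k\le l\le n\}$, and put $m=\sum_{1\le k\le l\le n}m(k,l)$. Let $\{\eta_{k,l}: 1\le k\le l\le n\}$ be a centered jointly Gaussian family with covariances $$\mathrm{Cov}(\eta_{k,l},\eta_{k',l'})=\begin{cases}A_2^2\,\mathbf 1\{\{k,l\}=\{k',l'\}\}+|\{k,l\}\cap\{k',l'\}|\,A_1^2+A_0^2, & \text{if } k\neq l,\ k'\ne l',\\ B_1^2\,\mathbf 1\{|\{k,l\}\cap\{k',l'\}|=1\}+B_0^2, & \text{if } k=l,\ k'=l',\\ C_1^2\,\mathbf 1\{|\{k,l\}\cap\{k',l'\}|=1\}+C_0^2, & \text{if exactly one of the pairs has equal entries.}\end{cases}$$ Then $$\nu\Big(\prod_{1\le k\le l\le n}(R_{k,l}-Q_{k,l})^{m(k,l)}\Big)=\mathbb{E}\Big[\prod_{1\le k\le l\le n}\eta_{k,l}^{m(k,l)}\Big]+O\big(N^{-(m+1)/2}\big),$$ where the implied constant does not depend on $N$.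
   Context: Fix an integer $\mathcal S\ge1$ and $N\ge2$; let $\Sigma_N=\{0,\pm1,\dots,\pm\mathcal S\}^N$. For $\beta>0$, $h\ge0$, $D\in\mathbb R$ and i.i.d. standard Gaussians $(g_{i,j})_{1\le i<j\le N}$ (the disorder), the Ghatak–Sherrington Hamiltonian is $H_N(\sigma)=\frac{\beta}{\sqrt N}\sum_{i<j}g_{i,j}\sigma_i\sigma_j+D\sum_{i}\sigma_i^2+h\sum_i\sigma_i$ and the Gibbs measure on $\Sigma_N$ is $G(\sigma)=e^{H_N(\sigma)}/\sum_{\sigma'\in\Sigma_N}e^{H_N(\sigma')}$. Replicas $\sigma^1,\sigma^2,\dots$ are i.i.d. samples from $G$ given the disorder; $\langle\cdot\rangle$ denotes the average under the product Gibbs measure and $\nu(f)=\mathbb E\langle f\rangle$, with $\mathbb E$ the expectation over the disorder. Overlaps: $R_{k,l}=\frac1N\sum_{i=1}^N\sigma_i^k\sigma_i^l$ ($k=l$ gives the self-overlap). The numbers $p,q$: for $\eta\sim N(0,1)$ and $\phi:\{0,\pm1,\dots,\pm\mathcal S\}\to\mathbb R$ set $\langle\phi\rangle_\eta=\sum_s\phi(s)w_\eta(s)/\sum_sw_\eta(s)$ with $w_\eta(s)=\exp\big(\beta\sqrt q\,\eta s+hs+(D+\tfrac{\beta^2}{2}(p-q))s^2\big)$; $(p,q)$ is the solution (unique in the high-temperature regime) of $q=\mathbb E[\langle s\rangle_\eta^2]$, $p=\mathbb E[\langle s^2\rangle_\eta]$; these are the values around which $R_{1,2}$ and $R_{1,1}$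 concentrate ($\nu((R_{1,2}-q)^2)\le16\mathcal S^2/N$, $\nu((R_{1,1}-p)^2)\le 16\mathcal S^4/N$). Set $Q_{k,l}=q$ if $k\ne l$ and $Q_{k,l}=p$ if $k=l$. Constants: write $m_j=\langle s^j\rangle_\eta$ and let all expectations below be over $\eta$. $A=\mathbb E[(m_2-m_1^2)^2]$, $\mathcal D=\mathbb E[m_4-m_2^2]$, $F=\mathbb E[m_2^2-m_1^2m_2]$, $G=\mathbb E[m_1^2(m_2-m_1^2)]$, $\mathcal E=\mathbb E[m_1(m_3-m_1m_2)]$, $I_3=\mathbb E[m_1^4]-q^2$, $I_5=\mathbb E[m_1^2m_2]-pq$, $K_4=\mathbb E[m_2^2]-p^2$. $M_1=1-\beta^2(F-3G)$, $M_2=1-\frac{\beta^2}{2}\mathcal D$, $M_3=1-\beta^2(F-G)$, $M=M_1M_2+\beta^4\mathcal E^2$. Then $A_2^2=\frac{A}{N(1-\beta^2A)}$, $A_1^2=\frac{GM_2+\frac{\beta^2}{2}\mathcal E^2}{NMM_3}$, $B_1^2=\frac{\mathcal DM_1-2\beta^2\mathcal E^2}{NM}$, $C_1^2=\frac{\mathcal E}{NM}$, $A_0^2=\frac{\beta^2}{M}(\beta^2\mathcal EK_4+M_2I_5)C_1^2+\frac{2\beta^2}{M}(\beta^2\mathcal E(\mathcal E-I_5)+M_2(2G-I_3))A_1^2+\frac{\beta^2}{M}(\beta^2\mathcal EI_5+M_2I_3)A_2^2+\frac{1}{MN}(\beta^2\mathcal EI_5+M_2I_3)$, $B_0^2=\frac{\beta^2}{2M}(M_1K_4-\beta^2\mathcal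 EI_5)B_1^2+\frac{\beta^2}{M}(M_1(\mathcal E-I_5)-\beta^2\mathcal E(2G-I_3))C_1^2+\frac{1}{MN}(M_1K_4-\beta^2\mathcal EI_5)$, $C_0^2=\frac{\beta^2}{2M}(M_2I_5+\beta^2\mathcal EK_4)B_1^2+\frac{\beta^2}{M}(M_2(2G-I_3)+\beta^2\mathcal E(\mathcal E-I_5))C_1^2+\frac{1}{MN}(M_2I_5+\beta^2\mathcal EK_4)$. *)

(* Defs.v *)
From HB Require Import structures.
From mathcomp Require Import all_boot all_order all_algebra.
From mathcomp Require Import all_classical all_reals all_analysis.
Set Implicit Arguments.
Unset Strict Implicit.
Unset Printing Implicit Defensive.
Import Order.TTheory GRing.Theory Num.Theory.
Import numFieldNormedType.Exports.
Local Open Scope ring_scope.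

Definition gdens {R : realType} (x : R) : R :=
  expR (- (x ^+ 2) / 2) / Num.sqrt (2 * pi).

Definition gavg1 {R : realType} (F : R -> R) : R :=
  Rintegral (@lebesgue_measure R) setT (fun x => gdens x * F x).

Definition consv {R : realType} n (x : R) (v : 'I_n -> R) : 'I_n.+1 -> R :=
  fun i => match unlift ord0 i with None => x | Some j => v j end.

Fixpoint gexp {R : realType} (n : nat) : (('I_n -> R) -> R) -> R :=
  match n return (('I_n -> R) -> R) -> R with
  | 0 => fun F => F (fun _ => 0)
  | n'.+1 => fun F => gavg1 (fun x => gexp (fun v => F (consv x v)))
  end.

Definition gexpT {R : realType} (I : finType) (F : (I -> R) -> R) : R :=
  gexp (fun v : 'I_#|I| -> R => F (fun i => v (enum_rank i))).

(* spin alphabet {0, +-1, ..., +-S}, encoded by 'I_(2S+1) *)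
Definition spin (S : nat) := 'I_(S.*2.+1).
Definition sval {R : realType} (S : nat) (s : spin S) : R := (s : nat)%:R - S%:R.

Definition config (S N : nat) := {ffun 'I_N -> spin S}.

Definition pairsLt (N : nat) := {p : 'I_N * 'I_N | (p.1 < p.2)%N}.
Definition pairsLe (n : nat) := {p : 'I_n * 'I_n | (p.1 <= p.2)%N}.

Definition Ham {R : realType} (S N : nat) (beta h D : R) (g : pairsLt N -> R)
  (sigma : config S N) : R :=
  beta / Num.sqrt (N%:R) *
    (\sum_(p : pairsLt N) g p * sval (sigma (val p).1) * sval (sigma (val p).2))
  + D * (\sum_(i < N) sval (sigma i) ^+ 2)
  + h * (\sum_(i < N) sval (sigma i)).

Definition gibbs {R : realType} (S N : nat) (beta h D : R) (g : pairsLt N -> R)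
  (sigma : config S N) : R :=
  expR (Ham beta h D g sigma) / \sum_(tau : config S N) expR (Ham beta h D g tau).

Definition gibbs_avg {R : realType} (S N n : nat) (beta h D : R)
  (g : pairsLt N -> R) (F : {ffun 'I_n -> config S N} -> R) : R :=
  \sum_(rho : {ffun 'I_n -> config S N})
     (\prod_(k < n) gibbs beta h D g (rho k)) * F rho.

Definition nu {R : realType} (S N n : nat) (beta h D : R)
  (F : {ffun 'I_n -> config S N} -> R) : R :=
  gexpT (fun g : pairsLt N -> R => gibbs_avg beta h D g F).

Definition overlap {R : realType} (S N n : nat) (rho : {ffun 'I_n -> config S N})
  (k l : 'I_n) : R :=
  (N%:R)^-1 * \sum_(i < N) sval (rho k i) * sval (rho l i).

Definition wgt {R : realType} (S : nat) (beta h D p q : R) (eta : R) (s : spin S) : R :=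
  expR (beta * Num.sqrt q * eta * sval s + h * sval s
        + (D + beta ^+ 2 / 2 * (p - q)) * sval s ^+ 2).

Definition mom {R : realType} (S : nat) (beta h D p q : R) (j : nat) (eta : R) : R :=
  (\sum_(s : spin S) wgt beta h D p q eta s * sval s ^+ j)
  / \sum_(s : spin S) wgt beta h D p q eta s.

Definition fixed_point {R : realType} (S : nat) (beta h D p q : R) : Prop :=
  q = gavg1 (fun eta => mom S beta h D p q 1 eta ^+ 2) /\
  p = gavg1 (fun eta => mom S beta h D p q 2 eta).

Definition Emom {R : realType} (S : nat) (beta h D p q : R) (f : (nat -> R) -> R) : R :=
  gavg1 (fun eta => f (fun j => mom S beta h D p q j eta)).

Section Constants.
Context {R : realType} (S : nat) (beta h D p q : R) (N : nat).
Local Notation E := (Emom S beta h D p q).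

Definition cA : R := E (fun m => (m 2%N - m 1%N ^+ 2) ^+ 2).
Definition cDD : R := E (fun m => m 4%N - m 2%N ^+ 2).
Definition cF : R := E (fun m => m 2%N ^+ 2 - m 1%N ^+ 2 * m 2%N).
Definition cG : R := E (fun m => m 1%N ^+ 2 * (m 2%N - m 1%N ^+ 2)).
Definition cE : R := E (fun m => m 1%N * (m 3%N - m 1%N * m 2%N)).
Definition cI3 : R := E (fun m => m 1%N ^+ 4) - q ^+ 2.
Definition cI5 : R := E (fun m => m 1%N ^+ 2 * m 2%N) - p * q.
Definition cK4 : R := E (fun m => m 2%N ^+ 2) - p ^+ 2.
Definition cM1 : R := 1 - beta ^+ 2 * (cF - 3 * cG).
Definition cM2 : R := 1 - beta ^+ 2 / 2 * cDD.
Definition cM3 : R := 1 - beta ^+ 2 * (cF - cG).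
Definition cM : R := cM1 * cM2 + beta ^+ 4 * cE ^+ 2.
Definition NR : R := N%:R.

Definition A2sq : R := cA / (NR * (1 - beta ^+ 2 * cA)).
Definition A1sq : R := (cG * cM2 + beta ^+ 2 / 2 * cE ^+ 2) / (NR * cM * cM3).
Definition B1sq : R := (cDD * cM1 - 2 * beta ^+ 2 * cE ^+ 2) / (NR * cM).
Definition C1sq : R := cE / (NR * cM).
Definition A0sq : R :=
  beta ^+ 2 / cM * (beta ^+ 2 * cE * cK4 + cM2 * cI5) * C1sq
  + 2 * beta ^+ 2 / cM * (beta ^+ 2 * cE * (cE - cI5) + cM2 * (2 * cG - cI3)) * A1sq
  + beta ^+ 2 / cM * (beta ^+ 2 * cE * cI5 + cM2 * cI3) * A2sq
  + (cM * NR)^-1 * (beta ^+ 2 * cE * cI5 + cM2 * cI3).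
Definition B0sq : R :=
  beta ^+ 2 / (2 * cM) * (cM1 * cK4 - beta ^+ 2 * cE * cI5) * B1sq
  + beta ^+ 2 / cM * (cM1 * (cE - cI5) - beta ^+ 2 * cE * (2 * cG - cI3)) * C1sq
  + (cM * NR)^-1 * (cM1 * cK4 - beta ^+ 2 * cE * cI5).
Definition C0sq : R :=
  beta ^+ 2 / (2 * cM) * (cM2 * cI5 + beta ^+ 2 * cE * cK4) * B1sq
  + beta ^+ 2 / cM * (cM2 * (2 * cG - cI3) + beta ^+ 2 * cE * (cE - cI5)) * C1sq
  + (cM * NR)^-1 * (cM2 * cI5 + beta ^+ 2 * cE * cK4).
End Constants.

Definition pset {n} (a : pairsLe n) : {set 'I_n} := [set (val a).1; (val a).2].
Definition inter {n} (a b : pairsLe n) : nat := #|pset a :&: pset b|.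
Definition isdiag {n} (a : pairsLe n) : bool := (val a).1 == (val a).2.

Definition eta_cov {R : realType} (S : nat) (beta h D p q : R) (N n : nat)
  (a b : pairsLe n) : R :=
  if ~~ isdiag a && ~~ isdiag b then
    A2sq S beta h D p q N * (pset a == pset b)%:R
    + (inter a b)%:R * A1sq S beta h D p q N + A0sq S beta h D p q N
  else if isdiag a && isdiag b then
    B1sq S beta h D p q N * (inter a b == 1)%N%:R + B0sq S beta h D p q N
  else
    C1sq S beta h D p q N * (inter a b == 1)%N%:R + C0sq S beta h D p q N.

Definition Qkl {R : realType} (p q : R) {n} (a : pairsLe n) : R :=
  if isdiag a then p else q.

(* Main.v *)
(** Write x_(k,l) = R_(k,l) - Q_(k,l).  Singling out one site and interpolating to the system in
    which it is decoupled, a second order expansion of the interpolation gives, for a product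
    x_a x_s of centred overlaps with s a list of m pairs,
      nu(x_a x_s) = N^-1 sum_(b in s) c(a;b) nu(x_(s minus b))
                    + beta^2/2 Gamma(b |-> c(a;b) nu(x_b x_s)) + O(N^(-(m+2)/2)),
    where c(a;b) is the single-spin covariance and Gamma the signed sum over pairs of replicas
    (two of them new) produced by the interpolation; the errors are controlled by a priori bounds
    nu(x^(2k)) = O(N^-k), which need beta small independently of k.  The covariance of eta solves
    the same recursion with m = 1, so by Wick's rule the Gaussian moments satisfy the recursion
    exactly.  The difference e of the two families thus solves e = beta^2/2 Gamma(c e) up to
    O(N^(-(m+2)/2)).  Symmetry among replicas not occurring in s reduces this system to 2x2 blocks of
    determinant M, and a factor M_3, independently of the number of replicas, so e is of the
    order of the error; induct on m. *)

(* The threshold on [beta] must serve all [n] and all exponents at once. For the a priori bounds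
   this holds because the even moments are treated one after the other with the same contraction
   constant [htC], computed from two replicas; the order of the moment enters the constants but not
   the condition on [beta]. For the linear system it holds because subtracting equations that differ
   in one replica cancels the global sums that grow with the number of replicas, so that only M and
   M_3 are divided by. Symmetry between sites is replaced by uniformity: every cavity estimate holds
   with one constant for all sites and is then averaged over them. Each derivative along the
   interpolation adds two replicas, hence replicas form an infinite stream with an averaged initial
   segment. An angle parametrises the interpolation, which keeps its coefficients smooth at both
   ends. Gaussian calculus takes place in a class of functions where differentiation under the
   integral follows from Taylor remainders. The family eta is a linear image [L g] of independent
   Gaussians. *)
Require Import Defs.
From HB Require Import structures.
From mathcomp Require Import all_boot all_order all_algebra.
From mathcomp Require Import perm ring lra zify.
From mathcomp Require Import all_classical all_reals all_analysis.
From mathcomp Require Import measurable_realfun.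
Import Order.TTheory GRing.Theory Num.Theory.
Import numFieldNormedType.Exports.
Local Open Scope ring_scope.
Set Implicit Arguments. Unset Strict Implicit. Unset Printing Implicit Defensive.

(** * Gaussian integrals in one variable *)

Section GaussOneDim.
Context {R : realType}.
Implicit Types (f g : R -> R) (x y C : R) (k n : nat).
Local Open Scope classical_set_scope.
Local Notation mu := (@lebesgue_measure R).

Lemma gdens_gt0 x : 0 < gdens x.
Proof. by rewrite /gdens divr_gt0 ?expR_gt0// sqrtr_gt0 mulr_gt0 ?pi_gt0. Qed.

Lemma gdens_pdf x : gdens x = normal_pdf 0 1 x.
Proof.
rewrite normal_pdfE ?oner_eq0// /gdens mulrC /normal_peak /normal_fun.
by rewrite subr0 expr1n mul1r mulr_natl.
Qed.

Lemma continuous_gdens : continuous (@gdens R).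
Proof.
have -> : @gdens R = normal_pdf 0 1 by apply/funext => x; exact: gdens_pdf.
exact: continuous_normal_pdf (oner_neq0 _).
Qed.

(** With [y = 1 + |x|], [y ^+ k / k!] is a term of the exponential series, and [y <= 2 + x ^+ 2 / 4]
    is [(|x| - 2) ^+ 2 >= 0]. Only half of the Gaussian exponent is spent; the other half, [gtail],
    remains for integrability. *)
Lemma poly_le_gauss k x : (1 + `|x|) ^+ k <= k`!%:R * expR 2 * expR (x ^+ 2 / 4).
Proof.
have x0 : 0 <= 1 + `|x| by rewrite addr_ge0.
have h : (1 + `|x|) ^+ k <= k`!%:R * expR (1 + `|x|).
  case: k => [|k]; first by rewrite expr0 mul1r -expR0 ler_expR.
  have := expR_ge1Dxn k x0.
  move=> H; rewrite mulrC -ler_pdivrMr; last by rewrite ltr0n fact_gt0.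
  by apply: le_trans H; rewrite lerDr.
apply: le_trans h _; rewrite -mulrA ler_wpM2l// -expRD ler_expR.
rewrite -(real_normK (num_real x)).
have := sqr_ge0 (`|x| - 2); rewrite sqrrB => H.
nra.
Qed.

Definition gtail x : R := expR (- (x ^+ 2 / 4)).

Lemma poly_gdens_le k x :
  (1 + `|x|) ^+ k * gdens x <= k`!%:R * expR 2 / Num.sqrt (2 * pi) * gtail x.
Proof.
have s0 : 0 < Num.sqrt (2 * pi) :> R by rewrite sqrtr_gt0 mulr_gt0 ?pi_gt0.
rewrite /gdens mulrA ler_pdivrMr// (mulrAC _ _ (gtail x)) divfK ?gt_eqF//.
rewrite /gtail (_ : - x ^+ 2 / 2 = - (x ^+ 2/4) + - (x^+2 / 4)); last by field.
rewrite expRD mulrA ler_wpM2r ?expR_ge0//.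
rewrite expRN ler_pdivrMr ?expR_gt0//; exact: poly_le_gauss.
Qed.

(** Up to normalisation, [gtail] is the centered normal density of variance 2. *)
Lemma integrable_gtail : mu.-integrable setT (EFin \o gtail).
Proof.
have s0 : Num.sqrt 2 != 0 :> R by rewrite gt_eqF// sqrtr_gt0.
have pk : 0 < normal_peak (Num.sqrt 2) :> R by rewrite normal_peak_gt0.
apply: (@le_integrable _ _ _ mu setT measurableT _
  (fun x => (normal_peak (Num.sqrt 2))^-1%:E * (normal_pdf 0 (Num.sqrt 2) x)%:E)%E).
- apply/measurable_EFinP; apply: measurableT_comp => //.
  apply: measurableT_comp => //; apply: measurable_funM => //.
- move=> x _ /=; rewrite !lee_fin normal_pdfE// /normal_fun subr0 sqr_sqrtr//.
  rewrite mulrA mulVf ?gt_eqF// mul1r /gtail.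
  by rewrite le_eqVlt; apply/orP; left; apply/eqP; congr `|expR _|; field.
- apply: integrableZl => //; exact: integrable_normal_pdf.
Qed.

Definition pgrow f := exists C k, forall x, `|f x| <= C * (1 + `|x|) ^+ k.

Lemma pgrow_integrable f : continuous f -> pgrow f ->
  mu.-integrable setT (EFin \o (fun x => gdens x * f x)).
Proof.
move=> cf [C [k H]].
have C0 : 0 <= C.
  by have := le_trans (normr_ge0 _) (H 0); rewrite normr0 addr0 expr1n mulr1.
set D := C * (k`!%:R * expR 2 / Num.sqrt (2 * pi)).
apply: (@le_integrable _ _ _ mu setT measurableT _ (fun x => D%:E * (gtail x)%:E)%E).
- apply/measurable_EFinP/measurable_funM; apply: continuous_measurable_fun => //.
  exact: continuous_gdens.
- move=> x _ /=; rewrite !lee_fin normrM (ger0_norm (ltW (gdens_gt0 x))).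
  rewrite [leRHS]ger0_norm; last first.
    by rewrite /D !mulr_ge0// ?expR_ge0.
  rewrite /D -[leRHS]mulrA; apply: (@le_trans _ _ (C * ((1 + `|x|) ^+ k * gdens x))).
    rewrite mulrA mulrC ler_wpM2r// ltW//; exact: gdens_gt0.
  rewrite ler_wpM2l//; exact: poly_gdens_le.
- apply: integrableZl => //; exact: integrable_gtail.
Qed.

Lemma gavg1_cst C : gavg1 (fun=> C) = C.
Proof.
rewrite /gavg1 (_ : (fun x => gdens x * C) = (fun x => C * normal_pdf 0 1 x)); last first.
  by apply/funext => x; rewrite gdens_pdf mulrC.
rewrite RintegralZl//; last exact: integrable_normal_pdf.
by rewrite /Rintegral integral_normal_pdf mulr1.
Qed.

Lemma gavg1D f g : continuous f -> pgrow f -> continuous g -> pgrow g ->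
  gavg1 (fun x => f x + g x) = gavg1 f + gavg1 g.
Proof.
move=> cf pf cg pg; rewrite /gavg1 -RintegralD//; try exact: pgrow_integrable.
by apply: eq_Rintegral => x _; rewrite mulrDr.
Qed.

Lemma gavg1Z C f : continuous f -> pgrow f ->
  gavg1 (fun x => C * f x) = C * gavg1 f.
Proof.
move=> cf pf; rewrite /gavg1 -RintegralZl//; last exact: pgrow_integrable.
by apply: eq_Rintegral => x _; rewrite mulrCA.
Qed.

Lemma gavg1_le f g : continuous f -> pgrow f -> continuous g -> pgrow g ->
  (forall x, f x <= g x) -> gavg1 f <= gavg1 g.
Proof.
move=> cf pf cg pg fg; apply: le_Rintegral => //; try exact: pgrow_integrable.
by move=> x _; rewrite ler_wpM2l// ltW// gdens_gt0.
Qed.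

Lemma is_derive_gdens x : is_derive x 1 (@gdens R) (- x * gdens x).
Proof.
have -> : @gdens R = (fun x => (Num.sqrt (2 * pi))^-1 * expR ((- 2^-1) * x ^+ 2)).
  by apply/funext => y; rewrite /gdens mulrC; congr (_ * expR _); field.
apply: is_derive_eq.
rewrite -[LHS]/(_ * (_ * (_ * (x * 1 + x * 1)))); field.
by rewrite gt_eqF// sqrtr_gt0 mulr_gt0 ?pi_gt0.
Qed.

(** Boundary terms only have to vanish along the integers, and [n + 1 <= 1 + (n + 1) ^+ 2 / 4] gives
    a sufficient majorant. *)
Lemma gtail_harmonic n : gtail n.+1%:R <= harmonic n.
Proof.
rewrite /gtail /harmonic /= expRN lef_pV2 ?posrE ?expR_gt0//.
apply: le_trans (expR_ge1Dx _).
have := sqr_ge0 (n.+1%:R - 2 : R); rewrite sqrrB => H; nra.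
Qed.

Lemma cvg_Rintegral_segment (h : R -> R) : mu.-integrable setT (EFin \o h) ->
  (\int[mu]_(x in `[(- n.+1%:R : R), n.+1%:R]) h x)%R @[n --> \oo] --> (\int[mu]_x h x)%R.
Proof.
move=> ih.
pose f_ n := (EFin \o h) \_ `[(- n.+1%:R : R), (n.+1%:R : R)]%classic.
have mh : measurable_fun setT (EFin \o h) by case/integrableP : ih.
have := @dominated_convergence _ _ _ mu setT measurableT f_ (EFin \o h) (abse \o (EFin \o h)).
case.
- move=> n; apply/(measurable_restrictT _ _).1 => //.
  exact: measurable_funS mh.
- exact: mh.
- apply: aeW => x _; apply: cvg_near_cst.
  near=> n; rewrite /f_ patchE mem_set//= in_itv/= -ler_norml.
  near: n; exists (Num.truncn `|x|) => // n /= H.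
  by apply: (le_trans (ltW (truncnS_gt _))); rewrite ler_nat ltnS.
- exact: integrable_abse.
- apply: aeW => x n _; rewrite /f_ patchE; case: ifP => //= _.
  by rewrite normr0 lee_fin.
move=> _ _ H.
have -> : (fun n => \int[mu]_(x in `[(- n.+1%:R : R), n.+1%:R]) h x)%R =
    fine \o (fun n => (\int[mu]_x f_ n x)%E).
  by apply/funext => n /=; rewrite /Rintegral integral_mkcond.
apply: fine_cvg; rewrite fineK//; exact: integrable_fin_num.
Unshelve. all: by end_near. Qed.

(** The integrals over growing segments converge to the full integral by dominated convergence, and
    to 0 by the fundamental theorem of calculus. *)
Lemma Rintegral_derive_eq0 (h h' : R -> R) :
  (forall x, is_derive x 1 h (h' x)) -> continuous h' ->
  mu.-integrable setT (EFin \o h') ->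
  h n.+1%:R @[n --> \oo] --> 0 -> h (- n.+1%:R) @[n --> \oo] --> 0 ->
  (\int[mu]_x h' x)%R = 0.
Proof.
move=> dh ch' ih' hp hn.
have ch : continuous h.
  by move=> x; apply/differentiable_continuous/derivable1_diffP; case: (dh x).
have H := cvg_Rintegral_segment ih'.
have E n : (\int[mu]_(x in `[(- n.+1%:R : R), n.+1%:R]) h' x)%R =
    h n.+1%:R - h (- n.+1%:R).
  rewrite /Rintegral (@continuous_FTC2 _ h' h)//.
  - by rewrite gtrN.
  - exact: continuous_subspaceT.
  - split; [by move=> x _; case: (dh x)| |].
      exact/cvg_at_right_filter/ch.
    exact/cvg_at_left_filter/ch.
  - by move=> x _; rewrite derive1E; apply: derive_val.
have H0 : (\int[mu]_(x in `[(- n.+1%:R : R), n.+1%:R]) h' x)%R @[n --> \oo] --> (0 : R).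
  have -> : (0 : R) = 0 - 0 by rewrite subr0.
  under eq_fun do rewrite E.
  exact: cvgB hp hn.
exact: (cvg_unique _ H H0).
Qed.

Lemma pgrow_cst C : pgrow (fun=> C).
Proof. by exists `|C|, 0 => x; rewrite expr0 mulr1. Qed.

Lemma pgrow_id : pgrow id.
Proof. by exists 1, 1 => x; rewrite expr1 mul1r lerDr. Qed.

Lemma pgrowM f g : pgrow f -> pgrow g -> pgrow (fun x => f x * g x).
Proof.
move=> [C [k H]] [D [l K]]; exists (C * D), (k + l)%N => x.
by rewrite normrM exprD mulrACA ler_pM.
Qed.

Lemma pgrowD f g : pgrow f -> pgrow g -> pgrow (fun x => f x + g x).
Proof.
move=> [C [k H]] [D [l K]]; exists (`|C| + `|D|), (k + l)%N => x.
apply: (le_trans (ler_normD _ _)); rewrite mulrDl.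
have h1 : 1 <= 1 + `|x| by rewrite lerDl.
apply: lerD.
  apply: (le_trans (H x)); apply: ler_pM; rewrite ?ler_norm//.
    by have := le_trans (normr_ge0 _) (H 0); rewrite normr0 addr0 expr1n mulr1.
  by rewrite ler_weXn2l// leq_addr.
apply: (le_trans (K x)); apply: ler_pM; rewrite ?ler_norm//.
  by have := le_trans (normr_ge0 _) (K 0); rewrite normr0 addr0 expr1n mulr1.
by rewrite ler_weXn2l// leq_addl.
Qed.

Lemma gdens_vanish f : pgrow f ->
  gdens n.+1%:R * f n.+1%:R @[n --> \oo] --> 0 /\
  gdens (- n.+1%:R) * f (- n.+1%:R) @[n --> \oo] --> 0.
Proof.
move=> [C [k H]].
have C0 : 0 <= C.
  by have := le_trans (normr_ge0 _) (H 0); rewrite normr0 addr0 expr1n mulr1.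
set D := C * (k`!%:R * expR 2 / Num.sqrt (2 * pi)).
have D0 : 0 <= D by rewrite /D !mulr_ge0// ?expR_ge0.
have B x : `|gdens x * f x| <= D * gtail x.
  rewrite normrM (ger0_norm (ltW (gdens_gt0 x))).
  apply: (@le_trans _ _ (C * ((1 + `|x|) ^+ k * gdens x))).
    rewrite mulrA mulrC ler_wpM2r// ltW//; exact: gdens_gt0.
  by rewrite /D -[leRHS]mulrA ler_wpM2l//; exact: poly_gdens_le.
have L : D * harmonic n @[n --> \oo] --> (0 : R).
  by rewrite -(mulr0 D); apply: cvgMr; exact: cvg_harmonic.
have sq (u : nat -> R) : (forall n, `|u n| <= D * harmonic n) -> u n @[n --> \oo] --> (0 : R).
  move=> Hu; apply/norm_cvg0P; apply: squeeze_cvgr (cvg_cst 0) L.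
  by apply: nearW => n; rewrite normr_ge0 Hu.
split; apply: sq => n; apply: (le_trans (B _)); rewrite ler_wpM2l//.
  exact: gtail_harmonic.
by rewrite /gtail sqrrN; exact: gtail_harmonic.
Qed.

(** The derivative of [gdens x * f x] is [gdens x * (f' x - x * f x)], and its integral vanishes
    since the density beats polynomial growth. *)
Lemma gavg1_ibp f f' : (forall x, is_derive x 1 f (f' x)) -> continuous f' ->
  pgrow f -> pgrow f' -> gavg1 (fun x => x * f x) = gavg1 f'.
Proof.
move=> df cf' pf pf'.
have cf : continuous f.
  by move=> x; apply/differentiable_continuous/derivable1_diffP; case: (df x).
have pxf : pgrow (fun x => x * f x) by apply: pgrowM => //; exact: pgrow_id.
have cxf : continuous (fun x => x * f x) by move=> x; apply: cvgM; [exact: cvg_id|exact: cf].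
have cN : continuous (fun x => -1 * (x * f x)).
  by move=> x; apply: cvgM; [exact: cvg_cst|exact: cxf].
have pN : pgrow (fun x => -1 * (x * f x)) by apply: pgrowM => //; exact: pgrow_cst.
apply/eqP; rewrite eq_sym -subr_eq0 -mulN1r -gavg1Z// -gavg1D//; apply/eqP.
have [v1 v2] := gdens_vanish pf.
apply: (@Rintegral_derive_eq0 (fun x => gdens x * f x)) => //.
- move=> x; have := is_deriveM (is_derive_gdens x) (df x).
  move=> Hd; apply: is_derive_eq.
  rewrite -[LHS]/(_ * _ + _ * _); ring.
- move=> x; apply: cvgM; first exact: continuous_gdens.
  by apply: cvgD; [exact: cf'|exact: cN].
- apply: pgrow_integrable; last exact: pgrowD.
  by move=> x; apply: cvgD; [exact: cf'|exact: cN].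
Qed.

End GaussOneDim.

(** * Gaussian integrals in several variables *)

Section Taylor.
Context {R : realType}.
Local Open Scope classical_set_scope.

(** A quadratic remainder bound, unlike a derivative, can be integrated directly over the other
    variables; this lemma converts it back at the end. *)
Lemma is_derive_taylor (f : R -> R) (x l K : R) :
  (forall s, `|s| <= 1 -> `|f (x + s) - f x - s * l| <= K * s ^+ 2) ->
  is_derive x 1 f l.
Proof.
move=> H.
have K0 : 0 <= K.
  have := le_trans (normr_ge0 _) (H 1 _); rewrite normr1 expr1n mulr1; exact.
have K1 : 0 < K + 1 by rewrite ltr_wpDl.
have cv : h^-1 *: ((f \o shift x) (h *: (1 : R)) - f x) @[h --> 0^'] --> l.
  apply/cvgrPdist_le => e e0.
  have e1 : 0 < e / (K + 1) by exact: divr_gt0.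
  near=> h.
  have h0 : h != 0 by near: h; exact: nbhs_dnbhs_neq.
  have h1 : `|h| <= 1.
    near: h; apply: dnbhs0_le; exact: ltr01.
  have h2 : `|h| <= e / (K + 1).
    near: h; apply: dnbhs0_le; exact: e1.
  have -> : l - h^-1 *: ((f \o shift x) (h *: (1 : R)) - f x) =
     - (h^-1 * (f (x + h) - f x - h * l)).
    rewrite -[(f \o _) _]/(f (h * 1 + x)) mulr1 (addrC h x).
    by rewrite -[h^-1 *: _]/(h^-1 * (_ : R)); field.
  rewrite normrN normrM normfV ler_pdivrMl ?normr_gt0//.
  apply: (le_trans (H h h1)); rewrite -(real_normK (num_real h)) expr2 mulrCA.
  rewrite ler_wpM2l//; move: h2; rewrite ler_pdivlMr// => h2.
  by apply: le_trans h2; rewrite mulrC ler_wpM2l// lerDl.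
split; first by apply/cvg_ex; exists l.
exact: cvg_lim cv.
Unshelve. all: by end_near. Qed.

Lemma continuous_locLip (f : R -> R) (K : R -> R) :
  (forall x y, `|y - x| <= 1 -> `|f y - f x| <= K x * `|y - x|) -> continuous f.
Proof.
move=> H x; apply/cvgrPdist_le => e e0.
have K0 : 0 <= K x.
  have := le_trans (normr_ge0 _) (H x (x + 1) _).
  rewrite (addrC x 1) addrK normr1 mulr1; exact.
have K1 : 0 < K x + 1 by rewrite ltr_wpDl.
have e1 : 0 < e / (K x + 1) by exact: divr_gt0.
near=> y.
have h1 : `|x - y| <= 1 by near: y; apply: cvgr_dist_le => //; exact: cvg_id.
have h2 : `|x - y| <= e / (K x + 1).
  by near: y; apply: cvgr_dist_le; [exact: cvg_id|exact: e1].
rewrite distrC; rewrite distrC in h1; rewrite distrC in h2.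
apply: (le_trans (H _ _ h1)).
move: h2; rewrite ler_pdivlMr// => h2.
by apply: le_trans h2; rewrite mulrC ler_wpM2l// lerDl.
Unshelve. all: by end_near. Qed.
End Taylor.

Section GaussMulti.
Context {R : realType}.
Implicit Types (n k : nat) (C : R).

Definition wt {n} (v : 'I_n -> R) : R := 1 + \sum_i `|v i|.

Lemma wt_ge1 n (v : 'I_n -> R) : 1 <= wt v.
Proof. by rewrite lerDl sumr_ge0. Qed.

Lemma wt_ge0 n (v : 'I_n -> R) : 0 <= wt v.
Proof. exact: le_trans ler01 (wt_ge1 v). Qed.

(* Locally Lipschitz with constants of polynomial growth: an algebra of functions stable under partial Gaussian integration, on which every integral in [gexp] converges. *)
Definition plip {n} (F : ('I_n -> R) -> R) := exists C k, 0 <= C /\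
  forall v w, `|F v - F w| <= C * (wt v + wt w) ^+ k * \sum_i `|v i - w i|.

Definition pgn {n} (F : ('I_n -> R) -> R) := exists C k, 0 <= C /\
  forall v, `|F v| <= C * wt v ^+ k.

Lemma wt_dist n (v w : 'I_n -> R) : \sum_i `|v i - w i| <= wt v + wt w.
Proof.
apply: (@le_trans _ _ (\sum_i `|v i| + \sum_i `|w i|)).
  by rewrite -big_split; apply: ler_sum => i _; exact: ler_normB.
by rewrite /wt; lra.
Qed.

Lemma plip_pgn n (F : ('I_n -> R) -> R) : plip F -> pgn F.
Proof.
move=> [C [k [C0 H]]]; exists (`|F (fun=> 0)| + C * 2 ^+ k.+1), k.+1.
split=> [|v]; first by rewrite addr_ge0// mulr_ge0// exprn_ge0.
have w0 : wt (fun _ : 'I_n => 0) = 1 :> R.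
  by rewrite /wt big1 ?addr0// => i _; rewrite normr0.
have := H v (fun=> 0); rewrite w0 => h.
rewrite -(subrK (F (fun=> 0)) (F v)) (le_trans (ler_normD _ _))// addrC mulrDl lerD//.
  by rewrite ler_peMr// exprn_ege1// wt_ge1.
apply: (le_trans h); rewrite -!mulrA ler_wpM2l// -exprMn exprS mulrC ler_pM//.
- by rewrite sumr_ge0.
- by rewrite exprn_ge0// addr_ge0// wt_ge0.
- apply: (le_trans (wt_dist _ _)); rewrite w0; have := wt_ge1 v; lra.
- apply: lerXn2r; rewrite ?nnegrE.
  + by rewrite addr_ge0// wt_ge0.
  + by rewrite mulr_ge0// wt_ge0.
  + have := wt_ge1 v; lra.
Qed.

Lemma plip_cst n C : plip (fun _ : 'I_n -> R => C).
Proof. by exists 0, 0; split=> // v w; rewrite subrr normr0 !mul0r. Qed.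

Lemma plip_coord n (i : 'I_n) : plip (fun v => v i).
Proof.
exists 1, 0; split=> // v w; rewrite expr0 !mul1r (bigD1 i)//= lerDl.
by rewrite sumr_ge0.
Qed.

Lemma wtD_ge1 n (v w : 'I_n -> R) : 1 <= wt v + wt w.
Proof. by rewrite (le_trans (wt_ge1 v))// lerDl wt_ge0. Qed.

Lemma plipD n (F G : ('I_n -> R) -> R) : plip F -> plip G ->
  plip (fun v => F v + G v).
Proof.
move=> [C [k [C0 H]]] [D [l [D0 K]]]; exists (C + D), (k + l)%N.
split=> [|v w]; first exact: addr_ge0.
rewrite opprD addrACA (le_trans (ler_normD _ _))// !mulrDl.
have g := wtD_ge1 v w.
by apply: lerD; [apply: (le_trans (H _ _))|apply: (le_trans (K _ _))];
  rewrite ler_wpM2r ?sumr_ge0// ler_wpM2l// ler_weXn2l// ?leq_addr ?leq_addl.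
Qed.

Lemma plipM n (F G : ('I_n -> R) -> R) : plip F -> plip G ->
  plip (fun v => F v * G v).
Proof.
move=> pF pG; have [A [a [A0 bF]]] := plip_pgn pF; have [B [b [B0 bG]]] := plip_pgn pG.
case: pF pG => [C [k [C0 H]]] [D [l [D0 K]]].
exists (A * D + B * C), (a + b + k + l)%N.
split=> [|v w]; first by rewrite addr_ge0// mulr_ge0.
have -> : F v * G v - F w * G w = F v * (G v - G w) + G w * (F v - F w) by ring.
rewrite (le_trans (ler_normD _ _))// !normrM !mulrDl.
have g := wtD_ge1 v w; have g0 := le_trans ler01 g.
have s0 : 0 <= \sum_i `|v i - w i| by rewrite sumr_ge0.
have lev : wt v <= wt v + wt w by rewrite lerDl wt_ge0.
have lew : wt w <= wt v + wt w by rewrite lerDr wt_ge0.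
apply: lerD.
  apply: (@le_trans _ _ ((A * wt v ^+ a) * (D * (wt v + wt w) ^+ l * \sum_i `|v i - w i|))).
    by rewrite ler_pM.
  rewrite mulrA mulrACA ler_wpM2r// ler_wpM2l ?mulr_ge0//.
  apply: (@le_trans _ _ ((wt v + wt w) ^+ a * (wt v + wt w) ^+ l)).
    by rewrite ler_wpM2r ?exprn_ge0// lerXn2r// nnegrE ?wt_ge0.
  by rewrite -exprD ler_weXn2l// leq_add2r -addnA leq_addr.
apply: (@le_trans _ _ ((B * wt w ^+ b) * (C * (wt v + wt w) ^+ k * \sum_i `|v i - w i|))).
  by rewrite ler_pM.
rewrite mulrA mulrACA ler_wpM2r// ler_wpM2l ?mulr_ge0//.
apply: (@le_trans _ _ ((wt v + wt w) ^+ b * (wt v + wt w) ^+ k)).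
  by rewrite ler_wpM2r ?exprn_ge0// lerXn2r// nnegrE ?wt_ge0.
by rewrite -exprD ler_weXn2l// (leq_trans (leq_addl a _))// addnA leq_addr.
Qed.

Lemma plipZ n C (F : ('I_n -> R) -> R) : plip F -> plip (fun v => C * F v).
Proof. by apply: plipM; exact: plip_cst. Qed.

Lemma plipN n (F : ('I_n -> R) -> R) : plip F -> plip (fun v => - F v).
Proof.
by move=> [C [k [C0 H]]]; exists C, k; split=> // v w; rewrite -opprD normrN H.
Qed.

Lemma plip_sum n (I : Type) (r : seq I) (P : pred I) (F : I -> ('I_n -> R) -> R) :
  (forall i, plip (F i)) -> plip (fun v => \sum_(i <- r | P i) F i v).
Proof.
move=> H; elim: r => [|a r IH].
  have -> : (fun v => \sum_(i <- [::] | P i) F i v) = (fun=> 0).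
    by apply/funext => v; rewrite big_nil.
  exact: plip_cst.
have -> : (fun v => \sum_(i <- a :: r | P i) F i v) =
  (fun v => (P a)%:R * F a v + \sum_(i <- r | P i) F i v).
  apply/funext => v; rewrite big_cons; case: (P a); first by rewrite mul1r.
  by rewrite mul0r add0r.
by apply: plipD => //; exact: plipZ.
Qed.

Lemma plip_prod n (I : Type) (r : seq I) (F : I -> ('I_n -> R) -> R) :
  (forall i, plip (F i)) -> plip (fun v => \prod_(i <- r) F i v).
Proof.
move=> H; elim: r => [|a r IH].
  have -> : (fun v => \prod_(i <- [::]) F i v) = (fun=> 1).
    by apply/funext => v; rewrite big_nil.
  exact: plip_cst.
have -> : (fun v => \prod_(i <- a :: r) F i v) =
  (fun v => F a v * \prod_(i <- r) F i v).
  by apply/funext => v; rewrite big_cons.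
exact: plipM.
Qed.

Lemma plip_norm n (F : ('I_n -> R) -> R) : plip F -> plip (fun v => `|F v|).
Proof.
move=> [C [k [C0 H]]]; exists C, k; split=> // v w.
by apply: le_trans (H v w); exact: ler_dist_dist.
Qed.

Lemma plipX n (F : ('I_n -> R) -> R) k : plip F -> plip (fun v => F v ^+ k).
Proof.
move=> pF; elim: k => [|k IH]; first exact: plip_cst.
have -> : (fun v => F v ^+ k.+1) = (fun v => F v * F v ^+ k).
  by apply/funext => v; rewrite exprS.
exact: plipM.
Qed.

Lemma plip_wtX n k : plip (fun v : 'I_n -> R => wt v ^+ k).
Proof.
apply: plipX; apply: plipD; first exact: plip_cst.
by apply: plip_sum => i; apply: plip_norm; exact: plip_coord.
Qed.

Lemma consv0 n x (v : 'I_n -> R) : consv x v ord0 = x.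
Proof. by rewrite /consv unlift_none. Qed.

Lemma consvS n x (v : 'I_n -> R) j : consv x v (lift ord0 j) = v j.
Proof. by rewrite /consv liftK. Qed.

Lemma wt_consv n x (v : 'I_n -> R) : wt (consv x v) = `|x| + wt v.
Proof.
rewrite /wt big_ord_recl consv0 addrCA; congr (_ + (_ + _)).
by apply: eq_bigr => i _; rewrite consvS.
Qed.

Lemma wt_consv_le n x (v : 'I_n -> R) : wt (consv x v) <= (1 + `|x|) * wt v.
Proof. by rewrite wt_consv mulrDl mul1r addrC lerD2l ler_peMr// wt_ge1. Qed.

Lemma plip_slice n (F : ('I_n.+1 -> R) -> R) x : plip F ->
  plip (fun v => F (consv x v)).
Proof.
move=> [C [k [C0 H]]]; exists (C * (1 + `|x|) ^+ k), k.
split=> [|v w]; first by rewrite mulr_ge0// exprn_ge0// addr_ge0.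
apply: (le_trans (H _ _)).
rewrite big_ord_recl !consv0 subrr normr0 add0r.
under eq_bigr do rewrite !consvS.
rewrite ler_wpM2r ?sumr_ge0// -mulrA ler_wpM2l// -exprMn lerXn2r// ?nnegrE.
- by rewrite addr_ge0// wt_ge0.
- by rewrite mulr_ge0// addr_ge0// wt_ge0.
- by rewrite mulrDr lerD// wt_consv_le.
Qed.

(** The properties are bundled because the induction on [n] needs them together: linearity and
    monotonicity of the inner integral make it a continuous function of polynomial growth of the
    outer coordinate, which is what the one-dimensional lemmas require. *)
Definition gfunctional n := [/\
  forall F G : ('I_n -> R) -> R, plip F -> plip G ->
    gexp (fun v => F v + G v) = gexp F + gexp G,
  forall C (F : ('I_n -> R) -> R), plip F -> gexp (fun v => C * F v) = C * gexp F,
  forall F G : ('I_n -> R) -> R, plip F -> plip G -> (forall v, F v <= G v) ->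
    gexp F <= gexp G &
  forall C, gexp (fun _ : 'I_n -> R => C) = C].

Lemma gfunctional_slice n (F : ('I_n.+1 -> R) -> R) : gfunctional n -> plip F ->
  continuous (fun x => gexp (fun v => F (consv x v))) /\
  pgrow (fun x => gexp (fun v => F (consv x v))).
Proof.
move=> [gD gZ gle gc] pF; have [C [k [C0 H]]] := pF.
set f := fun x => _.
set E := gexp (fun v : 'I_n -> R => wt v ^+ k).
have E0 : 0 <= E.
  rewrite -(gc 0); apply: gle; [exact: plip_cst|exact: plip_wtX|].
  by move=> v; rewrite exprn_ge0// wt_ge0.
(* The Lipschitz bound survives the inner integration, since the weights of the two slices add up to
   at most [(2 + |x| + |y|) * wt v]. *)
have B x y : `|f x - f y| <= C * (2 + `|x| + `|y|) ^+ k * `|x - y| * E.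
  have one a b : f a - f b <= C * (2 + `|a| + `|b|) ^+ k * `|a - b| * E.
    rewrite -gZ; last exact: plip_wtX.
    rewrite lerBlDr -gD; [|by apply: plipZ; exact: plip_wtX|exact: plip_slice].
    apply: gle; [exact: plip_slice| |].
      by apply: plipD; [apply: plipZ; exact: plip_wtX|exact: plip_slice].
    move=> v; rewrite -lerBlDr; apply: (le_trans (ler_norm _)).
    apply: (le_trans (H _ _)); rewrite big_ord_recl !consv0 big1 ?addr0; last first.
      by move=> i _; rewrite !consvS subrr normr0.
    rewrite mulrAC -!mulrA ler_wpM2l// [leRHS]mulrCA ler_wpM2l//.
    rewrite -exprMn lerXn2r// ?nnegrE.
    - by rewrite addr_ge0// wt_ge0.
    - by rewrite mulr_ge0 ?wt_ge0// !addr_ge0.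
    - rewrite !wt_consv; have := wt_ge1 v.
      have := normr_ge0 a; have := normr_ge0 b => *; nra.
  rewrite ler_norml one andbT lerNl opprB.
  have := one y x; rewrite distrC.
  by rewrite (_ : 2 + `|y| + `|x| = 2 + `|x| + `|y|)//; ring.
split.
  apply: (@continuous_locLip _ _ (fun x => C * (3 + 2 * `|x|) ^+ k * E)) => x y xy.
  apply: (le_trans (B y x)); rewrite mulrAC ler_wpM2r//.
  rewrite -!mulrA ler_wpM2l// ler_wpM2r// lerXn2r// ?nnegrE ?addr_ge0//.
  have := ler_normD (y - x) x; rewrite subrK => h; lra.
exists (`|f 0| + C * 2 ^+ k * E), k.+1 => x.
have := B x 0; rewrite normr0 addr0 subr0 => h.
rewrite -(subrK (f 0) (f x)) (le_trans (ler_normD _ _))// addrC mulrDl lerD//.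
  by rewrite ler_peMr// exprn_ege1// lerDl.
apply: (le_trans h); rewrite (mulrAC _ E) ler_wpM2r// -!mulrA ler_wpM2l//.
rewrite exprSr mulrA -exprMn ler_pM// ?exprn_ge0 ?addr_ge0// ?lerDr//.
rewrite lerXn2r// ?nnegrE ?addr_ge0 ?mulr_ge0 ?addr_ge0//.
have := normr_ge0 x; lra.
Qed.

Lemma gexpE n (F : ('I_n.+1 -> R) -> R) :
  gexp F = gavg1 (fun x => gexp (fun v => F (consv x v))).
Proof. by []. Qed.

Lemma gfunctionalP n : gfunctional n.
Proof.
elim: n => [|n IH]; first by split => //= F G _ _; exact.
have [gD gZ gle gc] := IH; split.
- move=> F G pF pG; rewrite !gexpE.
  have [cF gF] := gfunctional_slice IH pF.
  have [cG gG] := gfunctional_slice IH pG.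
  rewrite -gavg1D//; congr gavg1; apply/funext => x.
  by rewrite gD//; exact: plip_slice.
- move=> C F pF; rewrite !gexpE; have [cF gF] := gfunctional_slice IH pF.
  rewrite -gavg1Z//; congr gavg1; apply/funext => x.
  by rewrite gZ//; exact: plip_slice.
- move=> F G pF pG FG; rewrite !gexpE.
  have [cF gF] := gfunctional_slice IH pF.
  have [cG gG] := gfunctional_slice IH pG.
  by apply: gavg1_le => // x; apply: gle; do ?exact: plip_slice.
- move=> C; rewrite gexpE -[RHS]gavg1_cst; congr gavg1; apply/funext => x.
  exact: gc.
Qed.

Section Functional.
Context {n : nat}.
Implicit Types F G : ('I_n -> R) -> R.

Lemma gexpD F G : plip F -> plip G -> gexp (fun v => F v + G v) = gexp F + gexp G.
Proof. by case: (gfunctionalP n) => gD *; exact: gD. Qed.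

Lemma gexpZ C F : plip F -> gexp (fun v => C * F v) = C * gexp F.
Proof. by case: (gfunctionalP n) => _ gZ *; exact: gZ. Qed.

Lemma gexp_le F G : plip F -> plip G -> (forall v, F v <= G v) -> gexp F <= gexp G.
Proof. by case: (gfunctionalP n) => _ _ gl *; exact: gl. Qed.

Lemma gexp_cst C : gexp (fun _ : 'I_n -> R => C) = C.
Proof. by case: (gfunctionalP n). Qed.

Lemma gexpN F : plip F -> gexp (fun v => - F v) = - gexp F.
Proof.
move=> pF; rewrite -mulN1r -gexpZ//; congr gexp.
by apply/funext => v; rewrite mulN1r.
Qed.

Lemma gexpB F G : plip F -> plip G -> gexp (fun v => F v - G v) = gexp F - gexp G.
Proof. by move=> pF pG; rewrite gexpD ?gexpN//; exact: plipN. Qed.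

Lemma gexp_sum (I : Type) (r : seq I) (P : pred I) (F : I -> ('I_n -> R) -> R) :
  (forall i, plip (F i)) ->
  gexp (fun v => \sum_(i <- r | P i) F i v) = \sum_(i <- r | P i) gexp (F i).
Proof.
move=> H; elim: r => [|a r IH].
  rewrite big_nil -[RHS](gexp_cst 0); congr gexp.
  by apply/funext => v; rewrite big_nil.
rewrite big_cons.
under eq_fun do rewrite big_cons.
case: (P a) => //; rewrite gexpD ?IH//; exact: plip_sum.
Qed.

Lemma gexp_ge0 F : plip F -> (forall v, 0 <= F v) -> 0 <= gexp F.
Proof. by move=> pF F0; rewrite -(gexp_cst 0); apply: gexp_le => //; exact: plip_cst. Qed.

Lemma gexp_norm_le F G : plip F -> plip G -> (forall v, `|F v| <= G v) ->
  `|gexp F| <= gexp G.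
Proof.
move=> pF pG H; rewrite ler_norml lerNl -gexpN//; apply/andP; split.
  apply: gexp_le => //; first exact: plipN.
  by move=> v; apply: le_trans (H v); rewrite -normrN ler_norm.
by apply: gexp_le => // v; apply: le_trans (H v); rewrite ler_norm.
Qed.

(** Differentiation under the integral: the pointwise Taylor remainder is integrated against a power
    of [wt]. *)
Lemma gexp_is_derive (F : R -> ('I_n -> R) -> R) F' t C k :
  (forall s, plip (F s)) -> plip F' ->
  (forall v s, `|s| <= 1 -> `|F (t + s) v - F t v - s * F' v| <= C * s ^+ 2 * wt v ^+ k) ->
  is_derive t 1 (fun s => gexp (F s)) (gexp F').
Proof.
move=> pF pF' H; apply: (@is_derive_taylor _ _ _ _ (C * gexp (fun v : 'I_n -> R => wt v ^+ k))) => s s1.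
rewrite -gexpZ// -!gexpB//; [|by apply: plipD => //; exact: plipN|exact: plipZ].
rewrite mulrAC -(@gexpZ (C * s ^+ 2) (fun v => wt v ^+ k)); last exact: plip_wtX.
apply: gexp_norm_le => //.
- by apply: plipD; [apply: plipD => //; exact: plipN|apply: plipN; exact: plipZ].
- by apply: plipZ; exact: plip_wtX.
- by move=> v; exact: H.
Qed.
End Functional.

Definition shiftv {n} (i : 'I_n) (s : R) (v : 'I_n -> R) : 'I_n -> R :=
  fun j => v j + (if j == i then s else 0).

(* [F'] is the partial derivative of [F] along coordinate [i], in the quantitative sense that survives integration without any measurability argument. *)
Definition pderiv {n} (i : 'I_n) (F F' : ('I_n -> R) -> R) := exists C k, 0 <= C /\
  forall v s, `|s| <= 1 -> `|F (shiftv i s v) - F v - s * F' v| <= C * s ^+ 2 * wt v ^+ k.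

Lemma shiftv_consv0 n s x (v : 'I_n -> R) : shiftv ord0 s (consv x v) = consv (x + s) v.
Proof.
apply/funext => j; rewrite /shiftv.
case: (unliftP ord0 j) => [l ->|->]; first by rewrite !consvS addr0.
by rewrite !consv0 eqxx.
Qed.

Lemma shiftv_consvS n (i : 'I_n) s x (v : 'I_n -> R) :
  shiftv (lift ord0 i) s (consv x v) = consv x (shiftv i s v).
Proof.
apply/funext => j; rewrite /shiftv.
case: (unliftP ord0 j) => [l ->|->]; rewrite ?consvS ?consv0 /shiftv.
  by rewrite (inj_eq lift_inj).
by rewrite addr0.
Qed.

(** Induction on the outermost coordinate. If it is [i], the one-dimensional formula applies to the
    inner integral, differentiated under the integral sign; otherwise the formula holds on each
    slice. *)
Lemma gexp_ibp n (i : 'I_n) (F F' : ('I_n -> R) -> R) : plip F -> plip F' ->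
  pderiv i F F' -> gexp (fun v => v i * F v) = gexp F'.
Proof.
elim: n i F F' => [[]//|n IH] i F F' pF pF' [C [k [C0 H]]].
have [cF gF] := gfunctional_slice (gfunctionalP n) pF.
have [cF' gF'] := gfunctional_slice (gfunctionalP n) pF'.
case: (unliftP ord0 i) => [j ij|i0]; rewrite !gexpE.
  congr gavg1; apply/funext => x.
  rewrite -(IH j (fun v => F (consv x v)) _ (plip_slice x pF) (plip_slice x pF')).
    by congr gexp; apply/funext => v; rewrite ij consvS.
  exists (C * (1 + `|x|) ^+ k), k; split=> [|v s s1].
    by rewrite mulr_ge0// exprn_ge0// addr_ge0.
  rewrite -shiftv_consvS -ij; apply: (le_trans (H _ _ s1)).
  rewrite -[leRHS]mulrA -[leRHS]mulrA [in leRHS](mulrCA _ (s ^+ 2)) -mulrA ler_wpM2l//.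
  rewrite ler_wpM2l ?sqr_ge0// -exprMn lerXn2r// ?nnegrE ?wt_ge0//.
    by rewrite mulr_ge0 ?wt_ge0// addr_ge0.
  exact: wt_consv_le.
transitivity (gavg1 (fun x => x * gexp (fun v => F (consv x v)))).
  congr gavg1; apply/funext => x; rewrite -gexpZ; last exact: plip_slice.
  by congr gexp; apply/funext => v; rewrite i0 consv0.
apply: gavg1_ibp => // x.
apply: (@gexp_is_derive _ (fun x v => F (consv x v)) _ x (C * (1 + `|x|) ^+ k) k).
- by move=> s; exact: plip_slice.
- exact: plip_slice.
- move=> v s s1; rewrite -shiftv_consv0 -i0; apply: (le_trans (H _ _ s1)).
  rewrite -[leRHS]mulrA -[leRHS]mulrA [in leRHS](mulrCA _ (s ^+ 2)) -mulrA ler_wpM2l//.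
  rewrite ler_wpM2l ?sqr_ge0// -exprMn lerXn2r// ?nnegrE ?wt_ge0//.
    by rewrite mulr_ge0 ?wt_ge0// addr_ge0.
  exact: wt_consv_le.
Qed.
End GaussMulti.

(** * Replica averages under a softmax measure *)

Section Replicas.
Context {R : realType} {T : finType} (t0 : T).
Implicit Types (f g : (nat -> T) -> R) (w : T -> R) (r : nat -> T) (M k l : nat) (B : R).

Definition scons (t : T) r : nat -> T := fun k => if k is k'.+1 then r k' else t.

(* Replica [k] is [r k]; all replicas live in one stream, so that adding replicas needs no cast. Only the first [M] are averaged, the others are frozen at [t0]. *)
Fixpoint Av w M f : R :=
  if M is M'.+1 then \sum_t w t * Av w M' (fun r => f (scons t r))
  else f (fun=> t0).

Definition supp M f := forall r r', (forall k, (k < M)%N -> r k = r' k) -> f r = f r'.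

Definition prob w := (forall t, 0 <= w t) /\ \sum_t w t = 1.

Lemma supp_scons M f t : supp M.+1 f -> supp M (fun r => f (scons t r)).
Proof. by move=> H r r' E; apply: H => -[//|k] /E. Qed.

Lemma supp_le M M' f : (M <= M')%N -> supp M f -> supp M' f.
Proof. by move=> MM H r r' E; apply: H => k kM; apply: E; exact: leq_trans MM. Qed.

Lemma suppM M f g : supp M f -> supp M g -> supp M (fun r => f r * g r).
Proof. by move=> hf hg r r' E; rewrite (hf _ _ E) (hg _ _ E). Qed.

Lemma Av_ext w M f g : f =1 g -> Av w M f = Av w M g.
Proof. by move=> /funext ->. Qed.

Lemma AvD w M f g : Av w M (fun r => f r + g r) = Av w M f + Av w M g.
Proof.
elim: M f g => [//|M IH] f g /=; rewrite -big_split; apply: eq_bigr => t _.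
by rewrite IH mulrDr.
Qed.

Lemma AvZ w M c f : Av w M (fun r => c * f r) = c * Av w M f.
Proof.
elim: M f => [//|M IH] f /=; rewrite big_distrr; apply: eq_bigr => t _ /=.
by rewrite IH mulrCA.
Qed.

Lemma AvN w M f : Av w M (fun r => - f r) = - Av w M f.
Proof. by rewrite -mulN1r -AvZ; apply: Av_ext => r; rewrite mulN1r. Qed.

Lemma AvB w M f g : Av w M (fun r => f r - g r) = Av w M f - Av w M g.
Proof. by rewrite AvD AvN. Qed.

Lemma Av_sum w M (I : Type) (s : seq I) (P : pred I) (F : I -> (nat -> T) -> R) :
  Av w M (fun r => \sum_(i <- s | P i) F i r) = \sum_(i <- s | P i) Av w M (F i).
Proof.
elim: s => [|a s IH].
  rewrite big_nil -[RHS](mul0r (Av w M (fun=> 0))) -AvZ; apply: Av_ext => r.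
  by rewrite big_nil mul0r.
rewrite big_cons -IH; case: ifP => Pa; last first.
  by apply: Av_ext => r; rewrite big_cons Pa.
by rewrite -AvD; apply: Av_ext => r; rewrite big_cons Pa.
Qed.

Lemma Av_le w M f g : (forall t, 0 <= w t) -> (forall r, f r <= g r) ->
  Av w M f <= Av w M g.
Proof.
move=> w0; elim: M f g => [|M IH] f g H /=; first exact: H.
by apply: ler_sum => t _; rewrite ler_wpM2l// IH.
Qed.

Lemma Av_cst w M c : prob w -> Av w M (fun=> c) = c.
Proof.
move=> [w0 w1]; elim: M => [//|M IH] /=; under eq_bigr do rewrite IH.
by rewrite -big_distrl /= w1 mul1r.
Qed.

Lemma Av_norm_le w M f g : (forall t, 0 <= w t) -> (forall r, `|f r| <= g r) ->
  `|Av w M f| <= Av w M g.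
Proof.
move=> w0 H; rewrite ler_norml lerNl -AvN; apply/andP; split; apply: Av_le => // r.
  by apply: le_trans (H r); rewrite -normrN ler_norm.
by apply: le_trans (H r); rewrite ler_norm.
Qed.

Lemma Av_bound w M f B : prob w -> (forall r, `|f r| <= B) -> `|Av w M f| <= B.
Proof. by move=> pw H; rewrite -(Av_cst M B pw); apply: Av_norm_le => //; case: pw. Qed.

Lemma Av_suppS w M f : prob w -> supp M f -> Av w M.+1 f = Av w M f.
Proof.
move=> [w0 w1]; elim: M f => [|M IH] f sf.
  rewrite /= (eq_bigr (fun t => w t * f (fun=> t0))); last first.
    by move=> t _; rewrite (sf _ (fun=> t0)).
  by rewrite -big_distrl /= w1 mul1r.
rewrite [LHS]/= [RHS]/=; apply: eq_bigr => t _; congr (_ * _).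
by apply: IH; exact: supp_scons.
Qed.

Lemma Av_supp w M M' f : prob w -> (M <= M')%N -> supp M f -> Av w M' f = Av w M f.
Proof.
move=> pw /subnKC <- sf; elim: (M' - M)%N => [|d IH]; first by rewrite addn0.
by rewrite addnS Av_suppS//; apply: supp_le sf; rewrite leq_addr.
Qed.

Lemma Av_indep w M f (d : T -> R) : supp M f ->
  Av w M.+1 (fun r => f r * d (r M)) = Av w M f * \sum_t w t * d t.
Proof.
elim: M f => [|M IH] f sf.
  rewrite /= big_distrr; apply: eq_bigr => t _ /=.
  by rewrite (sf _ (fun=> t0))// mulrCA.
rewrite [LHS]/= [Av w M.+1 f]/= big_distrl; apply: eq_bigr => t _ /=.
by rewrite -mulrA -IH//; exact: supp_scons.
Qed.

(** Freezing at [t0] beyond [M] matches the base case of [Av]. *)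
Definition exn M (rho : {ffun 'I_M -> T}) : nat -> T :=
  fun k => if insub k is Some i then rho i else t0.

Lemma exn_ord M (rho : {ffun 'I_M -> T}) (k : 'I_M) : exn rho k = rho k.
Proof. by rewrite /exn valK. Qed.

Lemma exn_lt M (rho : {ffun 'I_M -> T}) k (kM : (k < M)%N) :
  exn rho k = rho (Ordinal kM).
Proof. by rewrite /exn insubT. Qed.

Lemma exn_ge M (rho : {ffun 'I_M -> T}) k : (M <= k)%N -> exn rho k = t0.
Proof. by move=> kM; rewrite /exn insubF// ltnNge kM. Qed.

Definition fcons M (t : T) (rho : {ffun 'I_M -> T}) : {ffun 'I_M.+1 -> T} :=
  [ffun i => oapp rho t (unlift ord0 i)].

Lemma exn_fcons M t (rho : {ffun 'I_M -> T}) : exn (fcons t rho) = scons t (exn rho).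
Proof.
apply/funext => -[|k] /=; first by rewrite exn_lt ffunE (_ : Ordinal _ = ord0) ?unlift_none//; exact: val_inj.
case: (ltnP k M) => kM; last by rewrite !exn_ge.
rewrite (@exn_lt _ _ k.+1) (exn_lt _ kM) ffunE.
by rewrite (_ : Ordinal _ = lift ord0 (Ordinal kM)) ?liftK//; exact: val_inj.
Qed.

(** Bridge between the recursive average and the sum over finite functions in [gibbs_avg]. In the
    second form a permutation of replicas is a change of variable. *)
Lemma AvE w M f :
  Av w M f = \sum_(rho : {ffun 'I_M -> T}) (\prod_(k < M) w (rho k)) * f (exn rho).
Proof.
elim: M f => [|M IH] f.
  pose r0 : {ffun 'I_0 -> T} := [ffun=> t0].
  rewrite (bigD1 r0)//= big_ord0 mul1r big1 ?addr0; last first.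
    by move=> i /eqP[]; apply/ffunP => -[].
  by congr f; apply/funext => k; rewrite exn_ge.
rewrite /=; under eq_bigr do rewrite IH big_distrr /=.
rewrite pair_big /=.
rewrite [RHS](reindex (fun p : T * {ffun 'I_M -> T} => fcons p.1 p.2)) /=; last first.
  exists (fun rho => (rho ord0, [ffun i => rho (lift ord0 i)])) => [[t rho] _|rho _] /=.
    rewrite ffunE unlift_none; congr pair; apply/ffunP => i.
    by rewrite !ffunE liftK.
  apply/ffunP => i; rewrite ffunE; case: (unliftP ord0 i) => [j ->|->] //=.
  by rewrite ffunE.
apply: eq_bigr => -[t rho] _ /=; rewrite exn_fcons mulrA; congr (_ * _).
rewrite big_ord_recl ffunE unlift_none /=; congr (_ * _).
by apply: eq_bigr => i _; rewrite ffunE liftK.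
Qed.

(** A transposition of all of [nat], so that it acts on streams and on replica labels alike. *)
Definition sw k l : nat -> nat := fun i => if i == k then l else if i == l then k else i.

Lemma Av_swap w M f k l : (k < M)%N -> (l < M)%N ->
  Av w M (fun r => f (r \o sw k l)) = Av w M f.
Proof.
move=> kM lM; rewrite !AvE.
pose p := tperm (Ordinal kM) (Ordinal lM).
pose h (rho : {ffun 'I_M -> T}) : {ffun 'I_M -> T} := [ffun i => rho (p i)].
have hK : involutive h by move=> rho; apply/ffunP => i; rewrite !ffunE tpermK.
rewrite (reindex_inj (inv_inj hK)); apply: eq_bigr => rho _ /=; congr (_ * f _).
  rewrite [RHS](reindex_inj (@perm_inj _ p)); apply: eq_bigr => i _.
  by rewrite ffunE.
apply/funext => i /=; case: (ltnP i M) => iM; last first.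
  rewrite /sw; case: eqP => [ik|_]; first by have := kM; rewrite -ik ltnNge iM.
  by case: eqP => [il|_]; [have := lM; rewrite -il ltnNge iM|rewrite !exn_ge].
have -> : sw k l i = p (Ordinal iM).
  rewrite /sw /p; case: tpermP => [/(congr1 val) /= ->|/(congr1 val) /= ->|/eqP ik /eqP il].
  - by rewrite eqxx.
  - by rewrite eqxx; case: eqP.
  - by move: ik il; rewrite -!(inj_eq val_inj) /= => /negbTE -> /negbTE ->.
by rewrite exn_ord ffunE tpermK (exn_lt _ iM).
Qed.

Definition softmax (e : T -> R) : T -> R := fun t => expR (e t) / \sum_u expR (e u).

Lemma sum_expR_gt0 (e : T -> R) : 0 < \sum_u expR (e u).
Proof.
by rewrite (bigD1 t0)//= ltr_pwDl ?expR_gt0// sumr_ge0// => i _; rewrite expR_ge0.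
Qed.

Lemma softmax_prob e : prob (softmax e).
Proof.
split=> [t|]; first by rewrite divr_ge0 ?expR_ge0// ltW// sum_expR_gt0.
by rewrite -big_distrl /= mulfV// gt_eqF// sum_expR_gt0.
Qed.

(** The upper bound comes from [expR x * (1 - x) <= expR x * expR (- x) = 1] together with [(1 + x +
    2 * x ^+ 2) * (1 - x) = 1 + x ^+ 2 * (1 - 2 * x)]. *)
Lemma expR_taylor2 (x : R) : `|x| <= 1 / 2 -> `|expR x - 1 - x| <= 2 * x ^+ 2.
Proof.
move=> hx; have h1 := expR_ge1Dx x; have h2 := expR_ge1Dx (- x).
have e0 := expR_gt0 x; have ee : expR x * expR (- x) = 1 by rewrite expRN mulfV// gt_eqF.
move: hx; rewrite ler_norml => /andP[xl xu].
rewrite ler_norml; apply/andP; split; first by have := sqr_ge0 x; lra.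
have h3 : expR x * (1 - x) <= 1 by rewrite -[leRHS]ee ler_wpM2l// ltW.
have h4 : 1 <= (1 + x + 2 * x ^+ 2) * (1 - x).
  have := mulr_ge0 (sqr_ge0 x) (_ : 0 <= 1 - 2 * x).
  rewrite subr_ge0 => /(_ _) h; have := h (ltac:(lra)); nra.
have : expR x <= 1 + x + 2 * x ^+ 2.
  rewrite -(ler_pM2r (_ : 0 < 1 - x)); last by lra.
  exact: le_trans h3 h4.
lra.
Qed.

Definition wmean w (d : T -> R) : R := \sum_t w t * d t.

Lemma wsum_le w (g : T -> R) B : prob w -> (forall t, `|g t| <= w t * B) ->
  \sum_t `|g t| <= B.
Proof.
move=> [w0 w1] H; apply: (@le_trans _ _ (\sum_t w t * B)); first exact: ler_sum.
by rewrite -big_distrl /= w1 mul1r.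
Qed.

Lemma wmean_bound w d B : prob w -> (forall t, `|d t| <= B) -> `|wmean w d| <= B.
Proof.
move=> pw H; have [w0 w1] := pw; rewrite (le_trans (ler_norm_sum _ _ _))//.
by apply: (@wsum_le w) => // t; rewrite normrM ger0_norm// ler_wpM2l.
Qed.

Lemma softmax_shift e d t : softmax (fun t => e t + d t) t =
  softmax e t * expR (d t) / wmean (softmax e) (fun t => expR (d t)).
Proof.
rewrite /softmax /wmean expRD.
have -> : \sum_u expR (e u + d u) = \sum_u expR (e u) * expR (d u).
  by apply: eq_bigr => u _; rewrite expRD.
have -> : \sum_u expR (e u) / (\sum_v expR (e v)) * expR (d u) =
  (\sum_u expR (e u) * expR (d u)) / (\sum_v expR (e v)).
  by rewrite big_distrl /=; apply: eq_bigr => u _; rewrite mulrAC.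
have h1 := sum_expR_gt0 e.
have h2 : 0 < \sum_u expR (e u) * expR (d u).
  by rewrite (bigD1 t0)//= ltr_pwDl ?mulr_gt0 ?expR_gt0// sumr_ge0// => i _; rewrite mulr_ge0 ?expR_ge0.
by field; rewrite !gt_eqF.
Qed.

(** To first order, a change [d] of the energy multiplies each weight by one plus the centered value
    of [d]. *)
Lemma softmax_taylor e d B : (forall t, `|d t| <= B) ->
  \sum_t `|softmax (fun t => e t + d t) t - softmax e t
           - softmax e t * (d t - wmean (softmax e) d)| <= 16 * B ^+ 2 /\
  \sum_t `|softmax (fun t => e t + d t) t - softmax e t| <= 16 * B.
Proof.
move=> H; have B0 : 0 <= B by exact: le_trans (normr_ge0 _) (H t0).
set w := softmax e; set w' := softmax _; set m := wmean w d.
have pw := softmax_prob e; have pw' : prob w' by exact: softmax_prob.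
have [w0 w1] := pw; have [w0' w1'] := pw'; rewrite -/w in w0 w1 pw.
have mB : `|m| <= B by exact: wmean_bound.
have dm t : `|d t - m| <= 2 * B.
  by rewrite (le_trans (ler_normB _ _))// (_ : 2 * B = B + B) ?lerD//; ring.
have sdm : \sum_t `|w t * (d t - m)| <= 2 * B.
  by apply: (@wsum_le w) => // t; rewrite normrM ger0_norm// ler_wpM2l.
have sww : \sum_t `|w' t - w t| <= 2.
  rewrite (_ : 2 = \sum_t (w' t + w t)); last by rewrite big_split /= w1' w1.
  apply: ler_sum => t _; rewrite (le_trans (ler_normB _ _))//.
  by rewrite !ger0_norm.
have tri (a b : T -> R) : \sum_t `|a t + b t| <= \sum_t `|a t| + \sum_t `|b t|.
  by rewrite -big_split; apply: ler_sum => t _; exact: ler_normD.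
(* For large [B] the trivial total variation bound 2 is enough. *)
case: (lerP B (1 / 2)) => hB; last first.
  split.
    apply: (@le_trans _ _ (2 + 2 * B)); last by nra.
    apply: (le_trans (tri _ _)); apply: lerD => //.
    by under eq_bigr do rewrite normrN.
  by apply: (le_trans sww); lra.
have main : \sum_t `|w' t - w t - w t * (d t - m)| <= 16 * B ^+ 2.
  pose r t := expR (d t) - 1 - d t.
  have rB t : `|r t| <= 2 * B ^+ 2.
    rewrite /r; apply: (le_trans (expR_taylor2 (le_trans (H t) hB))).
    by rewrite ler_wpM2l// -(real_normK (num_real (d t))) lerXn2r// nnegrE.
  pose mr := wmean w r.
  have mrB : `|mr| <= 2 * B ^+ 2 by exact: wmean_bound.
  pose Z := wmean w (fun t => expR (d t)).
  have ZE : Z = 1 + m + mr.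
    rewrite -w1 /Z /m /mr /wmean -big_split -[RHS]big_split /=; apply: eq_bigr => t _.
    by rewrite /r; ring.
  have Z2 : 1 / 2 <= Z.
    rewrite -[leLHS](Av_cst 1 _ pw); apply: ler_sum => t _.
    rewrite ler_wpM2l//=; apply: le_trans (expR_ge1Dx _).
    have := H t; rewrite ler_norml => /andP[? ?]; lra.
  apply: (@wsum_le w) => // t.
  have Z0 : Z != 0 by rewrite gt_eqF//; lra.
  have -> : w' t - w t - w t * (d t - m) =
     w t * ((r t - mr * (1 + d t - m) - m * (d t - m)) / Z).
    rewrite /w' softmax_shift -/w -/Z.
    have -> : expR (d t) = 1 + d t + r t by rewrite /r; ring.
    have -> : mr = Z - 1 - m by rewrite ZE; ring.
    by field.
  rewrite normrM ger0_norm// ler_wpM2l// normrM normfV.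
  rewrite ler_pdivrMr ?normr_gt0// (@ger0_norm _ Z); last by lra.
  (* The numerator is at most [8 * B ^+ 2]; dividing by [Z >= 1 / 2] gives the constant 16. *)
  apply: (@le_trans _ _ (2 * B ^+ 2 + 2 * B ^+ 2 * 2 + B * (2 * B))).
    rewrite (le_trans (ler_normB _ _))// lerD//; last by rewrite normrM ler_pM.
    rewrite (le_trans (ler_normB _ _))// lerD// normrM ler_pM//.
    rewrite -addrA (le_trans (ler_normD _ _))// normr1.
    have := dm t; lra.
  have := sqr_ge0 B; nra.
split=> //.
have -> : \sum_t `|w' t - w t| =
   \sum_t `|(w' t - w t - w t * (d t - m)) + w t * (d t - m)|.
  by apply: eq_bigr => t _; rewrite subrK.
apply: (le_trans (tri _ _)); nra.
Qed.

(* Derivative of the [M]-replica average in the direction [d] of the energy: one extra replica implements the subtraction of the Gibbs mean. *)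
Definition dirw M (d : T -> R) r : R := \sum_(k < M) (d (r k) - d (r M)).

(** The first replica is split off. Its own term averages to [d t - wmean w d], the subtracted
    replica being independent of the rest; the other terms form the same expression with one replica
    fewer. *)
Lemma Av_dirwS w M f d : prob w -> supp M.+1 f ->
  Av w M.+2 (fun r => f r * dirw M.+1 d r) =
  \sum_t (w t * (d t - wmean w d)) * Av w M (fun r => f (scons t r)) +
  \sum_t w t * Av w M.+1 (fun r => f (scons t r) * dirw M d r).
Proof.
move=> pw sf.
transitivity (\sum_t w t * Av w M.+1 (fun r => f (scons t r) * dirw M.+1 d (scons t r))) => //.
rewrite -big_split; apply: eq_bigr => t _.
have sft := supp_scons t sf.
have -> : Av w M.+1 (fun r => f (scons t r) * dirw M.+1 d (scons t r)) =
  Av w M.+1 (fun r => (d t * f (scons t r) - f (scons t r) * d (r M))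
                       + f (scons t r) * dirw M d r).
  apply: Av_ext => r; rewrite /dirw big_ord_recl /=; ring.
rewrite AvD AvB AvZ Av_indep// Av_suppS// -/(wmean w d) /=; ring.
Qed.

(** A discrete product rule. Primes denote perturbed quantities and [a] the average over the
    remaining replicas: the remainder of [w' a'] is the remainder of [w'] times [a], plus [w] times
    the remainder of [a'], plus [(w' - w) * (a' - a)]. These give the three summands of
    [16 + C + 16 * C]. *)
Lemma Av_taylor M : exists2 C : R, 0 <= C & forall e d B f (F : R),
  (forall t, `|d t| <= B) -> (forall r, `|f r| <= F) -> supp M f ->
  `|Av (softmax (fun t => e t + d t)) M f - Av (softmax e) M f
    - Av (softmax e) M.+1 (fun r => f r * dirw M d r)| <= C * F * B ^+ 2 /\
  `|Av (softmax (fun t => e t + d t)) M f - Av (softmax e) M f| <= C * F * B.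
Proof.
elim: M => [|M [C C0 IH]].
  exists 0 => // e d B f F dB fF sf; rewrite !mul0r.
  have -> : (fun r => f r * dirw 0 d r) = (fun=> 0).
    by apply/funext => r; rewrite /dirw big_ord0 mulr0.
  by rewrite (Av_cst _ _ (softmax_prob e)) /= subrr subr0 normr0.
exists (16 + C + 16 * C) => [|e d B f F dB fF sf]; first by lra.
have F0 : 0 <= F by exact: le_trans (normr_ge0 _) (fF (fun=> t0)).
have B0 : 0 <= B by exact: le_trans (normr_ge0 _) (dB t0).
set w := softmax e; set w' := softmax _.
have pw : prob w := softmax_prob e.
have pw' : prob w' := softmax_prob _.
have [w0 w1] := pw.
have [T1 T2] := softmax_taylor e dB; rewrite -/w -/w' in T1 T2.
pose a t := Av w M (fun r => f (scons t r)).
pose a' t := Av w' M (fun r => f (scons t r)).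
pose b t := Av w M.+1 (fun r => f (scons t r) * dirw M d r).
have aF t : `|a t| <= F by exact: Av_bound.
have a1 t : `|a' t - a t - b t| <= C * F * B ^+ 2.
  by have [] := IH e d B (fun r => f (scons t r)) F dB (fun r => fF _) (supp_scons t sf).
have a2 t : `|a' t - a t| <= C * F * B.
  by have [] := IH e d B (fun r => f (scons t r)) F dB (fun r => fF _) (supp_scons t sf).
have avg c (g : T -> R) : (forall t, `|g t| <= c) -> `|\sum_t w t * g t| <= c.
  exact: wmean_bound.
have sumb (g h : T -> R) c : (forall t, `|h t| <= c) ->
    `|\sum_t g t * h t| <= (\sum_t `|g t|) * c.
  move=> hc; rewrite (le_trans (ler_norm_sum _ _ _))// big_distrl /=.
  by apply: ler_sum => t _; rewrite normrM ler_wpM2l.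
split.
  rewrite Av_dirwS// -/w; rewrite [X in X - _ - _]/= [X in _ - X - _]/=.
  have -> : \sum_t w' t * Av w' M (fun r => f (scons t r))
    - \sum_t w t * Av w M (fun r => f (scons t r))
    - (\sum_t (w t * (d t - wmean w d)) * Av w M (fun r => f (scons t r))
       + \sum_t w t * Av w M.+1 (fun r => f (scons t r) * dirw M d r)) =
    \sum_t (w' t - w t - w t * (d t - wmean w d)) * a t
    + \sum_t w t * (a' t - a t - b t) + \sum_t (w' t - w t) * (a' t - a t).
    change (\sum_t w' t * a' t - \sum_t w t * a t
      - (\sum_t (w t * (d t - wmean w d)) * a t + \sum_t w t * b t) =
      \sum_t (w' t - w t - w t * (d t - wmean w d)) * a t
      + \sum_t w t * (a' t - a t - b t) + \sum_t (w' t - w t) * (a' t - a t)).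
    rewrite -[X in _ - _ - X]big_split -[X in X - _ = _]sumrB -[LHS]sumrB.
    rewrite -[X in _ = X + _]big_split -[RHS]big_split /=; apply: eq_bigr => t _.
    by ring.
  apply: (@le_trans _ _ (16 * B ^+ 2 * F + C * F * B ^+ 2 + 16 * B * (C * F * B))).
    rewrite (le_trans (ler_normD _ _))// lerD//.
      rewrite (le_trans (ler_normD _ _))// lerD//; last exact: avg.
      apply: (le_trans (sumb _ _ _ aF)); rewrite ler_wpM2r//.
    apply: (le_trans (sumb _ _ _ a2)); rewrite ler_wpM2r// !mulr_ge0//.
  by rewrite le_eqVlt; apply/orP; left; apply/eqP; ring.
rewrite [X in X - _]/= [X in _ - X]/=.
have -> : \sum_t w' t * Av w' M (fun r => f (scons t r))
    - \sum_t w t * Av w M (fun r => f (scons t r)) =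
    \sum_t (w' t - w t) * a' t + \sum_t w t * (a' t - a t).
  rewrite -[LHS]sumrB -[RHS]big_split /=; apply: eq_bigr => t _.
  by rewrite -/(a t) -/(a' t); ring.
apply: (@le_trans _ _ (16 * B * F + C * F * B)); last first.
  have := mulr_ge0 (mulr_ge0 C0 F0) B0; nra.
rewrite (le_trans (ler_normD _ _))// lerD//; last exact: avg.
have aF' t : `|a' t| <= F by exact: Av_bound.
apply: (le_trans (sumb _ _ _ aF')); rewrite ler_wpM2r//.
Qed.
End Replicas.

(** * Differentiation along a Gaussian interpolation *)

Section Interpolation.
Context {R : realType} {T : finType} (t0 : T) {n : nat}.
Variables (X : 'I_n -> T -> R) (a a' : 'I_n -> R -> R) (c c' : R -> T -> R).

Definition taylor2 (f f' : R -> R) := exists K, 0 <= K /\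
  forall t s, `|s| <= 1 -> `|f (t + s) - f t - s * f' t| <= K * s ^+ 2.

Hypothesis ta : forall j, taylor2 (a j) (a' j).
Hypothesis tc : forall u, taylor2 (c^~ u) (c'^~ u).

Implicit Types (f g : (nat -> T) -> R) (w : T -> R) (r : nat -> T) (M k l : nat) (B t s : R).
Local Notation Av := (@Av R T t0).

(** An arbitrary function of streams may be unbounded. Composed with [trunc M] it takes finitely
    many values and is supported on the first [M] replicas, while [Av] at level [M] is unchanged. *)
Definition trunc M r : nat -> T := fun k => if (k < M)%N then r k else t0.

Lemma trunc_exn M (rho : {ffun 'I_M -> T}) : trunc M (exn t0 rho) = exn t0 rho.
Proof.
by apply/funext => k; rewrite /trunc; case: ltnP => // kM; rewrite exn_ge.
Qed.

Lemma Av_trunc w M f : Av w M f = Av w M (fun r => f (trunc M r)).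
Proof. by rewrite !AvE; apply: eq_bigr => rho _; rewrite trunc_exn. Qed.

Lemma supp_trunc M f : supp M (fun r => f (trunc M r)).
Proof.
move=> r r' E; congr f; apply/funext => k; rewrite /trunc.
by case: ltnP => // /E.
Qed.

Lemma trunc_bounded M f : exists2 B : R, 0 <= B & forall r, `|f (trunc M r)| <= B.
Proof.
exists (\sum_(rho : {ffun 'I_M -> T}) `|f (exn t0 rho)|) => [|r].
  by rewrite sumr_ge0.
pose rho : {ffun 'I_M -> T} := [ffun i : 'I_M => r i].
have -> : trunc M r = exn t0 rho.
  apply/funext => k; rewrite /trunc; case: ltnP => kM; last by rewrite exn_ge.
  by rewrite (exn_lt _ _ kM) ffunE.
by rewrite (bigD1 rho)//= lerDl sumr_ge0.
Qed.

Definition energy t (v : 'I_n -> R) (u : T) : R := \sum_j a j t * X j u * v j + c t u.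

Definition nuT t M f : R := gexp (fun v => Av (softmax (energy t v)) M f).

(** The energy is affine in the disorder and [Av] is Lipschitz in the energy, so the average is
    globally Lipschitz in the disorder. *)
Lemma plip_Av t M f : plip (fun v => Av (softmax (energy t v)) M f).
Proof.
have [F F0 fF] := trunc_bounded M f.
have [C C0 H] := @Av_taylor R T t0 M.
pose A := \sum_u \sum_j `|a j t * X j u|.
have A0 : 0 <= A by rewrite sumr_ge0// => u _; rewrite sumr_ge0.
exists (C * F * A), 0; split=> [|v w]; first by rewrite !mulr_ge0.
pose d u := \sum_j a j t * X j u * (v j - w j).
have dB u : `|d u| <= A * \sum_j `|v j - w j|.
  apply: (@le_trans _ _ (\sum_j `|a j t * X j u| * `|v j - w j|)).
    by rewrite (le_trans (ler_norm_sum _ _ _))//; apply: ler_sum => j _; rewrite normrM.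
  rewrite big_distrr /=; apply: ler_sum => j _; rewrite ler_wpM2r//.
  rewrite /A (bigD1 u)//= (bigD1 j)//= -addrA lerDl addr_ge0 ?sumr_ge0// => i _.
  by rewrite sumr_ge0.
have [_] := H (energy t w) d _ _ F dB fF (supp_trunc f).
rewrite !(Av_trunc _ M f) expr0 mulr1.
have -> : energy t v = (fun u => energy t w u + d u).
  apply/funext => u; rewrite /energy /d addrAC -big_split /=; congr (_ + _).
  by apply: eq_bigr => j _; ring.
by rewrite !mulrA.
Qed.

Lemma nuT_ext t M f g : f =1 g -> nuT t M f = nuT t M g.
Proof. by move=> /funext ->. Qed.

Lemma nuTD t M f g : nuT t M (fun r => f r + g r) = nuT t M f + nuT t M g.
Proof.
rewrite /nuT -gexpD; [|exact: plip_Av|exact: plip_Av].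
by congr gexp; apply/funext => v; rewrite AvD.
Qed.

Lemma nuTZ t M s f : nuT t M (fun r => s * f r) = s * nuT t M f.
Proof.
rewrite /nuT -gexpZ; last exact: plip_Av.
by congr gexp; apply/funext => v; rewrite AvZ.
Qed.

Lemma nuTN t M f : nuT t M (fun r => - f r) = - nuT t M f.
Proof. by rewrite -mulN1r -nuTZ; apply: nuT_ext => r; rewrite mulN1r. Qed.

Lemma nuTB t M f g : nuT t M (fun r => f r - g r) = nuT t M f - nuT t M g.
Proof. by rewrite nuTD nuTN. Qed.

Lemma nuT_sum t M (I : Type) (s : seq I) (P : pred I) (F : I -> (nat -> T) -> R) :
  nuT t M (fun r => \sum_(i <- s | P i) F i r) = \sum_(i <- s | P i) nuT t M (F i).
Proof.
rewrite /nuT -gexp_sum; last by move=> i; exact: plip_Av.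
by congr gexp; apply/funext => v; rewrite Av_sum.
Qed.

Lemma nuT_cst t M s : nuT t M (fun=> s) = s.
Proof.
rewrite /nuT -[RHS](gexp_cst (n := n)); congr gexp; apply/funext => v.
by rewrite Av_cst//; exact: softmax_prob.
Qed.

Lemma nuT_le t M f g : (forall r, f r <= g r) -> nuT t M f <= nuT t M g.
Proof.
move=> fg; apply: gexp_le => [||v]; [exact: plip_Av|exact: plip_Av|].
by apply: Av_le => //; case: (softmax_prob t0 (energy t v)).
Qed.

Lemma nuT_ge0 t M f : (forall r, 0 <= f r) -> 0 <= nuT t M f.
Proof. by move=> H; rewrite -(nuT_cst t M 0); exact: nuT_le. Qed.

Lemma nuT_norm_le t M f g : (forall r, `|f r| <= g r) -> `|nuT t M f| <= nuT t M g.
Proof.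
move=> H; rewrite ler_norml lerNl -nuTN; apply/andP; split; apply: nuT_le => r.
  by apply: le_trans (H r); rewrite -normrN ler_norm.
by apply: le_trans (H r); rewrite ler_norm.
Qed.

Lemma nuT_supp t M M' f : (M <= M')%N -> supp M f -> nuT t M' f = nuT t M f.
Proof.
move=> MM sf; congr gexp; apply/funext => v; apply: Av_supp => //.
exact: softmax_prob.
Qed.

Lemma nuT_swap t M f k l : (k < M)%N -> (l < M)%N ->
  nuT t M (fun r => f (r \o sw k l)) = nuT t M f.
Proof. by move=> kM lM; congr gexp; apply/funext => v; apply: Av_swap. Qed.

Lemma dirwZ M (d : T -> R) s r : dirw M (fun u => s * d u) r = s * dirw M d r.
Proof. by rewrite /dirw big_distrr; apply: eq_bigr => k _ /=; ring. Qed.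

Lemma dirwD M (d e : T -> R) r : dirw M (fun u => d u + e u) r = dirw M d r + dirw M e r.
Proof. by rewrite /dirw -big_split; apply: eq_bigr => k _ /=; ring. Qed.

Lemma dirwB M (d e : T -> R) r : dirw M (fun u => d u - e u) r = dirw M d r - dirw M e r.
Proof. by rewrite /dirw -sumrB; apply: eq_bigr => k _ /=; ring. Qed.

Lemma dirw_sum M (I : finType) (d : I -> T -> R) r :
  dirw M (fun u => \sum_i d i u) r = \sum_i dirw M (d i) r.
Proof. by rewrite /dirw exchange_big; apply: eq_bigr => k _ /=; rewrite sumrB. Qed.

Lemma supp_dirw M (d : T -> R) : supp M.+1 (dirw M d).
Proof.
move=> r r' E; apply: eq_bigr => k _; rewrite !E//.
by rewrite (leq_trans (ltn_ord k)).
Qed.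

Lemma dirw_bound M (d : T -> R) B r : (forall u, `|d u| <= B) ->
  `|dirw M d r| <= 2 * M%:R * B.
Proof.
move=> dB; rewrite (le_trans (ler_norm_sum _ _ _))//.
apply: (@le_trans _ _ (\sum_(k < M) (2 * B))).
  apply: ler_sum => k _; rewrite (le_trans (ler_normB _ _))//.
  by rewrite (_ : 2 * B = B + B) ?lerD//; ring.
by rewrite sumr_const card_ord -[leLHS]mulr_natl mulrA (mulrC M%:R).
Qed.

Lemma pderiv_Av t M f j : supp M f ->
  pderiv j (fun v => Av (softmax (energy t v)) M f)
    (fun v => a j t * Av (softmax (energy t v)) M.+1 (fun r => f r * dirw M (X j) r)).
Proof.
move=> sf; have [F F0 fF] := trunc_bounded M f.
have ftr : (fun r => f (trunc M r)) = f.
  by apply/funext => r; apply: sf => k kM; rewrite /trunc kM.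
have {}fF r : `|f r| <= F by rewrite -ftr; exact: fF.
have [C C0 H] := @Av_taylor R T t0 M.
pose A := \sum_u `|a j t * X j u|.
have A0 : 0 <= A by rewrite sumr_ge0.
exists (C * F * A ^+ 2), 0; split=> [|v s s1]; first by rewrite !mulr_ge0// exprn_ge0.
pose d u := s * (a j t * X j u).
have dB u : `|d u| <= `|s| * A.
  by rewrite normrM ler_wpM2l// /A (bigD1 u)//= lerDl sumr_ge0.
have [+ _] := H (energy t v) d _ _ F dB fF sf.
have -> : energy t (shiftv j s v) = (fun u => energy t v u + d u).
  apply/funext => u; rewrite /energy /d addrAC; congr (_ + _).
  rewrite /shiftv (bigD1 j)//= [in RHS](bigD1 j)//= eqxx addrAC.
  rewrite (eq_bigr (fun i => a i t * X i u * v i)); last first.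
    by move=> i /negbTE ->; rewrite addr0.
  by ring.
have -> : (fun r => f r * dirw M d r) = (fun r => (s * a j t) * (f r * dirw M (X j) r)).
  apply/funext => r; rewrite /d dirwZ dirwZ; ring.
rewrite AvZ -mulrA expr0 mulr1 exprMn (real_normK (num_real s)).
by rewrite (_ : C * F * (s ^+ 2 * A ^+ 2) = C * F * A ^+ 2 * s ^+ 2)//; ring.
Qed.

(** Differentiating the Gaussian part of the energy brings down a coordinate [v j] and one extra
    replica. Integration by parts turns [v j] into a derivative of an [M.+1]-replica average, which
    adds the second one. *)
Lemma nuT_derive t M f : supp M f ->
  is_derive t 1 (fun t => nuT t M f)
    (nuT t M.+2 (fun r => f r * \sum_j (a' j t * a j t) * (dirw M (X j) r * dirw M.+1 (X j) r))
     + nuT t M.+1 (fun r => f r * dirw M (c' t) r)).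
Proof.
move=> sf; have [F F0 fF] := trunc_bounded M f.
have ftr : (fun r => f (trunc M r)) = f.
  by apply/funext => r; apply: sf => k kM; rewrite /trunc kM.
have {}fF r : `|f r| <= F by rewrite -ftr; exact: fF.
have [C C0 H] := @Av_taylor R T t0 M.
pose e' v u := \sum_j a' j t * X j u * v j + c' t u.
have [K K0 KH] : exists2 K, 0 <= K & forall v s u, `|s| <= 1 ->
    `|energy (t + s) v u - energy t v u - s * e' v u| <= K * s ^+ 2 * wt v.
  have [Ka KaP] := choice ta.
  have [Kc KcP] := choice tc.
  exists (\sum_u (\sum_j Ka j * `|X j u| + Kc u)) => [|v s u s1].
    rewrite sumr_ge0// => u _; rewrite addr_ge0//; last by case: (KcP u).
    by rewrite sumr_ge0// => j _; rewrite mulr_ge0//; case: (KaP j).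
  apply: (@le_trans _ _ ((\sum_j Ka j * `|X j u| + Kc u) * s ^+ 2 * wt v)); last first.
    rewrite ler_wpM2r ?wt_ge0// ler_wpM2r ?sqr_ge0// (bigD1 u)//= lerDl.
    rewrite sumr_ge0// => i _; rewrite addr_ge0//; last by case: (KcP i).
    by rewrite sumr_ge0// => j _; rewrite mulr_ge0//; case: (KaP j).
  have -> : energy (t + s) v u - energy t v u - s * e' v u =
    \sum_j (a j (t + s) - a j t - s * a' j t) * X j u * v j +
    (c (t + s) u - c t u - s * c' t u).
    have -> : \sum_j (a j (t + s) - a j t - s * a' j t) * X j u * v j =
      \sum_j a j (t + s) * X j u * v j - \sum_j a j t * X j u * v j
      - s * \sum_j a' j t * X j u * v j.
      by rewrite big_distrr -!sumrB; apply: eq_bigr => j _ /=; ring.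
    by rewrite /energy /e'; ring.
  rewrite (le_trans (ler_normD _ _))// !mulrDl lerD//; last first.
    have [k0 /(_ t s s1) k1] := KcP u; apply: (le_trans k1).
    by rewrite ler_peMr ?wt_ge1// mulr_ge0// sqr_ge0.
  rewrite !big_distrl (le_trans (ler_norm_sum _ _ _))//=; apply: ler_sum => j _.
  have [k0 /(_ t s s1) k1] := KaP j.
  have vw : `|v j| <= wt v.
    by rewrite /wt (bigD1 j)//= addrCA lerDl addr_ge0// sumr_ge0.
  rewrite !normrM (mulrAC (Ka j)) ler_pM// ?mulr_ge0// ler_pM//.
pose E := \sum_u (\sum_j `|a' j t * X j u| + `|c' t u|).
have E0 : 0 <= E by rewrite sumr_ge0// => u _; rewrite addr_ge0// sumr_ge0.
have eE v u : `|e' v u| <= E * wt v.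
  apply: (@le_trans _ _ ((\sum_j `|a' j t * X j u| + `|c' t u|) * wt v)); last first.
    rewrite ler_wpM2r ?wt_ge0// /E (bigD1 u)//= lerDl sumr_ge0// => i _.
    by rewrite addr_ge0// sumr_ge0.
  rewrite (le_trans (ler_normD _ _))// mulrDl lerD ?ler_peMr ?wt_ge1//.
  rewrite big_distrl (le_trans (ler_norm_sum _ _ _))//=; apply: ler_sum => j _.
  rewrite normrM ler_wpM2l//.
  by rewrite /wt (bigD1 j)//= addrCA lerDl addr_ge0// sumr_ge0.
(* [G v] is the derivative at fixed disorder, before integration by parts. *)
pose G v := \sum_j v j * (a' j t * Av (softmax (energy t v)) M.+1 (fun r => f r * dirw M (X j) r))
  + Av (softmax (energy t v)) M.+1 (fun r => f r * dirw M (c' t) r).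
have GE v : G v = Av (softmax (energy t v)) M.+1 (fun r => f r * dirw M (e' v) r).
  have -> : (fun r => f r * dirw M (e' v) r) =
      (fun r => (\sum_j (v j * a' j t) * (f r * dirw M (X j) r)) + f r * dirw M (c' t) r).
    apply/funext => r; rewrite /e' dirwD dirw_sum mulrDr; congr (_ + _).
    rewrite big_distrr; apply: eq_bigr => j _ /=.
    have -> : dirw M (fun u => a' j t * X j u * v j) r =
       (v j * a' j t) * dirw M (X j) r.
      by rewrite -dirwZ /dirw; apply: eq_bigr => k _; ring.
    by ring.
  by rewrite AvD Av_sum; congr (_ + _); apply: eq_bigr => j _; rewrite AvZ; ring.
have pG : plip G.
  apply: plipD; last exact: plip_Av.
  apply: plip_sum => j; apply: plipM; first exact: plip_coord.
  by apply: plipZ; exact: plip_Av.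
have -> : nuT t M.+2 (fun r => f r * \sum_j (a' j t * a j t) * (dirw M (X j) r * dirw M.+1 (X j) r))
     + nuT t M.+1 (fun r => f r * dirw M (c' t) r) = gexp G.
  rewrite gexpD; last 2 first.
  - apply: plip_sum => j; apply: plipM; first exact: plip_coord.
    by apply: plipZ; exact: plip_Av.
  - exact: plip_Av.
  congr (_ + _); rewrite gexp_sum; last first.
    move=> j; apply: plipM; first exact: plip_coord.
    by apply: plipZ; exact: plip_Av.
  rewrite /nuT.
  have -> : (fun v => Av (softmax (energy t v)) M.+2
     (fun r => f r * \sum_j a' j t * a j t * (dirw M (X j) r * dirw M.+1 (X j) r))) =
    (fun v => \sum_j a' j t * (a j t * Av (softmax (energy t v)) M.+2
     (fun r => (f r * dirw M (X j) r) * dirw M.+1 (X j) r))).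
    apply/funext => v.
    have -> : (fun r => f r * \sum_j a' j t * a j t * (dirw M (X j) r * dirw M.+1 (X j) r)) =
      (fun r => \sum_j (a' j t * a j t) * ((f r * dirw M (X j) r) * dirw M.+1 (X j) r)).
      by apply/funext => r; rewrite big_distrr; apply: eq_bigr => j _ /=; ring.
    by rewrite Av_sum; apply: eq_bigr => j _; rewrite AvZ mulrA.
  rewrite gexp_sum; last by move=> j; do 2 apply: plipZ; exact: plip_Av.
  apply: eq_bigr => j _; rewrite gexpZ; last by apply: plipZ; exact: plip_Av.
  under [in RHS]eq_fun do rewrite mulrCA.
  rewrite [in RHS]gexpZ; last by apply: plipM; [exact: plip_coord|exact: plip_Av].
  congr (_ * _); apply/esym; apply: gexp_ibp; [exact: plip_Av|apply: plipZ; exact: plip_Av|].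
  apply: pderiv_Av; apply: suppM; last exact: supp_dirw.
  by apply: supp_le sf.
(* What remains is the pointwise remainder: that of [Av_taylor] for the energy increment [d], plus
   the error of replacing [d] by its linear part [s * e' v]. *)
apply: (@gexp_is_derive _ _ _ _ _ (C * F * (K + E) ^+ 2 + F * (2 * M%:R * K)) 2) => //.
  by move=> s; exact: plip_Av.
move=> v s s1.
pose d u := energy (t + s) v u - energy t v u.
have ds : `|s| ^+ 2 = s ^+ 2 by rewrite real_normK ?num_real.
have w1 := wt_ge1 v; have w0 := wt_ge0 v.
have dB u : `|d u| <= `|s| * (K + E) * wt v.
  rewrite /d -(subrK (s * e' v u) (energy (t + s) v u - energy t v u)).
  rewrite (le_trans (ler_normD _ _))// (mulrDr `|s|) mulrDl lerD//.
    apply: (le_trans (KH v s u s1)); rewrite ler_wpM2r// mulrC ler_wpM2r//.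
    by rewrite -ds expr2 ler_piMl.
  by rewrite normrM -mulrA ler_wpM2l.
have [+ _] := H (energy t v) d _ _ F dB fF sf.
have -> : (fun u => energy t v u + d u) = energy (t + s) v.
  by apply/funext => u; rewrite /d addrC subrK.
move=> h1; rewrite GE.
set P1 := Av _ _ _; set P2 := Av _ _ _; set P3 := Av _ _ _.
set P4 := Av _ M.+1 (fun r => f r * dirw M d r) in h1.
have -> : P1 - P2 - s * P3 = (P1 - P2 - P4) + (P4 - s * P3) by ring.
have h2 : `|P4 - s * P3| <= F * (2 * M%:R * (K * s ^+ 2 * wt v)).
  rewrite /P4 /P3 -AvZ -AvB; apply: Av_bound => [|r]; first exact: softmax_prob.
  have -> : f r * dirw M d r - s * (f r * dirw M (e' v) r) =
     f r * dirw M (fun u => d u - s * e' v u) r by rewrite dirwB dirwZ; ring.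
  rewrite normrM ler_pM//; apply: dirw_bound => u; exact: KH.
rewrite (le_trans (ler_normD _ _))// (le_trans (lerD h1 h2))//.
rewrite -[leRHS]mulrA [leRHS]mulrDl lerD//.
  by rewrite !exprMn ds le_eqVlt; apply/orP; left; apply/eqP; ring.
have -> : F * (2 * M%:R * (K * s ^+ 2 * wt v)) = F * (2 * M%:R * K) * (s ^+ 2 * wt v) by ring.
rewrite ler_wpM2l ?mulr_ge0// ler_wpM2l ?sqr_ge0//.
by rewrite expr2 ler_peMr.
Qed.

End Interpolation.

(** * The cavity path *)

Section Comparison.
Context {R : realType}.
Local Open Scope classical_set_scope.
Implicit Types (f g phi psi : R -> R) (x t s K : R).

Lemma scaleRE (a b : R) : a *: (b : R^o) = a * b. Proof. by []. Qed.

Lemma is_derive_nonincr f f' s x : (forall t, is_derive t 1 f (f' t)) -> s <= x ->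
  (forall t, s <= t <= x -> f' t <= 0) -> f x <= f s.
Proof.
move=> df x0 f0.
have cf : {within `[s, x]%classic, continuous f}.
  apply: continuous_subspaceT => t.
  by apply/differentiable_continuous/derivable1_diffP; case: (df t).
have [c cx E] := MVT_segment x0 (fun t _ => df t) cf.
by rewrite -subr_le0 E mulr_le0_ge0 ?subr_ge0// f0//; rewrite in_itv /= in cx.
Qed.

Lemma taylor2_bounded f f' f'' K : 0 <= K -> (forall t, is_derive t 1 f (f' t)) ->
  (forall t, is_derive t 1 f' (f'' t)) -> (forall t, `|f'' t| <= K) -> taylor2 f f'.
Proof.
move=> K0 df df' Hf; exists K; split=> // t s _.
have mvt (g g' : R -> R) a b : (forall t, is_derive t 1 g (g' t)) ->
    exists2 c, `|c - a| <= `|b - a| & g b - g a = g' c * (b - a).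
  move=> dg; have cg u v : {within `[u, v]%classic, continuous g}.
    apply: continuous_subspaceT => w.
    by apply/differentiable_continuous/derivable1_diffP; case: (dg w).
  case: (leP a b) => ab.
    have [c] := MVT_segment ab (fun t _ => dg t) (cg _ _).
    rewrite in_itv /= => /andP[ac cb] E; exists c => //.
    by rewrite !ger0_norm ?subr_ge0//; lra.
  have [c] := MVT_segment (ltW ab) (fun t _ => dg t) (cg _ _).
  rewrite in_itv /= => /andP[ac cb] E; exists c.
    by rewrite !ler0_norm ?subr_le0//; [lra|exact: ltW].
  by rewrite -opprB E; ring.
have [c1 hc1 E1] := mvt f f' t (t + s) df.
have [c2 hc2 E2] := mvt f' f'' t c1 df'.
have st : t + s - t = s by ring.
rewrite E1 st (_ : f' c1 * s - s * f' t = s * (f' c1 - f' t)); last by ring.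
rewrite E2 !normrM mulrCA -(real_normK (num_real s)) expr2 ler_pM//.
by rewrite ler_wpM2l//; rewrite st in hc1.
Qed.

Lemma taylor2_cst x : taylor2 (fun=> x) (fun=> 0).
Proof.
by exists 0; split=> // t s _; rewrite subrr mulr0 subrr normr0 mul0r.
Qed.

Lemma taylor2_sin : taylor2 (@sin R) cos.
Proof.
apply: (@taylor2_bounded (@sin R) cos (fun t => - sin t) 1) => // t; rewrite normrN ler_norml.
by rewrite sin_le1 sin_geN1.
Qed.

Lemma taylor2_cos : taylor2 (@cos R) (fun t => - sin t).
Proof.
apply: (@taylor2_bounded (@cos R) (fun t => - sin t) (fun t => - cos t) 1) => // t.
rewrite normrN ler_norml.
by rewrite cos_le1 cos_geN1.
Qed.

Lemma taylor2_cos2 x y : taylor2 (fun t => x + y * cos t ^+ 2) (fun t => - (2 * y) * (sin t * cos t)).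
Proof.
apply: (@taylor2_bounded (fun t => x + y * cos t ^+ 2) (fun t => - (2 * y) * (sin t * cos t)) (fun t => - (2 * y) * (cos t ^+ 2 - sin t ^+ 2)) (4 * `|y|)).
- by rewrite mulr_ge0.
- move=> t; by apply: is_derive_eq; rewrite !scaleRE; field.
- move=> t; by apply: is_derive_eq; rewrite !scaleRE; field.
- move=> t; rewrite normrM normrN normrM (@ger0_norm _ 2)//.
  have h : `|cos t ^+ 2 - sin t ^+ 2| <= 2.
    have h := cos2Dsin2 t; have h1 := sqr_ge0 (cos t); have h2 := sqr_ge0 (sin t).
    by rewrite ler_norml; apply/andP; split; lra.
  have := ler_wpM2l (normr_ge0 y) h; lra.
Qed.

Lemma is_derive_sin2 t : is_derive t 1 (fun t => sin t ^+ 2) (2 * (sin t * cos t)).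
Proof. by apply: is_derive_eq; rewrite !scaleRE; ring. Qed.

Lemma sincos_ge0 t : 0 <= t <= pi / 2 -> 0 <= sin t * cos t.
Proof.
move=> /andP[t0 t1]; have := pi_gt0 R => pi0; rewrite mulr_ge0//.
  by rewrite sin_ge0_pi//; apply/andP; split; lra.
by rewrite cos_ge0_pihalf//; apply/andP; split; lra.
Qed.

(** In the variable [sin t ^+ 2] the derivative of [phi] is [psi / 2]; this is the origin of
    [K / 2]. *)
Lemma interp_bound phi psi K : (forall t, is_derive t 1 phi (sin t * cos t * psi t)) ->
  (forall t, 0 <= t <= pi / 2 -> `|psi t| <= K) ->
  forall t, 0 <= t <= pi / 2 -> `|phi t - phi 0| <= K / 2 * sin t ^+ 2.
Proof.
move=> dphi Hpsi t /andP[t0 t1].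
have main (e : R) : `|e| = 1 -> e * (phi t - phi 0) <= K / 2 * sin t ^+ 2.
  move=> e1; pose g u := e * phi u - K / 2 * sin u ^+ 2.
  have dg u : is_derive u (1 : R) g (sin u * cos u * (e * psi u - K)).
    have d1 := dphi u; have d2 := is_derive_sin2 u.
    by apply: is_derive_eq; rewrite !scaleRE; field.
  have := @is_derive_nonincr g _ 0 t dg t0; rewrite /g sin0 expr0n mulr0 subr0 => H.
  suff : e * phi t - K / 2 * sin t ^+ 2 <= e * phi 0 by lra.
  apply: H => u /andP[u0 u1].
  have ut : 0 <= u <= pi / 2 by rewrite u0 (le_trans u1).
  rewrite mulr_ge0_le0 ?sincos_ge0// subr_le0 (le_trans (ler_norm _))//.
  by rewrite normrM e1 mul1r Hpsi.
have h1 := main 1 (normr1 _); have h2 := main (-1) (normrN1 _).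
by rewrite ler_norml; apply/andP; split; lra.
Qed.

Lemma interp_bound_affine phi psi c K :
  (forall t, is_derive t 1 phi (sin t * cos t * psi t)) ->
  (forall t, 0 <= t <= pi / 2 -> `|psi t - c| <= K) ->
  `|phi (pi / 2) - phi 0 - c / 2| <= K / 2.
Proof.
move=> dphi Hpsi.
pose g t := phi t - c / 2 * sin t ^+ 2.
have dg u : is_derive u (1 : R) g (sin u * cos u * (psi u - c)).
  have d1 := dphi u; have d2 := is_derive_sin2 u.
  by apply: is_derive_eq; rewrite !scaleRE; field.
have ph : 0 <= (pi / 2 : R) <= pi / 2 by rewrite lexx andbT divr_ge0// pi_ge0.
have := interp_bound dg Hpsi ph.
have -> : g (pi / 2) = phi (pi / 2) - c / 2 by rewrite /g sin_pihalf expr1n mulr1.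
have -> : g 0 = phi 0 by rewrite /g sin0 expr0n mulr0 subr0.
rewrite sin_pihalf expr1n mulr1.
by rewrite (_ : phi (pi / 2) - c / 2 - phi 0 = phi (pi / 2) - phi 0 - c / 2)//; ring.
Qed.

(** Gronwall run backwards: [expR (K / 2 * sin t ^+ 2) * phi t] is nondecreasing, so the whole path
    is controlled by its end point, the full system. *)
Lemma interp_gronwall phi psi K : (forall t, is_derive t 1 phi (sin t * cos t * psi t)) ->
  0 <= K -> (forall t, 0 <= phi t) ->
  (forall t, 0 <= t <= pi / 2 -> `|psi t| <= K * phi t) ->
  forall t, 0 <= t <= pi / 2 -> phi t <= expR (K / 2) * phi (pi / 2).
Proof.
move=> dphi K0 phi0 Hpsi t /andP[t0 t1].
pose e u := expR (K / 2 * sin u ^+ 2).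
have de u : is_derive u (1 : R) e (e u * (K * (sin u * cos u))).
  have d2 := is_derive_sin2 u.
  by apply: is_derive_eq; rewrite !scaleRE -/(e u); field.
pose g u := - (e u * phi u).
have dg u : is_derive u (1 : R) g (- (e u *
    (sin u * cos u * (K * phi u + psi u)))).
  have d1 := dphi u; have d3 := de u.
  by apply: is_derive_eq; rewrite !scaleRE; field.
have := @is_derive_nonincr g _ t (pi / 2) dg t1; rewrite /g lerN2 => H.
apply: (@le_trans _ _ (e t * phi t)).
  rewrite ler_peMl// -expR0 ler_expR mulr_ge0 ?sqr_ge0//; lra.
have -> : expR (K / 2) = e (pi / 2) by rewrite /e sin_pihalf expr1n mulr1.
apply: H => u /andP[u0 u1].
have ut : 0 <= u <= pi / 2 by rewrite u1 (le_trans t0).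
rewrite oppr_le0 mulr_ge0 ?expR_ge0// mulr_ge0 ?sincos_ge0//.
have := Hpsi u ut; rewrite ler_norml => /andP[? _]; lra.
Qed.
End Comparison.

Section Cavity.
Context {R : realType} (S N : nat) (beta h D p q : R) (i0 : 'I_N).
Local Notation conf := (config S N).
Local Notation I := (pairsLt N : finType).
Local Notation sv := (@Defs.sval R S).
Implicit Types (r : nat -> conf) (k l M : nat) (s t x : R) (f : (nat -> conf) -> R).

Definition conf0 : conf := [ffun=> ord0].

Lemma sval_bound (s : spin S) : `|sv s| <= S%:R.
Proof.
rewrite /Defs.sval ler_norml; have := ltn_ord s; rewrite ltnS => H.
have h2 : (s : nat)%:R <= S%:R + S%:R :> R by rewrite -natrD ler_nat addnn.
have h1 : 0 <= (s : nat)%:R :> R by [].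
by apply/andP; split; lra.
Qed.

Definition touches (e : I) := ((val e).1 == i0) || ((val e).2 == i0).

(* The Gaussian disorder is extended by a first coordinate, the cavity field acting on site [i0]. *)
Definition cavX (j : 'I_#|I|.+1) (u : conf) : R :=
  if unlift ord0 j is Some e
  then beta / Num.sqrt N%:R * (sv (u (val (enum_val e)).1) * sv (u (val (enum_val e)).2))
  else beta * Num.sqrt q * sv (u i0).

(** The variances of the couplings at [i0] and of the cavity field are weighted by [sin t ^+ 2] and
    [cos t ^+ 2]. The angle avoids the square roots of a linear parametrisation, which are not
    differentiable at the ends. *)
Definition cava (j : 'I_#|I|.+1) t : R :=
  if unlift ord0 j is Some e then (if touches (enum_val e) then sin t else 1) else cos t.

Definition cava' (j : 'I_#|I|.+1) t : R :=
  if unlift ord0 j is Some e then (if touches (enum_val e) then cos t else 0) else - sin t.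

(** The term with [cos t ^+ 2] makes site [i0] at [t = 0] follow the weight [wgt]. Its derivative
    changes the centering of the self-overlap from [q] to [p], see [cavnu_derive]. *)
Definition cavc t (u : conf) : R :=
  (D * (\sum_(j < N) sv (u j) ^+ 2) + h * (\sum_(j < N) sv (u j)))
  + (beta ^+ 2 / 2 * (p - q) * sv (u i0) ^+ 2) * cos t ^+ 2.

Definition cavc' t (u : conf) : R :=
  - (2 * (beta ^+ 2 / 2 * (p - q) * sv (u i0) ^+ 2)) * (sin t * cos t).

Lemma cava_taylor j : taylor2 (cava j) (cava' j).
Proof.
rewrite /cava /cava'; case: (unlift _ _) => [e|]; last exact: taylor2_cos.
case: (touches _); [exact: taylor2_sin|exact: taylor2_cst].
Qed.

Lemma cavc_taylor u : taylor2 (cavc^~ u) (cavc'^~ u).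
Proof. exact: taylor2_cos2. Qed.

(* The path from the system with site [i0] decoupled ([t = 0]) to the full system ([t = pi / 2]). *)
Definition cavnu t M f : R := nuT conf0 cavX cava cavc t M f.

Lemma sum_enum_rank (F : I -> 'I_#|I| -> R) :
  \sum_(j < #|I|) F (enum_val j) j = \sum_(e : I) F e (enum_rank e).
Proof.
rewrite (reindex (@enum_rank I)) /=; last first.
  by apply: onW_bij; exact: enum_rank_bij.
by apply: eq_bigr => e _; rewrite enum_rankK.
Qed.

Lemma cavX0 u : cavX ord0 u = beta * Num.sqrt q * sv (u i0).
Proof. by rewrite /cavX unlift_none. Qed.

Lemma cavXS e u : cavX (lift ord0 e) u =
  beta / Num.sqrt N%:R * (sv (u (val (enum_val e)).1) * sv (u (val (enum_val e)).2)).
Proof. by rewrite /cavX liftK. Qed.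

Lemma energy_cav t x v u :
  energy cavX cava cavc t (consv x v) u =
  cos t * (beta * Num.sqrt q * sv (u i0)) * x +
  beta / Num.sqrt N%:R * (\sum_(e : I) (if touches e then sin t else 1) * v (enum_rank e)
      * (sv (u (val e).1) * sv (u (val e).2)))
  + cavc t u.
Proof.
rewrite /energy big_ord_recl consv0 cavX0 /cava unlift_none; congr (_ + _ + _).
rewrite big_distrr /= -(sum_enum_rank (fun e j => beta / Num.sqrt N%:R *
  ((if touches e then sin t else 1) * v j * (sv (u (val e).1) * sv (u (val e).2))))).
have aux (a b c d : R) : a * (b * c) * d = b * (a * d * c) by ring.
by apply: eq_bigr => e _; rewrite cavXS liftK consvS; exact: aux.
Qed.

Lemma energy_cav_full x v u :
  energy cavX cava cavc (pi / 2) (consv x v) u = Ham beta h D (fun e => v (enum_rank e)) u.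
Proof.
rewrite energy_cav cos_pihalf sin_pihalf !mul0r add0r /Ham /cavc cos_pihalf expr0n mulr0 addr0.
rewrite addrA; congr (_ * _ + _ + _); apply: eq_bigr => e _.
by case: ifP => _; ring.
Qed.

Lemma cavnu_full M f : cavnu (pi / 2) M f =
  gexpT (fun g : I -> R => Av conf0 (softmax (Ham beta h D g)) M f).
Proof.
rewrite /cavnu /nuT /gexpT gexpE -[RHS]gavg1_cst; congr gavg1; apply/funext => x.
congr gexp; apply/funext => v; congr (Av _ (softmax _) _ _).
by apply/funext => u; rewrite energy_cav_full.
Qed.

Lemma nu_cavnu n (F : {ffun 'I_n -> conf} -> R) f :
  (forall rho, F rho = f (exn conf0 rho)) ->
  nu beta h D F = cavnu (pi / 2) n f.
Proof.
move=> H; rewrite cavnu_full /nu; congr gexpT; apply/funext => g.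
by rewrite /gibbs_avg AvE; apply: eq_bigr => rho _; rewrite H.
Qed.

Definition Qn k l : R := if k == l then p else q.
Definition epsr r k : R := sv (r k i0).
Definition ovr r k l : R := N%:R^-1 * \sum_(j < N) sv (r k j) * sv (r l j).
Definition ovrc r k l : R := N%:R^-1 * \sum_(j < N | j != i0) sv (r k j) * sv (r l j).

(* The replica operation of the interpolation formula; [M] and [M.+1] are two new replicas. *)
Definition Gam M (y : nat -> nat -> R) : R :=
  \sum_(k < M) \sum_(l < M.+1) (y k l - y k M.+1 - y M l + y M M.+1).

Lemma sum_pairsLt (F : 'I_N -> 'I_N -> R) :
  \sum_(e : I) F (val e).1 (val e).2 = \sum_(a < N) \sum_(b < N | (a < b)%N) F a b.
Proof.
rewrite pair_big_dep /= (reindex_omap (val : I -> _) insub) /=; last first.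
  by move=> e He; rewrite insubT.
apply: eq_big => e; last by [].
by rewrite (valP e) valK eqxx.
Qed.

(** Each pair containing [i0] occurs once, with [i0] in first or second position; the product does
    not see which. *)
Lemma sum_touches (F : 'I_N -> R) :
  \sum_(e : I | touches e) F (val e).1 * F (val e).2 = F i0 * \sum_(j | j != i0) F j.
Proof.
transitivity (\sum_(e : I) (if touches e then F (val e).1 * F (val e).2 else 0)).
  by rewrite big_mkcond.
rewrite (sum_pairsLt (fun a b => if (a == i0) || (b == i0) then F a * F b else 0)).
rewrite (bigD1 i0)//= eqxx /=.
rewrite (eq_bigr (fun b => F i0 * F b))//.
rewrite big_distrr /= [RHS](bigID (fun j : 'I_N => (i0 < j)%N)) /=; congr (_ + _).
  apply: eq_bigl => j.
  by rewrite andbC; case: ltngtP => // H; rewrite -(inj_eq val_inj) /= gtn_eqF.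
rewrite [RHS]big_mkcond [LHS]big_mkcond /=; apply: eq_bigr => j _.
case: (eqVneq j i0) => //= ji; rewrite (bigID (pred1 i0)) /= [X in _ + X]big1 ?addr0; last first.
  by move=> b /andP[_ /negbTE ->].
case: (ltngtP i0 j) => [H|H|/val_inj H] /=; last by rewrite H eqxx in ji.
  rewrite big_pred0// => b; case: eqP => [->|_]; rewrite ?andbF//.
  by rewrite andbT; apply/negbTE; rewrite -leqNgt ltnW.
rewrite (big_pred1 i0) ?eqxx 1?mulrC// => b /=.
by case: eqP => [->|]; rewrite ?andbF// H.
Qed.

Hypothesis N0 : (0 < N)%N.
Hypothesis q0 : 0 <= q.

(** The couplings at [i0] contribute the overlap without [i0], and the cavity field, whose
    coefficient decreases, contributes [- q]. *)
Lemma cav_cov t (u v : conf) :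
  \sum_j cava' j t * cava j t * (cavX j u * cavX j v) =
  sin t * cos t * beta ^+ 2 * (sv (u i0) * sv (v i0) *
    (N%:R^-1 * \sum_(j < N | j != i0) sv (u j) * sv (v j) - q)).
Proof.
have qq : Num.sqrt q ^+ 2 = q by rewrite sqr_sqrtr.
have NN : (Num.sqrt N%:R)^-1 ^+ 2 = N%:R^-1 :> R by rewrite exprVn sqr_sqrtr.
rewrite big_ord_recl /cava /cava' !unlift_none !cavX0.
rewrite (eq_bigr (fun e : 'I_#|I| => (if touches (enum_val e) then cos t * sin t * (beta / Num.sqrt N%:R) ^+ 2 *
   ((sv (u (val (enum_val e)).1) * sv (v (val (enum_val e)).1)) *
    (sv (u (val (enum_val e)).2) * sv (v (val (enum_val e)).2))) else 0))); last first.
  by move=> e _; rewrite !liftK !cavXS; case: ifP => _; ring.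
rewrite (sum_enum_rank (fun e _ => if touches e then cos t * sin t * (beta / Num.sqrt N%:R) ^+ 2 *
   ((sv (u (val e).1) * sv (v (val e).1)) *
    (sv (u (val e).2) * sv (v (val e).2))) else 0)) -big_mkcond -big_distrr /=.
rewrite (sum_touches (fun j => sv (u j) * sv (v j))) exprMn NN.
by rewrite -[in RHS]qq; ring.
Qed.

Lemma GamD M y z : Gam M (fun k l => y k l + z k l) = Gam M y + Gam M z.
Proof.
rewrite /Gam -big_split; apply: eq_bigr => k _; rewrite -big_split.
by apply: eq_bigr => l _ /=; ring.
Qed.

Lemma GamZ M s y : Gam M (fun k l => s * y k l) = s * Gam M y.
Proof.
rewrite /Gam big_distrr; apply: eq_bigr => k _ /=; rewrite big_distrr.
by apply: eq_bigr => l _ /=; ring.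
Qed.

(** Expanding [(x k - x M) * (x l - x M.+1)] gives the four signed terms of [Gam]. *)
Lemma Gam_dirw M (d : 'I_#|I|.+1 -> conf -> R) (c : 'I_#|I|.+1 -> R) r :
  \sum_j c j * (dirw M (d j) r * dirw M.+1 (d j) r) =
  Gam M (fun k l => \sum_j c j * (d j (r k) * d j (r l))).
Proof.
rewrite /dirw /Gam.
under eq_bigr do rewrite big_distrl /= big_distrr /=.
rewrite exchange_big; apply: eq_bigr => k _ /=.
under eq_bigr do rewrite big_distrr big_distrr /=.
rewrite exchange_big; apply: eq_bigr => l _ /=.
rewrite -!sumrB -big_split; apply: eq_bigr => j _ /=; ring.
Qed.

Lemma Gam_diag0 M (y : nat -> R) :
  Gam M (fun k l => if k == l then y k else 0) = \sum_(k < M) (y k - y M).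
Proof.
rewrite /Gam; apply: eq_bigr => k _.
have kM : (k < M.+1)%N by rewrite ltnS ltnW.
have nk : (k : nat) != M.+1 by rewrite neq_ltn kM.
have nM : M != M.+1 by rewrite neq_ltn ltnSn.
rewrite (negbTE nk) (negbTE nM).
rewrite (eq_bigr (fun l : 'I_M.+1 => (if (k : nat) == l then y k else 0) - (if M == l then y M else 0))); last first.
  by move=> l _; rewrite subr0 addr0.
rewrite sumrB -!big_mkcond /= (big_pred1 (Ordinal kM)); last first.
  by move=> l /=; rewrite eq_sym -(inj_eq val_inj).
by rewrite (big_pred1 (Ordinal (ltnSn M)))// => l /=; rewrite eq_sym -(inj_eq val_inj).
Qed.

(** The covariance centers every pair of replicas at [q]. On the diagonal the missing [p - q] leaves
    a one-replica sum, by [Gam_diag0], which the derivative of [cavc] cancels. *)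
Lemma cavnu_derive t M f : supp M f ->
  is_derive t 1 (fun t => cavnu t M f) (sin t * cos t *
    (beta ^+ 2 * cavnu t M.+2 (fun r => f r *
       Gam M (fun k l => epsr r k * epsr r l * (ovrc r k l - Qn k l))))).
Proof.
move=> sf; have := @nuT_derive _ _ conf0 _ cavX _ _ _ _ cava_taylor cavc_taylor t M f sf.
move=> H; apply: is_derive_eq; rewrite /cavnu mulrA -nuTZ.
rewrite -(@nuT_supp _ _ conf0 _ cavX cava cavc t M.+1 M.+2)//; last first.
  by apply: suppM; [exact: supp_le sf|exact: supp_dirw].
rewrite -nuTD; apply: nuT_ext => r; rewrite -mulrDr mulrCA; congr (_ * _).
rewrite Gam_dirw.
have -> : (fun k l => \sum_j cava' j t * cava j t * (cavX j (r k) * cavX j (r l))) =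
  (fun k l => (sin t * cos t * beta ^+ 2) * (epsr r k * epsr r l * (ovrc r k l - Qn k l))
     + (sin t * cos t * beta ^+ 2 * (p - q)) * (if k == l then epsr r k ^+ 2 else 0)).
  apply/funext => k; apply/funext => l; rewrite cav_cov /Qn -/(ovrc r k l) -/(epsr r k) -/(epsr r l).
  by case: eqP => [->|_]; ring.
rewrite GamD !GamZ (Gam_diag0 M (fun k => epsr r k ^+ 2)) -addrA.
rewrite [X in _ + X](_ : _ = 0) ?addr0//.
have -> : dirw M (cavc' t) r = - (sin t * cos t * beta ^+ 2 * (p - q)) * \sum_(k < M) (epsr r k ^+ 2 - epsr r M ^+ 2).
  rewrite /dirw big_distrr; apply: eq_bigr => k _ /=.
  by rewrite /cavc' /epsr; field.
by ring.
Qed.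
End Cavity.

(** * Decoupling at one site and single-spin moments *)

Section AvProducts.
Context {R : realType} {T : finType} (t0 : T).

Lemma Av_prod (w : T -> R) M (phi : nat -> T -> R) :
  Av t0 w M (fun r => \prod_(k < M) phi k (r k)) = \prod_(k < M) \sum_t w t * phi k t.
Proof.
elim: M phi => [|M IH] phi; first by rewrite /= !big_ord0.
rewrite big_ord_recl -(IH (fun k => phi k.+1)) /= big_distrl; apply: eq_bigr => t _ /=.
rewrite -mulrA -(AvZ _ _ _ (phi 0%N t)); congr (_ * _); apply: Av_ext => r.
by rewrite big_ord_recl.
Qed.

Lemma prod_nth_count (s : seq nat) M (m : nat -> R) : all (fun k => (k < M)%N) s ->
  m 0 = 1 -> \prod_(k < M) m (count_mem (k : nat) s) = \prod_(k <- undup s) m (count_mem k s).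
Proof.
move=> sM m0; rewrite -(big_mkord xpredT (fun k => m (count_mem k s))) /index_iota subn0.
rewrite (bigID (fun k => k \in s)) /= [X in _ * X]big1 ?mulr1; last first.
  by move=> k /count_memPn ->.
rewrite -big_filter; apply: perm_big; apply: uniq_perm.
- by rewrite filter_uniq ?iota_uniq.
- exact: undup_uniq.
- move=> k; rewrite mem_filter mem_iota mem_undup add0n /=.
  by case: (boolP (k \in s)) => // /(allP sM) ->.
Qed.

Lemma prod_seq_count (s : seq nat) M (x : nat -> R) : all (fun k => (k < M)%N) s ->
  \prod_(k <- s) x k = \prod_(k < M) x k ^+ (count_mem (k : nat) s).
Proof.
elim: s => [|a s IH] /=; first by rewrite big_nil big1.
move=> /andP[aM sM]; rewrite big_cons IH//.
rewrite [RHS](bigD1 (Ordinal aM))//= eqxx [in LHS](bigD1 (Ordinal aM))//= exprS mulrA.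
congr (_ * _); apply: eq_bigr => k; rewrite -(inj_eq val_inj) /= => /negbTE.
by rewrite eq_sym => ->.
Qed.
End AvProducts.

Section Decoupling.
Context {R : realType} (S N : nat) (i0 : 'I_N).
Local Notation conf := (config S N).
Local Notation conf0 := (@conf0 S N).
Local Notation ord0s := (ord0 : spin S).
Implicit Types (r : nat -> conf) (M : nat).

Definition off_site {U} (a : conf -> U) := forall u v : conf,
  (forall j, j != i0 -> u j = v j) -> a u = a v.

Definition off_siter {U} (f : (nat -> conf) -> U) := forall r r',
  (forall k j, j != i0 -> r k j = r' k j) -> f r = f r'.

Definition upd (u : conf) (s : spin S) : conf := [ffun j => if j == i0 then s else u j].

(** Exchanging the spin at [i0] with an additional free spin is an involution that [a] does not
    notice. The factor [S.*2.+1] counts the free spin and cancels in Gibbs ratios. *)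
Lemma sum_off_site (a : conf -> R) (b : spin S -> R) : off_site a ->
  (\sum_u a u * b (u i0)) * (S.*2.+1)%:R = (\sum_u a u) * (\sum_s b s).
Proof.
move=> ha; rewrite big_distrlr pair_big /=.
pose g (x : conf * spin S) := (upd x.1 x.2, x.1 i0).
have gK : involutive g.
  move=> [u s]; rewrite /g /upd /= ffunE eqxx; congr pair; apply/ffunP => j.
  by rewrite !ffunE; case: eqP => [->|].
rewrite [RHS](reindex_inj (inv_inj gK)) /=.
rewrite (eq_bigr (fun x => a x.1 * b (x.1 i0))); last first.
  move=> [u s] _ /=; congr (_ * _); apply: ha => j /negbTE ji.
  by rewrite ffunE ji.
rewrite -(pair_big xpredT xpredT (fun u _ => a u * b (u i0))) /= big_distrl /=.
by apply: eq_bigr => u _; rewrite sumr_const card_ord mulr_natr.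
Qed.

Lemma sum_softmax_off_site (A a : conf -> R) (B b : spin S -> R) :
  off_site A -> off_site a ->
  \sum_u softmax (fun u => A u + B (u i0)) u * (a u * b (u i0)) =
  (\sum_u softmax A u * a u) * (\sum_s softmax B s * b s).
Proof.
move=> hA ha; have c0 : (S.*2.+1)%:R != 0 :> R by rewrite pnatr_eq0.
have E1 := sum_off_site (a := fun u => expR (A u) * a u) (fun s => expR (B s) * b s).
have E2 := sum_off_site (a := fun u => expR (A u)) (fun s => expR (B s)).
have {}E1 := E1 (fun u v e => congr2 (fun x y => expR x * y) (hA u v e) (ha u v e)).
have {}E2 := E2 (fun u v e => congr1 (fun x => expR x) (hA u v e)).
have za := sum_expR_gt0 conf0 A; have zb := sum_expR_gt0 ord0s B.
have z := sum_expR_gt0 conf0 (fun u => A u + B (u i0)).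
have -> : \sum_u softmax A u * a u = (\sum_u expR (A u) * a u) / (\sum_u expR (A u)).
  by rewrite big_distrl; apply: eq_bigr => u _; rewrite /softmax mulrAC.
have -> : \sum_s softmax B s * b s = (\sum_s expR (B s) * b s) / (\sum_s expR (B s)).
  by rewrite big_distrl; apply: eq_bigr => u _; rewrite /softmax mulrAC.
have -> : \sum_u softmax (fun u => A u + B (u i0)) u * (a u * b (u i0)) =
  (\sum_u expR (A u) * a u * (expR (B (u i0)) * b (u i0))) / (\sum_u expR (A u) * expR (B (u i0))).
  rewrite big_distrl; apply: eq_bigr => u _; rewrite /softmax expRD.
  rewrite (eq_bigr (fun u => expR (A u) * expR (B (u i0)))); last by move=> v _; rewrite expRD.
  by rewrite /=; ring.
rewrite (eq_bigr (fun u => expR (A u) * expR (B (u i0)))) in z; last first.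
  by move=> v _; rewrite expRD.
rewrite mulf_div -E1 -E2; field.
apply/andP; split; last by rewrite gt_eqF.
by move: c0; rewrite -natr1 addrC.
Qed.

Lemma Av_decouple (A : conf -> R) (B : spin S -> R) M (F : (nat -> conf) -> R) (G : (nat -> spin S) -> R) :
  off_site A -> off_siter F ->
  Av conf0 (softmax (fun u => A u + B (u i0))) M (fun r => F r * G (fun k => r k i0)) =
  Av conf0 (softmax A) M F * Av ord0s (softmax B) M G.
Proof.
move=> hA; elim: M F G => [|M IH] F G hF.
  by rewrite /=; congr (_ * G _); apply/funext => k; rewrite ffunE.
rewrite [Av conf0 (softmax A) _ _]/= [Av ord0s _ _ _]/=.
rewrite -sum_softmax_off_site//; last first.
  move=> u v e; apply: Av_ext => r; apply: hF => -[|k] j ji //=.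
  exact: e.
apply: eq_bigr => u _; congr (_ * _); rewrite -IH; last first.
  by move=> r r' e; apply: hF => -[|k] j ji //=; exact: e.
apply: Av_ext => r; congr (_ * G _).
by apply/funext => -[|k].
Qed.
End Decoupling.

(** * Single-spin averages and their covariances *)

Section SingleSite.
Context {R : realType} (S : nat) (beta h D p q : R).
Local Notation sv := (@Defs.sval R S).
Local Notation ord0s := (ord0 : spin S).
Implicit Types (M k l u v : nat) (f g : R -> R) (x : R).

Definition siteE x (s : spin S) : R :=
  beta * Num.sqrt q * sv s * x + h * sv s + (D + beta ^+ 2 / 2 * (p - q)) * sv s ^+ 2.

Local Notation mom := (mom S beta h D p q).

Lemma momE j x : mom j x = \sum_s softmax (siteE x) s * sv s ^+ j.
Proof.
rewrite /Defs.mom big_distrl; apply: eq_bigr => s _; rewrite /softmax /=.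
have E t : wgt beta h D p q x t = expR (siteE x t).
  by rewrite /wgt /siteE (mulrAC _ x).
by rewrite E mulrAC; congr (_ / _ * _); apply: eq_bigr => t _; rewrite E.
Qed.

Lemma mom0 x : mom 0 x = 1.
Proof.
rewrite momE -[RHS](proj2 (softmax_prob ord0s (siteE x))).
by apply: eq_bigr => s _; rewrite expr0 mulr1.
Qed.

Lemma mom_bound j x : `|mom j x| <= S%:R ^+ j.
Proof.
rewrite momE; apply: wmean_bound => [|s]; first exact: (softmax_prob ord0s).
by rewrite normrX lerXn2r ?nnegrE// sval_bound.
Qed.

(** [gavg1] is viewed as [gexp] in one variable, so that the algebra of [plip] functions applies. *)
Definition plip1 f := plip (fun v : 'I_1 -> R => f (v ord0)).

Lemma gavg1_gexp f : gavg1 f = gexp (fun v : 'I_1 -> R => f (v ord0)).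
Proof. by rewrite gexpE; congr gavg1; apply/funext => x /=; rewrite consv0. Qed.

Lemma gavg1D1 f g : plip1 f -> plip1 g -> gavg1 (fun x => f x + g x) = gavg1 f + gavg1 g.
Proof. by move=> pf pg; rewrite !gavg1_gexp gexpD. Qed.

Lemma gavg1N1 f : plip1 f -> gavg1 (fun x => - f x) = - gavg1 f.
Proof. by move=> pf; rewrite !gavg1_gexp gexpN. Qed.

Lemma gavg1Z1 (c : R) f : plip1 f -> gavg1 (fun x => c * f x) = c * gavg1 f.
Proof. by move=> pf; rewrite !gavg1_gexp gexpZ. Qed.

Lemma gavg1_bound1 f (B : R) : plip1 f -> (forall x, `|f x| <= B) -> `|gavg1 f| <= B.
Proof.
move=> pf H; rewrite gavg1_gexp -(gexp_cst (n := 1) B).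
by apply: gexp_norm_le => //; exact: plip_cst.
Qed.

Lemma plip1_Av M (G : (nat -> spin S) -> R) :
  plip1 (fun x => Av ord0s (softmax (siteE x)) M G).
Proof.
pose X (_ : 'I_1) (s : spin S) := beta * Num.sqrt q * sv s.
pose c (_ : R) (s : spin S) := h * sv s + (D + beta ^+ 2 / 2 * (p - q)) * sv s ^+ 2.
have := @plip_Av _ _ ord0s 1 X (fun _ _ => 1) c 0 M G.
rewrite /plip1; congr plip; apply/funext => v; congr Av; congr softmax.
apply/funext => s; rewrite /energy big_ord1 /X /c /siteE mul1r addrA; ring.
Qed.

Lemma plip1_mom j : plip1 (mom j).
Proof.
have := plip1_Av 1 (fun r => sv (r 0) ^+ j); congr plip; apply/funext => v.
by rewrite momE.
Qed.

Definition Espin M (G : (nat -> spin S) -> R) : R :=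
  gavg1 (fun x => Av ord0s (softmax (siteE x)) M G).

Lemma EspinB M G1 G2 : Espin M (fun r => G1 r - G2 r) = Espin M G1 - Espin M G2.
Proof.
rewrite /Espin -gavg1N1 -?gavg1D1; try exact: plip1_Av.
  by congr gavg1; apply/funext => x; rewrite AvB.
by apply: plipN; exact: plip1_Av.
Qed.

Lemma EspinZ M (c : R) G : Espin M (fun r => c * G r) = c * Espin M G.
Proof.
rewrite /Espin -gavg1Z1; last exact: plip1_Av.
by congr gavg1; apply/funext => x; rewrite AvZ.
Qed.

(** Given the Gaussian variable, replicas are independent, so only the multiplicity of each replica
    matters. *)
Lemma Espin_prod M (s : seq nat) : all (fun k => (k < M)%N) s ->
  Espin M (fun r => \prod_(k <- s) sv (r k)) =
  gavg1 (fun x => \prod_(k <- undup s) mom (count_mem k s) x).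
Proof.
move=> sM; congr gavg1; apply/funext => x.
rewrite -(@prod_nth_count _ s M (fun j => mom j x))//; last exact: mom0.
under Av_ext do rewrite (prod_seq_count _ sM).
rewrite (Av_prod _ _ _ (fun k t => sv t ^+ count_mem k s)).
by apply: eq_bigr => k _; rewrite momE.
Qed.

Hypothesis fp : fixed_point S beta h D p q.

(** The fixed point equations say exactly that products of two spins at the decoupled site have mean
    [Qn]. *)
Lemma Espin2 M k l : (k < M)%N -> (l < M)%N ->
  Espin M (fun r => sv (r k) * sv (r l)) = Qn p q k l.
Proof.
move=> kM lM; have := @Espin_prod M [:: k; l].
rewrite /= kM lM => /(_ isT) H; rewrite (_ : Espin M _ = Espin M (fun r => \prod_(j <- [:: k; l]) sv (r j))); last first.
  by congr Espin; apply/funext => r; rewrite !big_cons big_nil mulr1.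
rewrite H /Qn; case: fp => fq fpp.
case: (eqVneq k l) => kl.
  rewrite kl inE eqxx /= [in RHS]fpp; congr gavg1; apply/funext => x.
  by rewrite big_cons big_nil eqxx mulr1.
rewrite inE (negbTE kl) /= [in RHS]fq; congr gavg1; apply/funext => x.
by rewrite !big_cons big_nil !eqxx [l == k]eq_sym (negbTE kl) /= mulr1 expr2.
Qed.

(* Covariance of the pairs (k,l) and (u,v) in terms of the coincidences between their entries. The same shape describes both the single-spin covariances and, with parameters A_0^2, A_1^2, ..., the covariance of eta. *)
Definition Ker (I3 G A I5 E K4 DD : R) k l u v : R :=
  if k != l then
    I3 + G * ((u == k)%:R + (u == l)%:R + (v == k)%:R + (v == l)%:R)
    + A * ((u == k)%:R * (v == l)%:R + (u == l)%:R * (v == k)%:R)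
    + (u == v)%:R * ((I5 - I3) + (E - 2 * G) * ((u == k)%:R + (u == l)%:R))
  else I5 + E * ((u == k)%:R + (v == k)%:R)
    + (u == v)%:R * ((K4 - I5) + (DD - 2 * E) * (u == k)%:R).

Definition cker := Ker (cI3 S beta h D p q) (cG S beta h D p q) (cA S beta h D p q)
  (cI5 S beta h D p q) (cE S beta h D p q) (cK4 S beta h D p q) (cDD S beta h D p q).

(** The five coincidence patterns of four replica indices; up to products of [p] and [q] all
    covariance constants are combinations of these. *)
Let t4 := gavg1 (mom 4).
Let t31 := gavg1 (fun x => mom 3 x * mom 1 x).
Let t22 := gavg1 (fun x => mom 2 x * mom 2 x).
Let t211 := gavg1 (fun x => mom 2 x * mom 1 x * mom 1 x).
Let t1111 := gavg1 (fun x => mom 1 x * mom 1 x * mom 1 x * mom 1 x).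

Ltac pl := repeat first [exact: plip1_mom | apply: plipN | apply: plipM | apply: plipD | exact: plip_cst].

Lemma cA_E : cA S beta h D p q = t22 - 2 * t211 + t1111.
Proof.
rewrite /t22 /t211 /t1111 -gavg1Z1; last by rewrite /plip1; pl.
rewrite -gavg1N1; last by rewrite /plip1; pl.
rewrite -!gavg1D1; try by rewrite /plip1; pl.
by congr gavg1; apply/funext => x; ring.
Qed.

Lemma cDD_E : cDD S beta h D p q = t4 - t22.
Proof.
rewrite /t4 /t22 -gavg1N1; last by rewrite /plip1; pl.
rewrite -!gavg1D1; try by rewrite /plip1; pl.
Qed.

Lemma cF_E : cF S beta h D p q = t22 - t211.
Proof.
rewrite /t22 /t211 -gavg1N1; last by rewrite /plip1; pl.
rewrite -!gavg1D1; try by rewrite /plip1; pl.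
by congr gavg1; apply/funext => x; ring.
Qed.

Lemma cG_E : cG S beta h D p q = t211 - t1111.
Proof.
rewrite /t211 /t1111 -gavg1N1; last by rewrite /plip1; pl.
rewrite -!gavg1D1; try by rewrite /plip1; pl.
by congr gavg1; apply/funext => x; ring.
Qed.

Lemma cE_E : cE S beta h D p q = t31 - t211.
Proof.
rewrite /t31 /t211 -gavg1N1; last by rewrite /plip1; pl.
rewrite -!gavg1D1; try by rewrite /plip1; pl.
by congr gavg1; apply/funext => x; ring.
Qed.

Lemma cI3_E : cI3 S beta h D p q = t1111 - q ^+ 2.
Proof. by congr (_ - _); congr gavg1; apply/funext => x; ring. Qed.

Lemma cI5_E : cI5 S beta h D p q = t211 - p * q.
Proof. by congr (_ - _); congr gavg1; apply/funext => x; ring. Qed.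

Lemma cK4_E : cK4 S beta h D p q = t22 - p ^+ 2.
Proof. by congr (_ - _); congr gavg1; apply/funext => x; ring. Qed.

Definition cE_ := (cA_E, cDD_E, cG_E, cE_E, cI3_E, cI5_E, cK4_E).

(** Only one factor is centered: by [Espin2] its mean is zero, so this is a covariance. The proof
    runs through the coincidences among the four indices. *)
Lemma Espin4 M k l u v : (k < M)%N -> (l < M)%N -> (u < M)%N -> (v < M)%N ->
  Espin M (fun r => (sv (r k) * sv (r l) - Qn p q k l) * (sv (r u) * sv (r v))) =
  cker k l u v.
Proof.
move=> kM lM uM vM.
have -> : (fun r : nat -> spin S => (sv (r k) * sv (r l) - Qn p q k l) * (sv (r u) * sv (r v))) =
  (fun r => \prod_(j <- [:: k; l; u; v]) sv (r j) - Qn p q k l * (sv (r u) * sv (r v))).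
  by apply/funext => r; rewrite !big_cons big_nil; ring.
rewrite EspinB EspinZ Espin2// Espin_prod; last by rewrite /= kM lM uM vM.
rewrite /cker /Ker !cE_ /Qn.
have s1 (a b : nat) : a != b -> ((a == b) = false) * ((b == a) = false).
  by move=> ab; rewrite [b == a]eq_sym !(negbTE ab).
case: (eqVneq k l) => [<-|kl]; last have {}kl := s1 _ _ kl.
  case: (eqVneq u v) => [<-|uv]; last have {}uv := s1 _ _ uv.
    case: (eqVneq u k) => [->|uk]; last have {}uk := s1 _ _ uk.
      rewrite /= ?inE ?eqxx /= (_ : gavg1 _ = t4); first by ring.
      congr gavg1; apply/funext => x; rewrite !big_cons big_nil /= ?eqxx; ring.
    rewrite /= ?inE ?eqxx ?uk /= ?inE ?eqxx ?uk /=.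
   rewrite (_ : gavg1 _ = t22); first by ring.
    congr gavg1; apply/funext => x; rewrite !big_cons big_nil ?eqxx ?uk /=; ring.
  case: (eqVneq u k) => [uk|uk]; last have {}uk := s1 _ _ uk.
    rewrite uk in uv *.
    rewrite /= ?inE ?eqxx ?uv /= ?inE ?eqxx ?uv /=.
   rewrite (_ : gavg1 _ = t31); first by ring.
    congr gavg1; apply/funext => x; rewrite !big_cons big_nil ?eqxx ?uv /=; ring.
  case: (eqVneq v k) => [vk|vk]; last have {}vk := s1 _ _ vk.
    rewrite vk in uv *.
    rewrite /= ?inE ?eqxx ?uv /= ?inE ?eqxx ?uv /=.
   rewrite (_ : gavg1 _ = t31); first by ring.
    congr gavg1; apply/funext => x; rewrite !big_cons big_nil ?eqxx ?uv /=; ring.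
  rewrite /= ?inE ?eqxx ?uv ?uk ?vk /= ?inE ?eqxx ?uv ?uk ?vk /=.
 rewrite (_ : gavg1 _ = t211); first by ring.
  congr gavg1; apply/funext => x; rewrite !big_cons big_nil ?eqxx ?uv ?uk ?vk /=; ring.
case: (eqVneq u v) => [<-|uv]; last have {}uv := s1 _ _ uv.
  case: (eqVneq u k) => [->|uk]; last have {}uk := s1 _ _ uk.
    rewrite /= ?inE ?eqxx ?kl /= ?inE ?eqxx ?kl /=.
   rewrite (_ : gavg1 _ = t31); first by ring.
    congr gavg1; apply/funext => x; rewrite !big_cons big_nil ?eqxx ?kl /=; ring.
  case: (eqVneq u l) => [->|ul]; last have {}ul := s1 _ _ ul.
    rewrite /= ?inE ?eqxx ?kl /= ?inE ?eqxx ?kl /=.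
   rewrite (_ : gavg1 _ = t31); first by ring.
    congr gavg1; apply/funext => x; rewrite !big_cons big_nil ?eqxx ?kl /=; ring.
  rewrite /= ?inE ?eqxx ?kl ?uk ?ul /= ?inE ?eqxx ?kl ?uk ?ul /=.
 rewrite (_ : gavg1 _ = t211); first by ring.
  congr gavg1; apply/funext => x; rewrite !big_cons big_nil ?eqxx ?kl ?uk ?ul /=; ring.
case: (eqVneq u k) => [uk|uk]; last have {}uk := s1 _ _ uk.
  rewrite uk in uv *; case: (eqVneq v l) => [->|vl]; last have {}vl := s1 _ _ vl.
    rewrite /= ?inE ?eqxx ?kl /= ?inE ?eqxx ?kl /=.
   rewrite (_ : gavg1 _ = t22); first by ring.
    congr gavg1; apply/funext => x; rewrite !big_cons big_nil ?eqxx ?kl /=; ring.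
  rewrite /= ?inE ?eqxx ?kl ?uv ?vl /= ?inE ?eqxx ?kl ?uv ?vl /=.
 rewrite (_ : gavg1 _ = t211); first by ring.
  congr gavg1; apply/funext => x; rewrite !big_cons big_nil ?eqxx ?kl ?uv ?vl /=; ring.
case: (eqVneq u l) => [ul|ul]; last have {}ul := s1 _ _ ul.
  rewrite ul in uv *; case: (eqVneq v k) => [->|vk]; last have {}vk := s1 _ _ vk.
    rewrite /= ?inE ?eqxx ?kl /= ?inE ?eqxx ?kl /=.
   rewrite (_ : gavg1 _ = t22); first by ring.
    congr gavg1; apply/funext => x; rewrite !big_cons big_nil ?eqxx ?kl /=; ring.
  rewrite /= ?inE ?eqxx ?kl ?uv ?vk /= ?inE ?eqxx ?kl ?uv ?vk /=.
 rewrite (_ : gavg1 _ = t211); first by ring.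
  congr gavg1; apply/funext => x; rewrite !big_cons big_nil ?eqxx ?kl ?uv ?vk /=; ring.
case: (eqVneq v k) => [vk|vk]; last have {}vk := s1 _ _ vk.
  rewrite vk in uv *.
  rewrite /= ?inE ?eqxx ?kl ?uv ?ul /= ?inE ?eqxx ?kl ?uv ?ul /=.
 rewrite (_ : gavg1 _ = t211); first by ring.
  congr gavg1; apply/funext => x; rewrite !big_cons big_nil ?eqxx ?kl ?uv ?ul /=; ring.
case: (eqVneq v l) => [vl|vl]; last have {}vl := s1 _ _ vl.
  rewrite vl in uv *.
  rewrite /= ?inE ?eqxx ?kl ?uv ?uk /= ?inE ?eqxx ?kl ?uv ?uk /=.
 rewrite (_ : gavg1 _ = t211); first by ring.
  congr gavg1; apply/funext => x; rewrite !big_cons big_nil ?eqxx ?kl ?uv ?uk /=; ring.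
rewrite /= ?inE ?eqxx ?kl ?uv ?uk ?ul ?vk ?vl /= ?inE ?eqxx ?kl ?uv ?uk ?ul ?vk ?vl /=.
rewrite (_ : gavg1 _ = t1111); first by ring.
congr gavg1; apply/funext => x; rewrite !big_cons big_nil ?eqxx ?kl ?uv ?uk ?ul ?vk ?vl /=; ring.
Qed.
End SingleSite.

(** * First and second order cavity expansions *)

Section CavnuLinear.
Context {R : realType} (S N : nat) (beta h D p q : R) (i : 'I_N) (t : R).
Local Notation conf := (config S N).
Implicit Types (k l M : nat) (f g : (nat -> conf) -> R).
Local Notation cavnu := (@cavnu R S N beta h D p q).

Lemma cavnuD M f g : cavnu i t M (fun r => f r + g r) = cavnu i t M f + cavnu i t M g.
Proof. exact: nuTD. Qed.

Lemma cavnuZ M (c : R) f : cavnu i t M (fun r => c * f r) = c * cavnu i t M f.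
Proof. exact: nuTZ. Qed.

Lemma cavnuB M f g : cavnu i t M (fun r => f r - g r) = cavnu i t M f - cavnu i t M g.
Proof. exact: nuTB. Qed.

Lemma cavnu_sum M (I : Type) (s : seq I) (P : pred I) (F : I -> (nat -> conf) -> R) :
  cavnu i t M (fun r => \sum_(j <- s | P j) F j r) = \sum_(j <- s | P j) cavnu i t M (F j).
Proof. exact: nuT_sum. Qed.

Lemma cavnu_le M f g : (forall r, f r <= g r) -> cavnu i t M f <= cavnu i t M g.
Proof. exact: nuT_le. Qed.

Lemma cavnu_ge0 M f : (forall r, 0 <= f r) -> 0 <= cavnu i t M f.
Proof. exact: nuT_ge0. Qed.

Lemma cavnu_norm_le M f g : (forall r, `|f r| <= g r) -> `|cavnu i t M f| <= cavnu i t M g.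
Proof. exact: nuT_norm_le. Qed.

Lemma cavnu_supp M M' f : (M <= M')%N -> supp M f -> cavnu i t M' f = cavnu i t M f.
Proof. exact: nuT_supp. Qed.

Lemma cavnu_cst M (c : R) : cavnu i t M (fun=> c) = c.
Proof. exact: nuT_cst. Qed.

Lemma cavnu_swap M f k l : (k < M)%N -> (l < M)%N ->
  cavnu i t M (fun r => f (r \o sw k l)) = cavnu i t M f.
Proof. exact: nuT_swap. Qed.
End CavnuLinear.

Section FullSystem.
Context {R : realType} (S N : nat) (beta h D : R).
Local Notation conf := (config S N).
Local Notation conf0 := (@conf0 S N).
Implicit Types (k l M : nat) (f g : (nat -> conf) -> R).

Definition nuf M f : R :=
  gexpT (fun g : (pairsLt N : finType) -> R => Av conf0 (softmax (Ham beta h D g)) M f).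

Lemma nuf_cavnu p q (i : 'I_N) M f : nuf M f = cavnu beta h D p q i (pi / 2) M f.
Proof. by rewrite cavnu_full. Qed.

Hypothesis N0 : (0 < N)%N.
Let j0 : 'I_N := Ordinal N0.

Lemma nuf_ext M f g : (forall r, f r = g r) -> nuf M f = nuf M g.
Proof. by move=> E; congr nuf; apply/funext. Qed.

Lemma nufD M f g : nuf M (fun r => f r + g r) = nuf M f + nuf M g.
Proof. by rewrite !(nuf_cavnu 0 0 j0) cavnuD. Qed.

Lemma nufZ M (c : R) f : nuf M (fun r => c * f r) = c * nuf M f.
Proof. by rewrite !(nuf_cavnu 0 0 j0) cavnuZ. Qed.

Lemma nufB M f g : nuf M (fun r => f r - g r) = nuf M f - nuf M g.
Proof. by rewrite !(nuf_cavnu 0 0 j0) cavnuB. Qed.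

Lemma nuf_sum M (I : Type) (s : seq I) (P : pred I) (F : I -> (nat -> conf) -> R) :
  nuf M (fun r => \sum_(j <- s | P j) F j r) = \sum_(j <- s | P j) nuf M (F j).
Proof. by rewrite (nuf_cavnu 0 0 j0) cavnu_sum; apply: eq_bigr => j _; rewrite -(nuf_cavnu 0 0). Qed.

Lemma nuf_le M f g : (forall r, f r <= g r) -> nuf M f <= nuf M g.
Proof. by move=> H; rewrite !(nuf_cavnu 0 0 j0) cavnu_le. Qed.

Lemma nuf_ge0 M f : (forall r, 0 <= f r) -> 0 <= nuf M f.
Proof. by move=> H; rewrite (nuf_cavnu 0 0 j0) cavnu_ge0. Qed.

Lemma nuf_norm_le M f g : (forall r, `|f r| <= g r) -> `|nuf M f| <= nuf M g.
Proof. by move=> H; rewrite !(nuf_cavnu 0 0 j0) cavnu_norm_le. Qed.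

Lemma nuf_supp M M' f : (M <= M')%N -> supp M f -> nuf M' f = nuf M f.
Proof. by move=> H sf; rewrite !(nuf_cavnu 0 0 j0); exact: cavnu_supp. Qed.

Lemma nuf_cst M (c : R) : nuf M (fun=> c) = c.
Proof. by rewrite (nuf_cavnu 0 0 j0) cavnu_cst. Qed.

Lemma nuf_swap M f k l : (k < M)%N -> (l < M)%N ->
  nuf M (fun r => f (r \o sw k l)) = nuf M f.
Proof. by move=> kM lM; rewrite !(nuf_cavnu 0 0 j0) cavnu_swap. Qed.
End FullSystem.

Section CavityEstimates.
Context {R : realType} (S N : nat) (beta h D p q : R).
Local Notation conf := (config S N).
Local Notation conf0 := (@conf0 S N).
Local Notation sv := (@Defs.sval R S).
Implicit Types (r : nat -> conf) (k l M : nat) (t x C : R) (f g : (nat -> conf) -> R) (i : 'I_N).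
Local Notation nuf := (@nuf R S N beta h D).
Local Notation cavnu := (@cavnu R S N beta h D p q).
Local Notation Qn := (@Qn R p q).
Local Notation Espin := (@Espin R S beta h D p q).

Lemma energy_cav0 i x (v : 'I_#|(pairsLt N : finType)| -> R) (u : conf) :
  energy (@cavX _ S N beta q i) (@cava _ N i) (@cavc _ S N beta h D p q i) 0 (consv x v) u =
  (beta / Num.sqrt N%:R * (\sum_(e : (pairsLt N : finType)) if touches i e then 0 else
     v (enum_rank e) * (sv (u (val e).1) * sv (u (val e).2)))
   + (D * (\sum_(j < N | j != i) sv (u j) ^+ 2) + h * (\sum_(j < N | j != i) sv (u j))))
  + siteE beta h D p q x (u i).
Proof.
rewrite energy_cav cos0 sin0 mul1r /cavc cos0 expr1n mulr1 /siteE.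
rewrite (bigD1 i)//= (bigD1 i (F := fun j => sv (u j)))//=.
rewrite (eq_bigr (fun e : (pairsLt N : finType) => if touches i e then 0 else
     v (enum_rank e) * (sv (u (val e).1) * sv (u (val e).2)))); last first.
  by move=> e _; case: ifP => _; rewrite ?mul0r ?mul1r.
ring.
Qed.

(** At [t = 0] the energy is a sum of a part off site [i], which carries all couplings, and [siteE],
    which carries the first Gaussian coordinate. Both the Gibbs average and the disorder average
    factorise. *)
Lemma cavnu0_decouple i M f (G : (nat -> spin S) -> R) : off_siter i f ->
  cavnu i 0 M (fun r => f r * G (fun k => r k i)) = cavnu i 0 M f * Espin M G.
Proof.
move=> hf.
pose A (v : 'I_#|(pairsLt N : finType)| -> R) (u : conf) :=
  beta / Num.sqrt N%:R * (\sum_(e : (pairsLt N : finType)) if touches i e then 0 else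
     v (enum_rank e) * (sv (u (val e).1) * sv (u (val e).2)))
   + (D * (\sum_(j < N | j != i) sv (u j) ^+ 2) + h * (\sum_(j < N | j != i) sv (u j))).
have hA v : off_site i (A v).
  move=> u u' e; rewrite /A; congr (_ * _ + (_ * _ + _ * _)).
  - apply: eq_bigr => d _; rewrite /touches; case: ifP => // /negbT; rewrite negb_or => /andP[d1 d2].
    by rewrite !e.
  - by apply: eq_bigr => j ji; rewrite e.
  - by apply: eq_bigr => j ji; rewrite e.
pose en := energy (@cavX _ S N beta q i) (@cava _ N i) (@cavc _ S N beta h D p q i) 0.
have E x v G' : Av conf0 (softmax (en (consv x v))) M (fun r => f r * G' (fun k => r k i)) =
    Av conf0 (softmax (A v)) M f * Av (ord0 : spin S) (softmax (siteE beta h D p q x)) M G'.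
  rewrite -(@Av_decouple _ S N i (A v) (siteE beta h D p q x) M f G' (hA v) hf); congr (Av _ (softmax _) _ _).
  by apply/funext => u; rewrite /en energy_cav0.
(* Taking the constant 1 as site function shows that the average of [f] does not depend on the
   cavity field. *)
have E1 x v : Av conf0 (softmax (en (consv x v))) M f = Av conf0 (softmax (A v)) M f.
  have := E x v (fun=> 1); rewrite Av_cst ?mulr1; last exact: (softmax_prob (ord0 : spin S)).
  by move=> <-; apply: Av_ext => r; rewrite mulr1.
have pA : plip (fun v => Av conf0 (softmax (A v)) M f).
  have := plip_slice 0 (plip_Av conf0 (@cavX _ S N beta q i) (@cava _ N i) (@cavc _ S N beta h D p q i) 0 M f).
  by congr plip; apply/funext => v; exact: E1.
transitivity (gavg1 (fun x => gexp (fun v => Av conf0 (softmax (A v)) M f) *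
    Av (ord0 : spin S) (softmax (siteE beta h D p q x)) M G)).
  rewrite /cavnu /nuT gexpE; congr gavg1; apply/funext => x.
  rewrite mulrC -gexpZ//; congr gexp; apply/funext => v.
  by rewrite -/(en _) E mulrC.
rewrite gavg1Z1; last exact: plip1_Av.
congr (_ * _); rewrite /cavnu /nuT gexpE -[LHS]gavg1_cst; congr gavg1.
by apply/funext => x; congr gexp; apply/funext => v; rewrite -/(en _) E1.
Qed.

Hypothesis N0 : (0 < N)%N.

Hypothesis S1 : (1 <= S)%N.
Hypothesis fp : fixed_point S beta h D p q.
Hypothesis b0 : 0 < beta.
Hypothesis b1 : beta <= 1.

Let s2 : R := S%:R ^+ 2.

Let s1 : 1 <= S%:R :> R. Proof. by rewrite ler1n. Qed.

Let s21 : 1 <= s2. Proof. by rewrite exprn_ege1. Qed.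

Let s20 : 0 <= s2. Proof. exact: sqr_ge0. Qed.

Lemma fixed_q_bound : 0 <= q <= s2.
Proof.
case: fp => -> _; rewrite gavg1_gexp.
have pm : plip (fun v : 'I_1 -> R => mom S beta h D p q 1 (v ord0) ^+ 2).
  apply: plipX; exact: plip1_mom.
apply/andP; split; first by apply: gexp_ge0 => // v; exact: sqr_ge0.
rewrite -[leRHS](gexp_cst (n := 1)); apply: gexp_le => //; first exact: plip_cst.
move=> v; rewrite -(real_normK (num_real _)) lerXn2r ?nnegrE//.
by have := mom_bound S beta h D p q 1 (v ord0); rewrite expr1.
Qed.

Lemma fixed_p_bound : `|p| <= s2.
Proof.
case: fp => _ ->; apply: gavg1_bound1; first exact: plip1_mom.
exact: mom_bound.
Qed.

Lemma Qn_bound k l : `|Qn k l| <= s2.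
Proof.
rewrite /Qn; case: ifP => _; first exact: fixed_p_bound.
by have /andP[q0 q1] := fixed_q_bound; rewrite ger0_norm.
Qed.

Let q0 : 0 <= q. Proof. by case/andP: fixed_q_bound. Qed.

Lemma epsr_bound i r k : `|epsr i r k| <= S%:R :> R.
Proof. exact: sval_bound. Qed.

Lemma eps2_bound i r k l : `|epsr i r k * epsr i r l| <= s2 :> R.
Proof. by rewrite normrM /s2 expr2 ler_pM// epsr_bound. Qed.

Lemma ovr_bound r k l : `|ovr r k l| <= s2.
Proof.
rewrite /ovr normrM ger0_norm ?invr_ge0// ler_pdivrMl ?ltr0n//.
rewrite (le_trans (ler_norm_sum _ _ _))// mulr_natl -[N in leRHS]card_ord -sumr_const.
by apply: ler_sum => j _; rewrite normrM /s2 expr2 ler_pM// sval_bound.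
Qed.

Lemma ovr_ovrc i r k l : ovr r k l = ovrc i r k l + N%:R^-1 * (epsr i r k * epsr i r l) :> R.
Proof. by rewrite /ovr (bigD1 i)//= mulrDr addrC. Qed.

Definition xx r k l : R := ovr r k l - Qn k l.
Definition xc i r k l : R := ovrc i r k l - Qn k l.

Lemma xc_xx i r k l : xc i r k l = xx r k l - N%:R^-1 * (epsr i r k * epsr i r l).
Proof. by rewrite /xc /xx (ovr_ovrc i); ring. Qed.

Lemma xx_bound r k l : `|xx r k l| <= 2 * s2.
Proof.
rewrite /xx (le_trans (ler_normB _ _))// (_ : 2 * s2 = s2 + s2); last by ring.
by rewrite lerD ?ovr_bound ?Qn_bound.
Qed.

Lemma invN_le1 : N%:R^-1 <= 1 :> R.
Proof. by rewrite invf_le1 ?ltr0n// ler1n. Qed.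

Lemma xc_xx_dist i r k l : `|xx r k l - xc i r k l| <= s2 * N%:R^-1.
Proof.
rewrite xc_xx opprB addrC subrK normrM ger0_norm ?invr_ge0// mulrC.
by rewrite ler_wpM2r ?invr_ge0// eps2_bound.
Qed.

Lemma xc_bound i r k l : `|xc i r k l| <= 3 * s2.
Proof.
rewrite -[xc _ _ _ _](subKr (xx r k l)) (le_trans (ler_normB _ _))//.
have h1 := xx_bound r k l; have h2 := xc_xx_dist i r k l.
have h3 : s2 * N%:R^-1 <= s2 by rewrite ler_piMr ?invN_le1// (le_trans ler01).
lra.
Qed.

Lemma supp_xc i M k l : (k < M)%N -> (l < M)%N -> supp M (fun r => xc i r k l).
Proof. by move=> kM lM r r' E; rewrite /xc /ovrc !E. Qed.

Lemma supp_xx M k l : (k < M)%N -> (l < M)%N -> supp M (fun r => xx r k l).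
Proof. by move=> kM lM r r' E; rewrite /xx /ovr !E. Qed.

Lemma supp_eps i M k : (k < M)%N -> supp M (fun r => epsr i r k : R).
Proof. by move=> kM r r' E; rewrite /epsr !E. Qed.

Lemma off_xc i k l : off_siter i (fun r => xc i r k l).
Proof.
move=> r r' E; rewrite /xc /ovrc; congr (_ * _ - _).
by apply: eq_bigr => j ji; rewrite !E.
Qed.

Definition GamA M (y : nat -> nat -> R) : R :=
  \sum_(k < M) \sum_(l < M.+1) (`|y k l| + `|y k M.+1| + `|y M l| + `|y M M.+1|).

Lemma GamA_ge0 M y : 0 <= GamA M y.
Proof. by rewrite sumr_ge0// => k _; rewrite sumr_ge0// => l _; rewrite !addr_ge0. Qed.

Lemma Gam_le M y z C : (forall k l, `|y k l| <= C * `|z k l|) -> `|Gam M y| <= C * GamA M z.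
Proof.
move=> H; rewrite /Gam /GamA big_distrr /= (le_trans (ler_norm_sum _ _ _))//.
apply: ler_sum => k _; rewrite big_distrr /= (le_trans (ler_norm_sum _ _ _))//.
apply: ler_sum => l _; rewrite !mulrDr.
rewrite (le_trans (ler_normD _ _))// lerD//.
rewrite (le_trans (ler_normB _ _))// lerD//.
by rewrite (le_trans (ler_normB _ _))// lerD.
Qed.

Lemma GamA_bound M y C : (forall k l, `|y k l| <= C) -> GamA M y <= (M * M.+1)%:R * (4 * C).
Proof.
move=> H; apply: (@le_trans _ _ (\sum_(k < M) \sum_(l < M.+1) (4 * C))); last first.
  by rewrite !sumr_const !card_ord -mulrnA -[leLHS]mulr_natl mulnC.
apply: ler_sum => k _; apply: ler_sum => l _.
have := H k l; have := H k M.+1; have := H M l; have := H M M.+1; lra.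
Qed.

Lemma supp_GamA i M : supp M.+2 (fun r => GamA M (xc i r)).
Proof.
move=> r r' E; rewrite /GamA; apply: eq_bigr => k _; apply: eq_bigr => l _.
have kM : (k < M.+2)%N by rewrite ltnS ltnW// ltnS ltnW.
have lM : (l < M.+2)%N by rewrite ltnS ltnW.
by rewrite /xc /ovrc !E.
Qed.

Definition dGam i M r : R := Gam M (fun k l => epsr i r k * epsr i r l * xc i r k l).

Lemma supp_dGam i M : supp M.+2 (dGam i M).
Proof.
move=> r r' E; rewrite /dGam /Gam; apply: eq_bigr => k _; apply: eq_bigr => l _.
have kM : (k < M.+2)%N by rewrite ltnS ltnW// ltnS ltnW.
have lM : (l < M.+2)%N by rewrite ltnS ltnW.
by rewrite /xc /ovrc /epsr !E.
Qed.

Lemma dGam_le i M r : `|dGam i M r| <= s2 * GamA M (xc i r).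
Proof. by apply: Gam_le => k l; rewrite normrM ler_wpM2r// eps2_bound. Qed.

Lemma cavnu_derive_x i t M f : supp M f ->
  is_derive t 1 (fun t => cavnu i t M f) (sin t * cos t *
    (beta ^+ 2 * cavnu i t M.+2 (fun r => f r * dGam i M r))).
Proof. by move=> sf; exact: cavnu_derive. Qed.

(** Gronwall constant for [beta <= 1]: [Gam] has [M * M.+1] groups of four terms, each at most
    [s2 * (3 * s2)], and the angle contributes a factor one half. *)
Definition growthC M : R := expR ((M * M.+1)%:R * (6 * s2 ^+ 2)).

Lemma growthC_ge0 M : 0 <= growthC M. Proof. exact: expR_ge0. Qed.

Let pihalf : 0 <= (pi / 2 : R) <= pi / 2.
Proof. by rewrite lexx andbT divr_ge0// pi_ge0. Qed.

Lemma b2_le1 : beta ^+ 2 <= 1.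
Proof. by rewrite expr_le1// ltW. Qed.

(** Errors that arise along the path are thereby estimated by moments of the full system. *)
Lemma cav_gronwall i t M f : supp M f -> (forall r, 0 <= f r) -> 0 <= t <= pi / 2 ->
  cavnu i t M f <= growthC M * nuf M f.
Proof.
move=> sf f0 ht; rewrite (nuf_cavnu beta h D p q i).
set K := (M * M.+1)%:R * (12 * s2 ^+ 2).
have K0 : 0 <= K by rewrite !mulr_ge0// sqr_ge0.
have := @interp_gronwall _ (fun t => cavnu i t M f) _ K (fun t => cavnu_derive_x i t sf) K0 _ _ t ht.
rewrite (_ : K / 2 = (M * M.+1)%:R * (6 * s2 ^+ 2)); last by rewrite /K; field.
apply=> [u|u hu]; first exact: cavnu_ge0.
rewrite -(@cavnu_supp _ _ _ beta h D p q i u M M.+2)//; last by rewrite ltnW.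
rewrite normrM ger0_norm ?sqr_ge0//.
apply: (@le_trans _ _ `|cavnu i u M.+2 (fun r => f r * dGam i M r)|).
  by rewrite ler_piMl// b2_le1.
rewrite -cavnuZ; apply: cavnu_norm_le => r; rewrite normrM (ger0_norm (f0 r)) mulrC ler_wpM2r//.
apply: (le_trans (dGam_le _ _ _)).
apply: (@le_trans _ _ (s2 * ((M * M.+1)%:R * (4 * (3 * s2))))).
  by rewrite ler_wpM2l // GamA_bound// => k l; exact: xc_bound.
by rewrite le_eqVlt; apply/orP; left; apply/eqP; rewrite /K; ring.
Qed.

Definition firstC M : R := s2 / 2 * growthC M.+2.

Lemma firstC_ge0 M : 0 <= firstC M.
Proof. by rewrite mulr_ge0 ?growthC_ge0// divr_ge0// sqr_ge0. Qed.

(* The interpolation formula bounds the derivative; the factor [GamA] gains one order N^(-1/2). *)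
Lemma cav_first i t M f : supp M f -> 0 <= t <= pi / 2 ->
  `|cavnu i t M f - cavnu i 0 M f| <=
  beta ^+ 2 * firstC M * nuf M.+2 (fun r => `|f r| * GamA M (xc i r)).
Proof.
move=> sf ht.
set K := beta ^+ 2 * (s2 * growthC M.+2 * nuf M.+2 (fun r => `|f r| * GamA M (xc i r))).
have sfG : supp M.+2 (fun r => `|f r| * GamA M (xc i r)).
  apply: suppM; last exact: supp_GamA.
  by move=> r r' E; rewrite (sf r r')// => k kM; rewrite E// ltnW// ltnW.
have n0 : 0 <= nuf M.+2 (fun r => `|f r| * GamA M (xc i r)).
  by rewrite (nuf_cavnu beta h D p q i); apply: cavnu_ge0 => r; rewrite mulr_ge0 ?GamA_ge0.
have K0 : 0 <= K by rewrite /K mulr_ge0 ?sqr_ge0// mulr_ge0// mulr_ge0 ?growthC_ge0.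
have H := @interp_bound _ (fun t => cavnu i t M f) _ K (fun t => cavnu_derive_x i t sf) _ t ht.
apply: (le_trans (H _)) => [u hu|].
  rewrite normrM ger0_norm ?sqr_ge0// ler_wpM2l ?sqr_ge0//.
  rewrite -[leRHS]mulrA.
  apply: (@le_trans _ _ (s2 * cavnu i u M.+2 (fun r => `|f r| * GamA M (xc i r)))).
    rewrite -cavnuZ; apply: cavnu_norm_le => r; rewrite normrM mulrCA ler_wpM2l//.
    exact: dGam_le.
  rewrite ler_wpM2l //; apply: cav_gronwall => // r.
  by rewrite mulr_ge0 ?GamA_ge0.
have -> : beta ^+ 2 * firstC M * nuf M.+2 (fun r => `|f r| * GamA M (xc i r)) = K / 2.
  by rewrite /K /firstC; field.
by rewrite ler_piMr ?divr_ge0//; have := cos2Dsin2 t; have := sqr_ge0 (cos t); lra.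
Qed.

(** The derivative is itself compared with its value at [t = 0] by [cav_first]. Each of the two
    comparisons contributes one factor [GamA] and two replicas. *)
Lemma cav_second i M f : supp M f ->
  `|nuf M f - cavnu i 0 M f - beta ^+ 2 / 2 * cavnu i 0 M.+2 (fun r => f r * dGam i M r)| <=
  firstC M.+2 * s2 * nuf M.+4 (fun r => `|f r| * GamA M (xc i r) * GamA M.+2 (xc i r)).
Proof.
move=> sf.
set f2 := fun r => f r * dGam i M r.
have sf2 : supp M.+2 f2.
  apply: suppM; last exact: supp_dGam.
  by apply: supp_le sf; rewrite ltnW.
set c := beta ^+ 2 * cavnu i 0 M.+2 f2.
set K := beta ^+ 2 * (beta ^+ 2 * firstC M.+2 * nuf M.+4 (fun r => `|f2 r| * GamA M.+2 (xc i r))).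
have H := @interp_bound_affine _ _ _ c K (fun t => cavnu_derive_x i t sf).
rewrite -(nuf_cavnu beta h D p q) in H.
have -> : beta ^+ 2 / 2 * cavnu i 0 M.+2 f2 = c / 2 by rewrite /c; field.
apply: (le_trans (H _)) => [u hu|].
  rewrite /c -mulrBr normrM ger0_norm ?sqr_ge0// ler_wpM2l ?sqr_ge0//.
  exact: cav_first.
have n0 : 0 <= nuf M.+4 (fun r => `|f2 r| * GamA M.+2 (xc i r)).
  by rewrite (nuf_cavnu beta h D p q i); apply: cavnu_ge0 => r; rewrite mulr_ge0 ?GamA_ge0.
apply: (@le_trans _ _ (firstC M.+2 * nuf M.+4 (fun r => `|f2 r| * GamA M.+2 (xc i r)))).
  have z0 : 0 <= firstC M.+2 * nuf M.+4 (fun r => `|f2 r| * GamA M.+2 (xc i r)).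
    by rewrite mulr_ge0 ?firstC_ge0.
  have -> : K / 2 = beta ^+ 2 * (beta ^+ 2 / 2) *
    (firstC M.+2 * nuf M.+4 (fun r => `|f2 r| * GamA M.+2 (xc i r))) by rewrite /K; field.
  have := b2_le1; have := sqr_ge0 beta; move: z0.
  move: (firstC M.+2 * _) => z z0 g0 g1.
  by rewrite ler_piMl//; nra.
rewrite -mulrA ler_wpM2l ?firstC_ge0// !(nuf_cavnu beta h D p q i) -cavnuZ; apply: cavnu_le => r.
rewrite mulrA ler_wpM2r ?GamA_ge0// /f2 normrM mulrCA ler_wpM2l//.
exact: dGam_le.
Qed.
End CavityEstimates.

(** * A priori moment bounds *)

Section PowerBounds.
Context {R : realType}.
Implicit Types (x y a b d u : R) (m k : nat).

Lemma powD_le a b m : 0 <= a -> 0 <= b -> (a + b) ^+ m <= 2 ^+ m * (a ^+ m + b ^+ m).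
Proof.
move=> a0 b0; have [ab|ab] := leP a b.
  apply: (@le_trans _ _ ((2 * b) ^+ m)).
    by rewrite lerXn2r ?nnegrE ?addr_ge0 ?mulr_ge0//; lra.
  by rewrite exprMn ler_wpM2l ?exprn_ge0// lerDr exprn_ge0.
apply: (@le_trans _ _ ((2 * a) ^+ m)).
  by rewrite lerXn2r ?nnegrE ?addr_ge0 ?mulr_ge0//; lra.
by rewrite exprMn ler_wpM2l ?exprn_ge0// lerDl exprn_ge0.
Qed.

Lemma pow_diff_le x y m : `|x ^+ m.+1 - y ^+ m.+1| <= m.+1%:R * `|x - y| * (`|x| + `|y|) ^+ m.
Proof.
elim: m => [|m IH]; first by rewrite !expr1 expr0 mulr1 mul1r.
have -> : x ^+ m.+2 - y ^+ m.+2 = x * (x ^+ m.+1 - y ^+ m.+1) + (x - y) * y ^+ m.+1.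
  by rewrite !exprS; ring.
rewrite (le_trans (ler_normD _ _))// !normrM -natr1 !mulrDl mul1r lerD//.
  apply: (@le_trans _ _ ((`|x| + `|y|) * (m.+1%:R * `|x - y| * (`|x| + `|y|) ^+ m))).
    by rewrite ler_pM// lerDl.
  by rewrite le_eqVlt exprS; apply/orP; left; apply/eqP; ring.
by rewrite ler_wpM2l// normrX lerXn2r ?nnegrE ?addr_ge0// lerDr.
Qed.

Lemma pow_pow_le x y m : `|x| ^+ m * `|y| <= `|x| ^+ m.+1 + `|y| ^+ m.+1.
Proof.
have [xy|xy] := leP `|x| `|y|.
  apply: (@le_trans _ _ (`|y| ^+ m.+1)); last by rewrite lerDr exprn_ge0.
  by rewrite exprSr ler_wpM2r// lerXn2r ?nnegrE.
apply: (@le_trans _ _ (`|x| ^+ m.+1)); last by rewrite lerDl exprn_ge0.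
by rewrite exprSr ler_wpM2l ?exprn_ge0// ltW.
Qed.

Lemma even_pow_norm x k : `|x| ^+ (k.*2) = x ^+ (k.*2).
Proof. by rewrite -mul2n !exprM real_normK ?num_real. Qed.

(* Replacing an overlap by its cavity version only costs moments of lower order. *)
Lemma pow_perturb (B : R) k : 0 <= B -> exists2 C, 0 <= C & forall x y u, 0 <= u <= 1 ->
  `|x| <= B -> `|x - y| <= B * u ->
  `|x ^+ (k.*2).+1 - y ^+ (k.*2).+1| <= C * u * (x ^+ (k.*2) + u ^+ k) /\
  `|x ^+ (k.*2).+2 - y ^+ (k.*2).+2| <= C * u * (x ^+ (k.*2) + u ^+ k).
Proof.
move=> B0.
have gen m : exists2 C, 0 <= C & forall x y u, 0 <= u <= 1 -> `|x - y| <= B * u ->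
    `|x ^+ m.+1 - y ^+ m.+1| <= C * u * (`|x| ^+ m + u ^+ m).
  exists (m.+1%:R * B * (2 ^+ m * (2 ^+ m + B ^+ m))) => [|x y u /andP[u0 u1] xy].
    by rewrite !mulr_ge0 ?addr_ge0 ?exprn_ge0.
  have hy : `|x| + `|y| <= 2 * `|x| + B * u.
    have := ler_normB x (x - y); rewrite subKr => h; lra.
  have Bu : 0 <= B * u by rewrite mulr_ge0.
  apply: (le_trans (pow_diff_le _ _ _)).
  apply: (@le_trans _ _ (m.+1%:R * (B * u) * (2 ^+ m * ((2 * `|x|) ^+ m + (B * u) ^+ m)))).
    rewrite ler_pM// ?mulr_ge0 ?exprn_ge0 ?addr_ge0//; first by rewrite ler_wpM2l.
    apply: le_trans (powD_le _ _ _); rewrite ?mulr_ge0//.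
    by rewrite lerXn2r ?nnegrE ?addr_ge0 ?mulr_ge0.
  have -> : m.+1%:R * B * (2 ^+ m * (2 ^+ m + B ^+ m)) * u * (`|x| ^+ m + u ^+ m) =
    m.+1%:R * (B * u) * (2 ^+ m * ((2 ^+ m + B ^+ m) * (`|x| ^+ m + u ^+ m))) by ring.
  rewrite ler_wpM2l ?mulr_ge0// ler_wpM2l ?exprn_ge0// !exprMn.
  have h1 : 0 <= `|x| ^+ m by rewrite exprn_ge0.
  have h2 : 0 <= u ^+ m by rewrite exprn_ge0.
  have h3 : 0 <= 2 ^+ m :> R by rewrite exprn_ge0.
  have h4 : 0 <= B ^+ m by rewrite exprn_ge0.
  have := mulr_ge0 h3 h2; have := mulr_ge0 h4 h1; nra.
have [C1 C10 H1] := gen (k.*2); have [C2 C20 H2] := gen (k.*2).+1.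
exists (C1 + C2 * (B + 1)) => [|x y u hu xB xy]; first by rewrite addr_ge0 ?mulr_ge0 ?addr_ge0.
have /andP[u0 u1] := hu.
have e0 : 0 <= x ^+ k.*2 by rewrite -even_pow_norm exprn_ge0.
have uk : u ^+ k.*2 <= u ^+ k by rewrite ler_wiXn2l// -addnn leq_addr.
have uk0 : 0 <= u ^+ k by rewrite exprn_ge0.
split.
  apply: (le_trans (H1 x y u hu xy)); rewrite even_pow_norm -!mulrA.
  apply: (@le_trans _ _ (C1 * (u * (x ^+ k.*2 + u ^+ k)))).
    by rewrite ler_wpM2l// ler_wpM2l// lerD2l.
  by rewrite ler_wpM2r ?mulr_ge0 ?addr_ge0// lerDl mulr_ge0 ?addr_ge0.
(* The remaining odd power of [x] is reduced to an even one by [|x| <= B]. *)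
apply: (le_trans (H2 x y u hu xy)).
apply: (@le_trans _ _ (C2 * u * ((B + 1) * (x ^+ k.*2 + u ^+ k)))).
  rewrite ler_wpM2l ?mulr_ge0// exprS even_pow_norm mulrDr lerD//.
    by rewrite ler_wpM2r// (le_trans xB)// lerDl.
  have h : u ^+ (k.*2).+1 <= u ^+ k by rewrite ler_wiXn2l// -addnn -addnS leq_addr.
  apply: (le_trans h); rewrite ler_peMl//; lra.
have z0 : 0 <= u * (x ^+ k.*2 + u ^+ k) by rewrite mulr_ge0 ?addr_ge0.
have := mulr_ge0 C10 z0; lra.
Qed.

(** A product is at most the corresponding power of its largest factor; [M] in the induction is that
    factor, and the 1 covers the empty product. *)
Lemma prod_le_sum_pow (I : Type) (s : seq I) (Y : I -> R) : (forall i, 0 <= Y i) ->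
  \prod_(i <- s) Y i <= 1 + \sum_(i <- s) Y i ^+ size s.
Proof.
move=> Y0.
have H : forall s, s = [::] \/ exists2 M, (0 <= M /\ \prod_(i <- s) Y i <= M ^+ size s) &
     (M ^+ size s <= \sum_(i <- s) Y i ^+ size s /\ forall k, M ^+ k <= \sum_(i <- s) Y i ^+ k).
  elim=> [|a s' [->|[M [M0 h1] [h2 h3]]]]; first by left.
    right; exists (Y a); rewrite ?big_seq1 /= ?expr1; split=> //.
    by move=> k; rewrite big_seq1.
  right; rewrite /= big_cons; have [aM|aM] := leP (Y a) M.
    exists M; split=> //.
    - by rewrite exprS ler_pM// prodr_ge0.
    - by rewrite big_cons (le_trans (h3 _))// lerDr exprn_ge0.
    - by move=> k; rewrite big_cons (le_trans (h3 _))// lerDr exprn_ge0.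
  exists (Y a); split=> //.
  - rewrite exprS ler_wpM2l// (le_trans h1)// lerXn2r ?nnegrE//; exact: ltW.
  - by rewrite big_cons lerDl sumr_ge0// => i _; rewrite exprn_ge0.
  - by move=> k; rewrite big_cons lerDl sumr_ge0// => i _; rewrite exprn_ge0.
case: (H s) => [->|[M [M0 h1] [h2 h3]]]; first by rewrite !big_nil addr0.
by apply: (le_trans h1); apply: (le_trans h2); rewrite lerDr.
Qed.
End PowerBounds.

Section Symmetry.
Context {R : realType} (S N : nat) (beta h D p q : R).
Local Notation conf := (config S N).
Local Notation nuf := (@nuf R S N beta h D).
Implicit Types (r : nat -> conf) (k l M : nat).
Hypothesis N0 : (0 < N)%N.

(** Two transpositions suffice; the image [m] of [l] under the first one differs from [k'], so the
    second one leaves [k'] in place. *)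
Lemma nuf_sym2 M (phi : conf -> conf -> R) k l k' l' : (k < M)%N -> (l < M)%N ->
  k != l -> (k' < M)%N -> (l' < M)%N -> k' != l' ->
  nuf M (fun r => phi (r k) (r l)) = nuf M (fun r => phi (r k') (r l')).
Proof.
move=> kM lM kl k'M l'M kl'.
have swM a b c : (a < M)%N -> (b < M)%N -> (c < M)%N -> (sw a b c < M)%N.
  by move=> aM bM cM; rewrite /sw; case: ifP => // _; case: ifP.
rewrite -(nuf_swap beta h D N0 (fun r => phi (r k) (r l)) kM k'M) /=.
have -> : sw k k' k = k' by rewrite /sw eqxx.
set m := sw k k' l.
have mM : (m < M)%N by exact: swM.
have mk : m != k'.
  rewrite /m /sw [l == k]eq_sym (negbTE kl).
  by case: (eqVneq l k') => [<-|].
rewrite -(nuf_swap beta h D N0 (fun r => phi (r k') (r m)) mM l'M) /=.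
have -> : sw m l' m = l' by rewrite /sw eqxx.
have -> // : sw m l' k' = k'.
by rewrite /sw eq_sym (negbTE mk) (negbTE kl').
Qed.

Lemma nuf_sym1 M (phi : conf -> R) k k' : (k < M)%N -> (k' < M)%N ->
  nuf M (fun r => phi (r k)) = nuf M (fun r => phi (r k')).
Proof.
move=> kM k'M; rewrite -(nuf_swap beta h D N0 (fun r => phi (r k)) kM k'M) /=.
by rewrite /sw eqxx.
Qed.

Local Notation xx := (@xx R S N p q).
Local Notation epsr := (@epsr R S N).
Local Notation Qn := (Qn p q).

(** [xx] is the average over sites of the centered spin products, so a bound uniform in the site
    passes to [xx]. *)
Lemma site_average M (g : (nat -> conf) -> R) k l (c e : R) :
  (forall i : 'I_N, `|nuf M (fun r => (epsr i r k * epsr i r l - Qn k l) * g r) - c| <= e) ->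
  `|nuf M (fun r => xx r k l * g r) - c| <= e.
Proof.
move=> H; have Nn0 : (N%:R : R) != 0 by rewrite pnatr_eq0 -lt0n.
have cN (z : R) : N%:R^-1 * \sum_(i < N) z = z.
  by rewrite sumr_const card_ord -[z *+ N]mulr_natl mulKf.
have -> : nuf M (fun r => xx r k l * g r) - c =
  N%:R^-1 * \sum_(i < N) (nuf M (fun r => (epsr i r k * epsr i r l - Qn k l) * g r) - c).
  rewrite big_split /= mulrDr cN; congr (_ + _).
  rewrite -nuf_sum// -nufZ//; apply: nuf_ext => r.
  rewrite -big_distrl /= sumrB mulrA mulrBr cN /xx /ovr.
  by congr ((_ * _ - _) * _).
rewrite normrM ger0_norm ?invr_ge0// -[leRHS]cN ler_wpM2l ?invr_ge0//.
by rewrite (le_trans (ler_norm_sum _ _ _))//; apply: ler_sum => i _.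
Qed.

(* By symmetry between replicas these two moments bound all even moments of order [2k]. *)
Definition Vm k : R := nuf 4 (fun r => xx r 0 1 ^+ k.*2) + nuf 4 (fun r => xx r 0 0 ^+ k.*2).

Lemma nuf_even_ge0 M k a b : 0 <= nuf M (fun r => xx r a b ^+ k.*2).
Proof. by apply: nuf_ge0 => // r; rewrite -even_pow_norm exprn_ge0. Qed.

Lemma nuf_le_Vm M k a b : (a < M)%N -> (b < M)%N -> nuf M (fun r => xx r a b ^+ k.*2) <= Vm k.
Proof.
move=> aM bM.
have s1 c d K : (c < K)%N -> (d < K)%N -> supp K (fun r => xx r c d ^+ k.*2).
  by move=> cK dK r r' E; rewrite (supp_xx p q cK dK E).
(* Enlarging the system of replicas provides replicas 0 and 1 to swap with, even for small [M]. *)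
have -> : nuf M (fun r => xx r a b ^+ k.*2) = nuf (M + 4) (fun r => xx r a b ^+ k.*2).
  by rewrite (@nuf_supp _ _ _ _ _ _ N0 M)//; [rewrite leq_addr|exact: s1].
have lt0 c : (c < M)%N -> (c < M + 4)%N by move=> cM; rewrite ltn_addr.
have lt4 c : (c < 4)%N -> (c < M + 4)%N by move=> cM; rewrite ltn_addl.
case: (eqVneq a b) => [<-|ab].
  have -> : nuf (M + 4) (fun r => xx r a a ^+ k.*2) = nuf (M + 4) (fun r => xx r 0 0 ^+ k.*2).
    rewrite /xx /Qn !eqxx.
    exact: (@nuf_sym1 _ (fun u => (N%:R^-1 * (\sum_(j < N) Defs.sval (u j) * Defs.sval (u j)) - p) ^+ k.*2) a 0 (lt0 _ aM) (lt4 _ _)).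
  rewrite (@nuf_supp _ _ _ _ _ _ N0 4)//; [|by rewrite leq_addl|exact: s1].
  by rewrite lerDr nuf_even_ge0.
have -> : nuf (M + 4) (fun r => xx r a b ^+ k.*2) = nuf (M + 4) (fun r => xx r 0 1 ^+ k.*2).
  rewrite /xx /Qn (negbTE ab) /=.
  exact: (@nuf_sym2 _ (fun u v => (N%:R^-1 * (\sum_(j < N) Defs.sval (u j) * Defs.sval (v j)) - q) ^+ k.*2) a b 0 1 (lt0 _ aM) (lt0 _ bM) ab (lt4 _ _) (lt4 _ _)).
rewrite (@nuf_supp _ _ _ _ _ _ N0 4)//; [|by rewrite leq_addl|exact: s1].
by rewrite lerDl nuf_even_ge0.
Qed.
End Symmetry.

(** * Bounds on all even moments of the centered overlaps *)

Section APriori.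
Context {R : realType} (S : nat) (h D : R).
Hypothesis S1 : (1 <= S)%N.
Let s2 : R := S%:R ^+ 2.

(** 192 is 2 times 2 times 48: two moments in [Vm], the bound [2 * s2] on a centered spin product,
    and 48 even powers, from the 6 groups of [GamA 2] with four products each, every product split
    in two. The constant does not depend on the order of the moment. *)
Definition htC : R := 192 * s2 * firstC S 2.

Section FixedBeta.
Variables (beta p q : R).
Hypothesis fp : fixed_point S beta h D p q.
Hypothesis b0 : 0 < beta.
Hypothesis b1 : beta <= 1.
Hypothesis bht : beta ^+ 2 * htC <= 1 / 2.
Local Notation nuf N := (@nuf R S N beta h D).
Local Notation xx := (xx p q).
Local Notation Vm N := (@Vm R S N beta h D p q).

Let s20 : 0 <= s2. Proof. exact: sqr_ge0. Qed.

Let s21 : 1 <= s2. Proof. by rewrite exprn_ege1// ler1n. Qed.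

(** Induction on the order. One overlap in the power is replaced by a single site product, centered
    in the decoupled system; the interpolation then returns at most [beta ^+ 2 * htC] times the
    moment itself, up to lower moments, and half of the moment is absorbed. *)
Lemma apriori k : exists2 C : R, 0 <= C & forall N, (0 < N)%N -> Vm N k <= C * (N%:R^-1) ^+ k.
Proof.
elim: k => [|k [Ck Ck0 IH]].
  exists 2 => // N N0; rewrite expr0 mulr1.
  have E a b : nuf N 4 (fun r => xx r a b ^+ 0) = 1.
    by rewrite -[RHS](nuf_cst S beta h D N0 4).
  by rewrite [Vm N 0]/(_ + _) !E.
have B0 : 0 <= 2 * s2 by rewrite mulr_ge0.
have [C C0 HC] := pow_perturb k B0.
(* This is the constant in the bound of [(4 * s2 + beta ^+ 2 * htC) * e] by [u ^+ k.+1]; absorbing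
   half of the moment doubles it. *)
pose C2 := 4 * s2 * C * (Ck + 1) + beta ^+ 2 * htC * (C * (Ck + 1)).
have fC0 : 0 <= firstC S 2 :> R by exact: firstC_ge0.
have hC0 : 0 <= htC by rewrite /htC mulr_ge0// mulr_ge0.
have C20 : 0 <= C2.
  have h1 : 0 <= Ck + 1 by lra.
  have h2 : 0 <= 4 * s2 * C by rewrite mulr_ge0// mulr_ge0.
  have h3 : 0 <= beta ^+ 2 * htC by rewrite mulr_ge0// sqr_ge0.
  by rewrite /C2 addr_ge0// mulr_ge0// mulr_ge0.
exists (2 * C2) => [|N N0]; first by rewrite mulr_ge0.
set u : R := N%:R^-1.
have hu : 0 <= u <= 1 by rewrite invr_ge0 ler0n invN_le1.
have /andP[u0 u1] := hu.
set V := Vm N k.+1.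
pose e := C * u * (Vm N k + u ^+ k).
have eB : e <= C * (Ck + 1) * u ^+ k.+1.
  rewrite /e exprS -!mulrA ler_wpM2l// mulrCA ler_wpM2l// mulrDl mul1r lerD2r.
  exact: IH.
have pert (i : 'I_N) (r : nat -> config S N) a b : `|xx r a b ^+ (k.*2).+1 - xc p q i r a b ^+ (k.*2).+1| <= C * u * (xx r a b ^+ (k.*2) + u ^+ k) /\
  `|xx r a b ^+ (k.*2).+2 - xc p q i r a b ^+ (k.*2).+2| <= C * u * (xx r a b ^+ (k.*2) + u ^+ k).
  apply: (HC _ _ _ hu); first exact: (xx_bound N0 fp).
  apply: (le_trans (xc_xx_dist p q i r a b)); rewrite ler_wpM2r//.
  by rewrite ler_peMl// ler1n.
have nue M a b : (a < M)%N -> (b < M)%N -> nuf N M (fun r => C * u * (xx r a b ^+ (k.*2) + u ^+ k)) <= e.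
  move=> aM bM; rewrite nufZ// nufD// nuf_cst// ler_wpM2l ?mulr_ge0// lerD2r.
  exact: nuf_le_Vm.
have nuxc M i a b : (a < M)%N -> (b < M)%N -> nuf N M (fun r => xc p q i r a b ^+ (k.*2).+2) <= V + e.
  move=> aM bM; apply: (@le_trans _ _ (nuf N M (fun r => xx r a b ^+ (k.*2).+2 + C * u * (xx r a b ^+ (k.*2) + u ^+ k)))).
    apply: nuf_le => // r; have [_] := pert i r a b; rewrite ler_norml => /andP[? _]; lra.
  by rewrite nufD// lerD ?nue// -doubleS; exact: nuf_le_Vm.
have main a b : (a < 2)%N -> (b < 2)%N ->
    nuf N 4 (fun r => xx r a b ^+ (k.+1).*2) <= 2 * s2 * e + beta ^+ 2 * (firstC S 2 * (2 * s2 * (48 * (V + e)))).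
  move=> a2 b2.
  have a4 : (a < 4)%N by rewrite (ltn_trans a2).
  have b4 : (b < 4)%N by rewrite (ltn_trans b2).
  have := @site_average R S N beta h D p q N0 4 (fun r => xx r a b ^+ (k.*2).+1) a b 0
    (2 * s2 * e + beta ^+ 2 * (firstC S 2 * (2 * s2 * (48 * (V + e))))).
  rewrite subr0 doubleS => H; apply: (le_trans (ler_norm _)).
  have -> : (fun r : nat -> config S N => xx r a b ^+ (k.*2).+2) = (fun r => xx r a b * xx r a b ^+ (k.*2).+1).
    by apply/funext => r; rewrite exprS.
  apply: H => i; rewrite subr0.
  (* The odd power is taken of [xc], which does not involve site [i], so that [f] decouples at
     [t = 0]. *)
  pose f (r : nat -> config S N) := (epsr i r a * epsr i r b - Qn p q a b) * xc p q i r a b ^+ (k.*2).+1.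
  have epsQ (r : nat -> config S N) : `|epsr i r a * epsr i r b - Qn p q a b| <= 2 * s2 :> R.
    rewrite (le_trans (ler_normB _ _))// (_ : 2 * s2 = s2 + s2); last by ring.
    rewrite lerD ?eps2_bound//; exact: (Qn_bound fp).
  have sf : supp 2 f.
    move=> r r' E; rewrite /f (supp_xc p q i a2 b2 E).
    by rewrite (supp_eps i a2 E) (supp_eps i b2 E).
  have z : cavnu beta h D p q i 0 2 f = 0.
    have off : off_siter i (fun r : nat -> config S N => xc p q i r a b ^+ (k.*2).+1).
      by move=> r r' E; rewrite (off_xc p q a b E).
    have -> : f = fun r => xc p q i r a b ^+ (k.*2).+1 * (Defs.sval (r a i) * Defs.sval (r b i) - Qn p q a b).
      by apply/funext => r; rewrite /f mulrC.
    rewrite (cavnu0_decouple beta h D p q 2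
      (fun r : nat -> spin S => Defs.sval (r a) * Defs.sval (r b) - Qn p q a b) off).
    rewrite EspinB (Espin2 fp a2 b2) /Espin.
    have -> : gavg1 (fun x => Av (ord0 : spin S) (softmax (siteE beta h D p q x)) 2 (fun=> Qn p q a b)) = Qn p q a b.
      rewrite -[RHS]gavg1_cst; congr gavg1; apply/funext => x.
      by rewrite Av_cst//; exact: (softmax_prob (ord0 : spin S)).
    by rewrite subrr mulr0.
  have h1 := cav_first N0 fp b0 b1 i sf (_ : 0 <= pi / 2 <= pi / 2).
  rewrite -nuf_cavnu z subr0 in h1.
  have {}h1 := h1 (ltac:(by rewrite lexx andbT divr_ge0// pi_ge0)).
  have -> : nuf N 4 (fun r => (epsr i r a * epsr i r b - Qn p q a b) * xx r a b ^+ (k.*2).+1) =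
    nuf N 4 (fun r => (epsr i r a * epsr i r b - Qn p q a b) * (xx r a b ^+ (k.*2).+1 - xc p q i r a b ^+ (k.*2).+1)) + nuf N 2 f.
    rewrite -(@nuf_supp _ _ _ _ _ _ N0 2 4 f)// -nufD//; apply: nuf_ext => r.
    by  rewrite /f; ring.
  rewrite (le_trans (ler_normD _ _))// lerD//.
    apply: (@le_trans _ _ (nuf N 4 (fun r => 2 * s2 * (C * u * (xx r a b ^+ (k.*2) + u ^+ k))))).
      apply: nuf_norm_le => // r; rewrite normrM ler_pM//.
      by have [] := pert i r a b.
    by rewrite nufZ// ler_wpM2l//; exact: nue.
  apply: (le_trans h1); rewrite -mulrA ler_wpM2l ?sqr_ge0// ler_wpM2l//.
  apply: (@le_trans _ _ (nuf N 4 (fun r => 2 * s2 * \sum_(c < 2) \sum_(d < 3)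
     ((xc p q i r a b ^+ (k.*2).+2 + xc p q i r c d ^+ (k.*2).+2) + (xc p q i r a b ^+ (k.*2).+2 + xc p q i r c 3 ^+ (k.*2).+2)
      + (xc p q i r a b ^+ (k.*2).+2 + xc p q i r 2 d ^+ (k.*2).+2) + (xc p q i r a b ^+ (k.*2).+2 + xc p q i r 2 3 ^+ (k.*2).+2))))).
    apply: nuf_le => // r; rewrite /f normrM -(mulrA `|_ - _|) ler_pM ?mulr_ge0 ?GamA_ge0//.
    (* An odd power times another overlap is at most a sum of two even powers, whose means are at
       most [V + e]. *)
    have ee x y : `|x ^+ (k.*2).+1| * `|y| <= x ^+ (k.*2).+2 + y ^+ (k.*2).+2 :> R.
      by rewrite normrX; have := pow_pow_le x y (k.*2).+1; rewrite -doubleS !even_pow_norm.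
    rewrite /GamA mulr_sumr; apply: ler_sum => c _; rewrite mulr_sumr; apply: ler_sum => d _.
    by rewrite !mulrDr !lerD.
  rewrite nufZ// ler_wpM2l// nuf_sum//.
  apply: (@le_trans _ _ (\sum_(c < 2) \sum_(d < 3) (8 * (V + e)))); last first.
    by rewrite !sumr_const !card_ord -!mulrnA -mulr_natl; lra.
  apply: ler_sum => c _; rewrite nuf_sum//; apply: ler_sum => d _.
  have c4 : (c < 4)%N by rewrite (ltn_trans (ltn_ord c)).
  have d4 : (d < 4)%N by rewrite (ltn_trans (ltn_ord d)).
  rewrite !nufD//.
  have z1 := @nuxc 4 i a b a4 b4; have z2 := @nuxc 4 i c d c4 d4.
  have z3 := @nuxc 4 i c 3 c4 isT; have z4 := @nuxc 4 i 2 d isT d4.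
  have z5 := @nuxc 4 i 2 3 isT isT; lra.
have m1 := main 0%N 1%N isT isT; have m2 := main 0%N 0%N isT isT.
have V0 : 0 <= V by rewrite addr_ge0// nuf_even_ge0.
(* By [bht] the coefficient of [V] on the right is at most one half. *)
have VV : V <= 4 * s2 * e + beta ^+ 2 * htC * (V + e).
  apply: (le_trans (lerD m1 m2)); rewrite /htC le_eqVlt; apply/orP; left; apply/eqP; ring.
have hV := ler_wpM2r V0 bht.
have e0 : 0 <= 4 * s2 + beta ^+ 2 * htC.
  apply: addr_ge0; first exact: mulr_ge0 (ler0n _ 4) s20.
  exact: mulr_ge0 (sqr_ge0 _) hC0.
have := ler_wpM2l e0 eB.
have -> : (4 * s2 + beta ^+ 2 * htC) * (C * (Ck + 1) * u ^+ k.+1) = C2 * u ^+ k.+1 by rewrite /C2; ring.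
lra.
Qed.

Definition Yb N (r : nat -> config S N) (a : nat * nat) : R := s2 + Num.sqrt N%:R * `|xx r a.1 a.2|.

Lemma Yb_ge0 N (r : nat -> config S N) a : 0 <= Yb r a.
Proof. by rewrite /Yb addr_ge0// ?mulr_ge0// sqr_ge0. Qed.

Definition below M (s : seq (nat * nat)) := all (fun a => (a.1 < M)%N && (a.2 < M)%N) s.

(** The product is reduced to powers of single overlaps and these to even moments, where the powers
    of [N] balance those of [apriori]. *)
Lemma Yb_prod_bound M (s : seq (nat * nat)) : below M s ->
  exists2 C : R, 0 <= C & forall N, (0 < N)%N -> nuf N M (fun r => \prod_(a <- s) Yb r a) <= C.
Proof.
move=> sM; set m := size s; have [C C0 HC] := apriori m.
exists (1 + \sum_(a <- s) (2 ^+ m * (s2 ^+ m + (1 + C)))) => [|N N0].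
  rewrite addr_ge0// sumr_ge0// => a _; rewrite mulr_ge0 ?exprn_ge0// !addr_ge0// exprn_ge0//; exact: s20.
apply: (@le_trans _ _ (nuf N M (fun r => 1 + \sum_(a <- s) Yb r a ^+ m))).
  by apply: nuf_le => // r; apply: prod_le_sum_pow => a; exact: Yb_ge0.
rewrite nufD// nuf_cst// lerD2l nuf_sum// !big_seq; apply: ler_sum => a /(allP sM) /andP[a1 a2].
apply: (@le_trans _ _ (nuf N M (fun r => 2 ^+ m * (s2 ^+ m + (1 + N%:R ^+ m * xx r a.1 a.2 ^+ m.*2))))).
  apply: nuf_le => // r; apply: (le_trans (powD_le _ _ _)); rewrite ?mulr_ge0//.
  rewrite ler_wpM2l ?exprn_ge0// lerD2l.
  have -> : N%:R ^+ m * xx r a.1 a.2 ^+ m.*2 = (Num.sqrt N%:R * `|xx r a.1 a.2|) ^+ m ^+ 2.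
    rewrite -exprM muln2 exprMn even_pow_norm; congr (_ * _).
    by rewrite -mul2n exprM sqr_sqrtr.
  (* Passage to even powers by [z <= 1 + z ^+ 2]. *)
  set z := (_ * _) ^+ m; have := sqr_ge0 (z - 1 / 2); rewrite sqrrB; lra.
rewrite nufZ// nufD// nufD// !nuf_cst// nufZ// ler_wpM2l ?exprn_ge0// lerD2l lerD2l.
have Nm : 0 < N%:R ^+ m :> R by rewrite exprn_gt0// ltr0n.
have := le_trans (nuf_le_Vm S beta h D p q N0 m a1 a2) (HC N N0).
by rewrite exprVn ler_pdivlMr// mulrC.
Qed.
End FixedBeta.
End APriori.

(** * The cavity recursion for moments of overlaps *)

Section PickSum.
Context {R : realType} {T : eqType}.
Implicit Types (s u : seq T) (F G : T -> seq T -> R).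

(* Sum of [F b u] over the ways of removing one entry [b] of [s], leaving [u]. *)
Fixpoint pick_sum F s : R :=
  match s with
  | [::] => 0
  | b :: s' => F b s' + pick_sum (fun c u => F c (b :: u)) s'
  end.

(** The hypothesis covers only pairs that actually occur; the permutation transports size and range
    of [s] to [b] and [u]. *)
Lemma pick_sum_ext F G s : (forall b u, perm_eq (b :: u) s -> F b u = G b u) ->
  pick_sum F s = pick_sum G s.
Proof.
elim: s F G => //= b s IH F G H; congr (_ + _); first exact: H.
by apply: IH => c u cu; apply: H; rewrite (perm_catCA [:: c] [:: b] u) /= perm_cons.
Qed.

Lemma pick_sumD F G s :
  pick_sum (fun b u => F b u + G b u) s = pick_sum F s + pick_sum G s.
Proof. by elim: s F G => [|b s IH] F G /=; rewrite ?addr0// IH addrACA. Qed.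

Lemma pick_sumZ (c : R) F s : pick_sum (fun b u => c * F b u) s = c * pick_sum F s.
Proof. by elim: s F => [|b s IH] F /=; rewrite ?mulr0// IH mulrDr. Qed.

Lemma pick_sumN F s : pick_sum (fun b u => - F b u) s = - pick_sum F s.
Proof. by elim: s F => [|b s IH] F /=; rewrite ?oppr0// IH opprD. Qed.

Lemma pick_sumB F G s :
  pick_sum (fun b u => F b u - G b u) s = pick_sum F s - pick_sum G s.
Proof. by rewrite pick_sumD pick_sumN. Qed.
End PickSum.

Lemma GamB {R : realType} M (y z : nat -> nat -> R) :
  Gam M (fun k l => y k l - z k l) = Gam M y - Gam M z.
Proof.
have E : (fun k l => y k l - z k l) = fun k l => y k l + (-1) * z k l.
  by apply/funext => k; apply/funext => l; rewrite mulN1r.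
by rewrite E GamD GamZ mulN1r.
Qed.

(** * Calculus of orders in [N] and the cavity recursion *)

Section Orders.
Context {R : realType} (S : nat) (h D : R).
Hypothesis S1 : (1 <= S)%N.
Variables (beta p q : R).
Hypothesis fp : fixed_point S beta h D p q.
Hypothesis b0 : 0 < beta.
Hypothesis b1 : beta <= 1.
Hypothesis bht : beta ^+ 2 * htC S <= 1 / 2.
Local Notation nuf N := (@nuf R S N beta h D).
Local Notation xx := (xx p q).
Local Notation xc := (xc p q).
Local Notation Yb := (Yb p q).

Definition om (N : nat) : R := (Num.sqrt N%:R)^-1.

Lemma om_ge0 N : 0 <= om N. Proof. by rewrite invr_ge0. Qed.

Lemma om_le1 N : (0 < N)%N -> om N <= 1.
Proof.
move=> N0; have h1 : 1 <= Num.sqrt N%:R :> R by rewrite -[leLHS]sqrtr1 ler_sqrt ?ler0n// ler1n.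
by rewrite invf_le1// (lt_le_trans ltr01).
Qed.

Lemma om2 N : om N ^+ 2 = N%:R^-1.
Proof. by rewrite exprVn sqr_sqrtr. Qed.

Lemma om_sqrt N : (0 < N)%N -> om N * Num.sqrt N%:R = 1.
Proof. by move=> N0; rewrite mulVf// sqrtr_eq0 -ltNge ltr0n. Qed.

Definition allpairsn M : seq (nat * nat) := [seq (k, l) | k <- iota 0 M, l <- iota 0 M].

Lemma below_allpairsn M : below M (allpairsn M).
Proof.
apply/allP => a /allpairsP[[k l] /= [+ + ->]] /=.
by rewrite !mem_iota !add0n /= => -> ->.
Qed.

(** One envelope for all overlaps of the first [M] replicas, rescaled by the square root of [N].
    Being at least 1, it allows estimates with different powers to be added. *)
Definition Zb M N (r : nat -> config S N) : R := 1 + \sum_(a <- allpairsn M) Yb r a.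

Lemma Zb_ge1 M N (r : nat -> config S N) : 1 <= Zb M r.
Proof. by rewrite lerDl sumr_ge0// => a _; exact: Yb_ge0. Qed.

Lemma Yb_le_Zb M N (r : nat -> config S N) k l : (k < M)%N -> (l < M)%N -> Yb r (k, l) <= Zb M r.
Proof.
move=> kM lM; have : (k, l) \in allpairsn M.
  by apply/allpairsP; exists (k, l); rewrite !mem_iota.
move=> /(big_rem _)/= H; rewrite /Zb H/= addrCA lerDl addr_ge0// sumr_ge0// => a _.
exact: Yb_ge0.
Qed.

(** One factor [Zb] at a time is distributed over its sum, and each [Yb] joins the list [t], which
    is why the statement carries [t]. *)
Lemma Zb_moment M j t : below M t ->
  exists2 C : R, 0 <= C & forall N, (0 < N)%N ->
    nuf N M (fun r => (\prod_(a <- t) Yb r a) * Zb M r ^+ j) <= C.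
Proof.
elim: j t => [|j IH] t tM.
  have [C C0 HC] := Yb_prod_bound fp b0 b1 bht tM.
  exists C => // N N0; apply: le_trans (HC N N0); apply: nuf_le => // r.
  by rewrite expr0 mulr1.
have [C C0 HC] := IH t tM.
have H s : below M s -> exists2 C' : R, 0 <= C' & forall N, (0 < N)%N ->
    nuf N M (fun r => (\prod_(a <- t) Yb r a) * Zb M r ^+ j * \sum_(a <- s) Yb r a) <= C'.
  elim: s => [|a s IHs] /= sM.
    exists 0 => // N N0; rewrite -[leRHS](nuf_cst S beta h D N0 M); apply: nuf_le => // r.
    by rewrite big_nil mulr0.
  move: sM => /andP[aM /IHs[C1 C10 H1]].
  have [|C2 C20 H2] := IH (a :: t); first by rewrite /below /= aM.
  exists (C2 + C1); first exact: addr_ge0.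
  move=> N N0; apply: le_trans (lerD (H2 N N0) (H1 N N0)); rewrite -nufD//.
  apply: nuf_le => // r; rewrite !big_cons le_eqVlt; apply/orP; left; apply/eqP; ring.
have [C' C'0 HC'] := H _ (below_allpairsn M).
exists (C + C'); first exact: addr_ge0.
move=> N N0; apply: le_trans (lerD (HC N N0) (HC' N N0)); rewrite -nufD//.
apply: nuf_le => // r; rewrite exprS /Zb le_eqVlt; apply/orP; left; apply/eqP; ring.
Qed.

Definition sitefam := forall N, 'I_N -> (nat -> config S N) -> R.

(* [dom k]: of order N^(-k/2) up to a power of the envelope [Zb], all of whose moments are bounded; [bO k]: of order N^(-k/2). Both are uniform in the site. *)
Definition dom M k (f : sitefam) := exists C j, 0 <= C /\
  forall N (i : 'I_N) r, `|f N i r| <= C * om N ^+ k * Zb M r ^+ j.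

Definition bO k (u : forall N, 'I_N -> R) := exists2 C : R, 0 <= C &
  forall N (i : 'I_N), `|u N i| <= C * om N ^+ k.

Lemma ordN0 N : 'I_N -> (0 < N)%N.
Proof. by case: N => // -[]. Qed.

Lemma bO_ext k u v : (forall N (i : 'I_N), u N i = v N i) -> bO k u -> bO k v.
Proof. by move=> E [C C0 H]; exists C => // N i; rewrite -E. Qed.

Lemma bO_D k u v : bO k u -> bO k v -> bO k (fun N i => u N i + v N i).
Proof.
move=> [C C0 H] [C' C'0 H']; exists (C + C'); first exact: addr_ge0.
by move=> N i; rewrite mulrDl (le_trans (ler_normD _ _))// lerD.
Qed.

Lemma bO_Z k (c : R) u : bO k u -> bO k (fun N i => c * u N i).
Proof.
move=> [C C0 H]; exists (`|c| * C); first exact: mulr_ge0.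
by move=> N i; rewrite normrM -mulrA ler_wpM2l.
Qed.

Lemma bO_N k u : bO k u -> bO k (fun N i => - u N i).
Proof. by move=> [C C0 H]; exists C => // N i; rewrite normrN. Qed.

Lemma bO_B k u v : bO k u -> bO k v -> bO k (fun N i => u N i - v N i).
Proof. by move=> hu hv; apply: bO_D => //; exact: bO_N. Qed.

Lemma bO_0 k : bO k (fun _ _ => 0).
Proof. by exists 0 => // N i; rewrite normr0 !mul0r. Qed.

Lemma bO_sum k (I : Type) (s : seq I) (u : I -> forall N, 'I_N -> R) :
  (forall j, bO k (u j)) -> bO k (fun N i => \sum_(j <- s) u j N i).
Proof.
move=> H; elim: s => [|a s IH].
  by apply: bO_ext (bO_0 k) => N i; rewrite big_nil.
by apply: bO_ext (bO_D (H a) IH) => N i; rewrite big_cons.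
Qed.

Lemma bO_divN k u : bO k u -> bO k.+2 (fun N i => N%:R^-1 * u N i).
Proof.
move=> [C C0 H]; exists C => // N i.
rewrite normrM ger0_norm ?invr_ge0// -om2 -[k.+2]add2n exprD mulrCA.
by rewrite ler_wpM2l ?exprn_ge0// om_ge0.
Qed.

Lemma bO_pick k (T : eqType) (F : T -> seq T -> forall N, 'I_N -> R) s :
  (forall b u, perm_eq (b :: u) s -> bO k (F b u)) ->
  bO k (fun N i => pick_sum (fun b u => F b u N i) s).
Proof.
elim: s F => [|b s IH] F H /=; first exact: bO_0.
apply: bO_D; first exact: H.
apply: (IH (fun c u => F c (b :: u))) => c u cu; apply: H.
by rewrite (perm_catCA [:: c] [:: b] u) /= perm_cons.
Qed.

Lemma bO_Gam k M (u : nat -> nat -> forall N, 'I_N -> R) :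
  (forall a b, (a < M.+2)%N -> (b < M.+2)%N -> bO k (u a b)) ->
  bO k (fun N i => Gam M (fun a b => u a b N i)).
Proof.
move=> H; rewrite /Gam; apply: bO_sum => a; apply: bO_sum => b.
have aM : (a < M.+2)%N by rewrite ltnS ltnW// ltnS ltnW.
have bM : (b < M.+2)%N by rewrite ltnS ltnW.
by apply: bO_D; [apply: bO_B; [apply: bO_B|]|]; apply: H.
Qed.

Section Dom.
Variable M : nat.
Local Notation dom := (dom M).

Lemma dom_ext k (f g : sitefam) : (forall N i r, f N i r = g N i r) -> dom k f -> dom k g.
Proof. by move=> E [C [j [C0 H]]]; exists C, j; split=> // N i r; rewrite -E. Qed.

Lemma dom_le k (f g : sitefam) : (forall N i r, `|f N i r| <= `|g N i r|) -> dom k g -> dom k f.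
Proof. by move=> E [C [j [C0 H]]]; exists C, j; split=> // N i r; apply: le_trans (H N i r). Qed.

Lemma Zb_mono N (r : nat -> config S N) j j' : (j <= j')%N -> Zb M r ^+ j <= Zb M r ^+ j'.
Proof. by move=> jj; rewrite ler_weXn2l// Zb_ge1. Qed.

Lemma Zb_ge0 N (r : nat -> config S N) j : 0 <= Zb M r ^+ j.
Proof. by rewrite exprn_ge0// (le_trans ler01)// Zb_ge1. Qed.

Lemma omX_ge0 N k : 0 <= om N ^+ k.
Proof. by rewrite exprn_ge0// om_ge0. Qed.

Lemma domD k (f g : sitefam) : dom k f -> dom k g -> dom k (fun N i r => f N i r + g N i r).
Proof.
move=> [C [j [C0 H]]] [C' [j' [C'0 H']]]; exists (C + C'), (maxn j j'); split; first exact: addr_ge0.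
move=> N i r; rewrite -mulrA mulrDl (le_trans (ler_normD _ _))// lerD//.
  by apply: (le_trans (H N i r)); rewrite -mulrA !ler_wpM2l ?omX_ge0// Zb_mono// leq_maxl.
by apply: (le_trans (H' N i r)); rewrite -mulrA !ler_wpM2l ?omX_ge0// Zb_mono// leq_maxr.
Qed.

Lemma domM k l (f g : sitefam) : dom k f -> dom l g -> dom (k + l) (fun N i r => f N i r * g N i r).
Proof.
move=> [C [j [C0 H]]] [C' [j' [C'0 H']]]; exists (C * C'), (j + j')%N; split; first exact: mulr_ge0.
move=> N i r; rewrite normrM !exprD.
rewrite (_ : _ * _ * _ * (_ * _) = (C * om N ^+ k * Zb M r ^+ j) * (C' * om N ^+ l * Zb M r ^+ j')); last by ring.
by rewrite ler_pM.
Qed.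

Lemma dom_cst (c : R) : dom 0 (fun _ _ _ => c).
Proof. by exists `|c|, 0%N; split=> // N i r; rewrite !expr0 !mulr1. Qed.

Lemma dom_bnd (c : R) (f : sitefam) : (forall N (i : 'I_N) r, `|f N i r| <= c) -> dom 0 f.
Proof.
move=> H; exists `|c|, 0%N; split=> // N i r; rewrite !expr0 !mulr1.
exact: le_trans (H N i r) (ler_norm _).
Qed.

Lemma domN k (f : sitefam) : dom k f -> dom k (fun N i r => - f N i r).
Proof. by apply: dom_le => N i r; rewrite normrN. Qed.

Lemma domB k (f g : sitefam) : dom k f -> dom k g -> dom k (fun N i r => f N i r - g N i r).
Proof. by move=> hf hg; apply: domD => //; exact: domN. Qed.

Lemma dom_norm k (f : sitefam) : dom k f -> dom k (fun N i r => `|f N i r|).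
Proof. by apply: dom_le => N i r; rewrite normr_id. Qed.

Lemma dom_0 k : dom k (fun _ _ _ => 0).
Proof. by exists 0, 0%N; split=> // N i r; rewrite normr0 !mul0r. Qed.

Lemma dom_sum k (I : Type) (s : seq I) (f : I -> sitefam) :
  (forall j, dom k (f j)) -> dom k (fun N i r => \sum_(j <- s) f j N i r).
Proof.
move=> H; elim: s => [|a s IH].
  by apply: dom_ext (dom_0 k) => N i r; rewrite big_nil.
by apply: dom_ext (domD (H a) IH) => N i r; rewrite big_cons.
Qed.

Lemma dom_prod (s : seq (nat * nat)) (f : nat * nat -> sitefam) : below M s ->
  (forall a b, (a < M)%N -> (b < M)%N -> dom 1 (f (a, b))) ->
  dom (size s) (fun N i r => \prod_(a <- s) f a N i r).
Proof.
move=> + H; elim: s => [|[a b] s IH] /=.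
  by move=> _; apply: dom_ext (dom_cst 1) => N i r; rewrite big_nil.
move=> /andP[/andP[aM bM] /IH sM].
by apply: dom_ext (domM (H _ _ aM bM) sM) => N i r; rewrite big_cons.
Qed.

Lemma dom_divN k (f : sitefam) : dom k f -> dom k.+2 (fun N i r => N%:R^-1 * f N i r).
Proof.
move=> hf; apply: (@domM 2 k (fun N _ _ => N%:R^-1)) => //.
by exists 1, 0%N; split=> // N i r; rewrite om2 expr0 mulr1 mul1r ger0_norm ?invr_ge0.
Qed.

Lemma dom_xx a b : (a < M)%N -> (b < M)%N -> dom 1 (fun N i r => xx r a b).
Proof.
move=> aM bM; exists 1, 1%N; split=> // N i r; rewrite mul1r !expr1.
apply: (@le_trans _ _ (om N * Yb r (a, b))); last first.
  by rewrite ler_wpM2l ?om_ge0// Yb_le_Zb.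
rewrite /Yb mulrDr (mulrA (om N) (Num.sqrt _)) om_sqrt ?(ordN0 i)// mul1r lerDr.
by rewrite mulr_ge0 ?om_ge0// sqr_ge0.
Qed.

Lemma dom_eps (a b : nat) : dom 0 (fun N i r => epsr i r a * epsr i r b).
Proof. by apply: (@dom_bnd (S%:R ^+ 2)) => N i r; exact: eps2_bound. Qed.

Lemma dom_epsQ (a b : nat) : dom 0 (fun N i r => epsr i r a * epsr i r b - Qn p q a b).
Proof. by apply: domB; [exact: dom_eps|exact: dom_cst]. Qed.

Lemma dom_xc a b : (a < M)%N -> (b < M)%N -> dom 1 (fun N i r => xc i r a b).
Proof.
move=> aM bM; apply: dom_ext (_ : dom 1 (fun N i r => xx r a b - N%:R^-1 * (epsr i r a * epsr i r b))).
  by move=> N i r; rewrite xc_xx.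
apply: domB; first exact: dom_xx.
have [C [j [C0 H]]] := dom_divN (dom_eps a b); exists C, j; split=> // N i r.
apply: (le_trans (H N i r)); rewrite ler_wpM2r ?Zb_ge0// ler_wpM2l//.
by rewrite ler_wiXn2l ?om_ge0// om_le1// (ordN0 i).
Qed.

Lemma dom_GamA m : (m.+1 < M)%N -> dom 1 (fun N i r => GamA m (xc i r)).
Proof.
move=> mM; rewrite /GamA; apply: dom_sum => a; apply: dom_sum => b.
have aM : (a < M)%N by rewrite (ltn_trans _ mM)// ltnS ltnW.
have bM : (b < M)%N by rewrite (ltn_trans _ mM).
have m1 : (m < M)%N by rewrite (ltn_trans _ mM).
by do !apply: domD; apply: dom_norm; exact: dom_xc.
Qed.

(** Here the a priori moment bounds turn pointwise orders into orders of averages. *)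
Lemma dom_nuf k f : dom k f -> bO k (fun N i => nuf N M (f N i)).
Proof.
move=> [C [j [C0 H]]]; have [C' C'0 H'] := Zb_moment j (isT : below M [::]).
exists (C * C'); first exact: mulr_ge0.
move=> N i; have N0 := ordN0 i.
apply: (@le_trans _ _ (nuf N M (fun r => C * om N ^+ k * ((\prod_(a <- [::]) Yb r a) * Zb M r ^+ j)))).
  by apply: nuf_norm_le => // r; rewrite big_nil mul1r.
by rewrite nufZ// (mulrAC C C') ler_wpM2l ?mulr_ge0 ?omX_ge0// H'.
Qed.
End Dom.

Definition Xs N (r : nat -> config S N) (s : seq (nat * nat)) : R := \prod_(a <- s) xx r a.1 a.2.
Definition Xcs N (i : 'I_N) (r : nat -> config S N) (s : seq (nat * nat)) : R :=
  \prod_(a <- s) xc i r a.1 a.2.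
Definition eps2 N (i : 'I_N) (r : nat -> config S N) (a : nat * nat) : R :=
  epsr i r a.1 * epsr i r a.2.

Lemma Xs_cons N (r : nat -> config S N) a s : Xs r (a :: s) = xx r a.1 a.2 * Xs r s.
Proof. by rewrite /Xs big_cons. Qed.

Lemma Xcs_cons N (i : 'I_N) (r : nat -> config S N) a s :
  Xcs i r (a :: s) = xc i r a.1 a.2 * Xcs i r s.
Proof. by rewrite /Xcs big_cons. Qed.

Lemma xx_xc N (i : 'I_N) (r : nat -> config S N) a :
  xx r a.1 a.2 = xc i r a.1 a.2 + N%:R^-1 * eps2 i r a.
Proof. by rewrite xc_xx /eps2; ring. Qed.

Lemma dom_Xs M s : below M s -> dom M (size s) (fun N i r => Xs r s).
Proof. by move=> sM; apply: dom_prod => // a b aM bM; exact: dom_xx. Qed.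

Lemma dom_Xcs M s : below M s -> dom M (size s) (fun N i r => Xcs i r s).
Proof. by move=> sM; apply: dom_prod => // a b aM bM; exact: dom_xc. Qed.

(** Removing one site changes a factor of order 1 by a term of order 2, so one order is gained. *)
Lemma dom_Xdiff M s : below M s -> dom M (size s).+1 (fun N i r => Xs r s - Xcs i r s).
Proof.
elim: s => [|a s IH] /= sM.
  by apply: dom_ext (dom_0 M 1) => N i r; rewrite /Xs /Xcs !big_nil subrr.
move: sM => /andP[/andP[aM bM] sM].
apply: dom_ext (domD (domM (dom_xc aM bM) (IH sM)) (dom_divN (domM (dom_eps M a.1 a.2) (dom_Xs sM)))).
by move=> N i r; rewrite Xs_cons Xcs_cons (xx_xc i) /eps2; ring.
Qed.

(** The terms in which a single factor loses its site are kept explicitly; they become the pairing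
    terms of the recursion. *)
Lemma dom_Xdiff2 M s : below M s -> dom M (size s).+2 (fun N i r =>
  Xs r s - Xcs i r s - N%:R^-1 * pick_sum (fun b u => eps2 i r b * Xcs i r u) s).
Proof.
elim: s => [|a s IH] /= sM.
  by apply: dom_ext (dom_0 M 2) => N i r; rewrite /Xs /Xcs !big_nil subrr mulr0 subrr.
move: sM => /andP[/andP[aM bM] sM].
apply: dom_ext (domD (domM (dom_xc aM bM) (IH sM)) (dom_divN (domM (dom_eps M a.1 a.2) (dom_Xdiff sM)))).
move=> N i r; rewrite Xs_cons Xcs_cons (xx_xc i).
have -> : pick_sum (fun b u => eps2 i r b * Xcs i r (a :: u)) s =
   xc i r a.1 a.2 * pick_sum (fun b u => eps2 i r b * Xcs i r u) s.
  by rewrite -pick_sumZ; apply: pick_sum_ext => b u _; rewrite Xcs_cons mulrCA.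
rewrite /eps2; ring.
Qed.

Lemma supp_Xcs M N (i : 'I_N) s : below M s -> supp M (fun r => Xcs i r s).
Proof.
elim: s => [|a s IH] /= sM r r' E; first by rewrite /Xcs !big_nil.
move: sM => /andP[/andP[aM bM] sM].
by rewrite !Xcs_cons (supp_xc p q i aM bM E) (IH sM r r' E).
Qed.

Lemma supp_Xs M N s : below M s -> supp M (fun r : nat -> config S N => Xs r s).
Proof.
elim: s => [|a s IH] /= sM r r' E; first by rewrite /Xs !big_nil.
move: sM => /andP[/andP[aM bM] sM].
by rewrite !Xs_cons (supp_xx p q aM bM E) (IH sM r r' E).
Qed.

Lemma off_Xcs N (i : 'I_N) s : off_siter i (fun r => Xcs i r s).
Proof.
by move=> r r' E; apply: eq_bigr => a _; exact: off_xc.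
Qed.

Lemma supp_eps2 M N (i : 'I_N) a : (a.1 < M)%N -> (a.2 < M)%N -> supp M (fun r => eps2 i r a).
Proof. by move=> aM bM r r' E; rewrite /eps2 (supp_eps i aM E) (supp_eps i bM E). Qed.

Let pihalf : 0 <= (pi / 2 : R) <= pi / 2.
Proof. by rewrite lexx andbT divr_ge0// pi_ge0. Qed.

Local Notation cav0 i := (cavnu beta h D p q i 0).

Lemma bO_first M k (f : sitefam) : (forall N (i : 'I_N), supp M (f N i)) -> dom M.+2 k f ->
  bO k.+1 (fun N i => nuf N M (f N i) - cav0 i M (f N i)).
Proof.
move=> sf df.
have := bO_Z (beta ^+ 2 * firstC S M) (dom_nuf (domM (dom_norm df) (dom_GamA (ltnSn M.+1)))).
rewrite addn1; move=> [C C0 H]; exists C => // N i; apply: le_trans (H N i).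
have N0 := ordN0 i.
have := cav_first N0 fp b0 b1 i (sf N i) pihalf; rewrite -nuf_cavnu => /le_trans; apply.
exact: ler_norm.
Qed.

Lemma bO_second M k (f : sitefam) : (forall N (i : 'I_N), supp M (f N i)) -> dom M.+4 k f ->
  bO k.+2 (fun N i => nuf N M (f N i) - cav0 i M (f N i)
     - beta ^+ 2 / 2 * cav0 i M.+2 (fun r => f N i r * dGam p q i M r)).
Proof.
move=> sf df.
have := bO_Z (firstC S M.+2 * S%:R ^+ 2) (dom_nuf (domM (domM (dom_norm df)
  (dom_GamA (leqW (leqW (ltnSn M.+1))))) (dom_GamA (ltnSn M.+3)))).
rewrite !addn1; move=> [C C0 H]; exists C => // N i; apply: le_trans (H N i).
by apply: le_trans (cav_second (ordN0 i) fp b0 b1 i (sf N i)) _; exact: ler_norm.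
Qed.
Lemma below_le M M' s : (M <= M')%N -> below M s -> below M' s.
Proof.
move=> MM; apply: sub_all => a /andP[aM bM].
by rewrite !(leq_trans _ MM).
Qed.

Lemma below_perm M s t : perm_eq s t -> below M s = below M t.
Proof. exact: perm_all. Qed.

Lemma cavnu_Gam N (i : 'I_N) t M m (y : nat -> nat -> (nat -> config S N) -> R) :
  cavnu beta h D p q i t m (fun r => Gam M (fun k l => y k l r)) =
  Gam M (fun k l => cavnu beta h D p q i t m (y k l)).
Proof.
rewrite /Gam cavnu_sum; apply: eq_bigr => k _; rewrite cavnu_sum; apply: eq_bigr => l _.
by rewrite cavnuD !cavnuB.
Qed.

Lemma nuf_pick N M (F : nat * nat -> seq (nat * nat) -> (nat -> config S N) -> R) s : (0 < N)%N ->
  nuf N M (fun r => pick_sum (fun b u => F b u r) s) = pick_sum (fun b u => nuf N M (F b u)) s.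
Proof.
move=> N0; elim: s F => [|b s IH] F /=; first by rewrite nuf_cst.
by rewrite nufD//; congr (_ + _); apply: (IH (fun c u => F c (b :: u))).
Qed.

Lemma Gam_ext M (y z : nat -> nat -> R) :
  (forall k l, (k < M.+2)%N -> (l < M.+2)%N -> y k l = z k l) -> Gam M y = Gam M z.
Proof.
move=> H; apply: eq_bigr => k _; apply: eq_bigr => l _.
have kM : (k < M.+2)%N by rewrite ltnS ltnW// ltnS ltnW.
have lM : (l < M.+2)%N by rewrite ltnS ltnW.
by rewrite !H.
Qed.

Definition mu N M s := nuf N M (fun r => Xs r s).
Definition ck (a b : nat * nat) : R := cker S beta h D p q a.1 a.2 b.1 b.2.
Definition Qp (a : nat * nat) : R := Qn p q a.1 a.2.

Lemma bO_cavX M s : below M s -> bO (size s).+1 (fun N i => cav0 i M (fun r => Xcs i r s) - mu N M s).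
Proof.
move=> sM; have sM2 : below M.+2 s by apply: below_le sM; rewrite leqW.
have h1 := bO_first (fun N i => @supp_Xcs M N i s sM) (dom_Xcs sM2).
have h2 := dom_nuf (dom_Xdiff sM).
apply: bO_ext (bO_N (bO_D h1 h2)) => N i.
by rewrite nufB ?(ordN0 i)// -/(mu N M s); ring.
Qed.

Lemma cav0_epsQ N (i : 'I_N) M a s : (a.1 < M)%N -> (a.2 < M)%N ->
  cav0 i M (fun r => (eps2 i r a - Qp a) * Xcs i r s) = 0.
Proof.
move=> aM bM.
have -> : (fun r : nat -> config S N => (eps2 i r a - Qp a) * Xcs i r s) = fun r => Xcs i r s *
   (Defs.sval (r a.1 i) * Defs.sval (r a.2 i) - Qp a) by apply/funext => r; rewrite mulrC.
rewrite (cavnu0_decouple beta h D p q M (fun r : nat -> spin S =>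
  Defs.sval (r a.1) * Defs.sval (r a.2) - Qp a) (@off_Xcs N i s)).
rewrite EspinB (Espin2 fp aM bM) /Espin.
have -> : gavg1 (fun x => Av (ord0 : spin S) (softmax (siteE beta h D p q x)) M (fun=> Qp a)) = Qp a.
  rewrite -[RHS]gavg1_cst; congr gavg1; apply/funext => x.
  by rewrite Av_cst//; exact: (softmax_prob (ord0 : spin S)).
by rewrite subrr mulr0.
Qed.

Lemma cav0_epsQeps N (i : 'I_N) M a b s : (a.1 < M)%N -> (a.2 < M)%N -> (b.1 < M)%N -> (b.2 < M)%N ->
  cav0 i M (fun r => (eps2 i r a - Qp a) * (eps2 i r b * Xcs i r s)) =
  ck a b * cav0 i M (fun r => Xcs i r s).
Proof.
move=> a1M a2M b1M b2M.
have -> : (fun r : nat -> config S N => (eps2 i r a - Qp a) * (eps2 i r b * Xcs i r s)) = fun r => Xcs i r s *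
   ((Defs.sval (r a.1 i) * Defs.sval (r a.2 i) - Qp a) * (Defs.sval (r b.1 i) * Defs.sval (r b.2 i))).
  by apply/funext => r; rewrite [RHS]mulrC mulrA.
rewrite (cavnu0_decouple beta h D p q M (fun r : nat -> spin S =>
  (Defs.sval (r a.1) * Defs.sval (r a.2) - Qp a) * (Defs.sval (r b.1) * Defs.sval (r b.2)))
  (@off_Xcs N i s)).
by rewrite (Espin4 fp) 1?mulrC.
Qed.

(** The value at [t = 0] vanishes by centering. The derivative there factorises into [ck] times
    cavity moments with one more overlap, and replacing these by [mu] costs only an error of the
    allowed order. *)
Lemma bO_drift M a s : (a.1 < M)%N -> (a.2 < M)%N -> below M s ->
  bO (size s).+2 (fun N i => nuf N M (fun r => (eps2 i r a - Qp a) * Xcs i r s)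
    - beta ^+ 2 / 2 * Gam M (fun k l => ck a (k, l) * mu N M.+2 ((k, l) :: s))).
Proof.
move=> aM bM sM; have sM2 : below M.+2 s by apply: below_le sM; rewrite leqW.
have sM4 : below M.+4 s by apply: below_le sM2; rewrite leqW.
pose f : sitefam := fun N i r => (eps2 i r a - Qp a) * Xcs i r s.
have sf N (i : 'I_N) : supp M (f N i).
  apply: suppM; last exact: supp_Xcs.
  by move=> r r' E; rewrite (supp_eps2 i aM bM E).
have df : dom M.+4 (size s) f by apply: (domM (dom_epsQ _ _ _)); exact: dom_Xcs.
have h1 := bO_second sf df.
have h2 : bO (size s).+2 (fun N i => Gam M (fun k l => ck a (k, l) *
   (cav0 i M.+2 (fun r => Xcs i r ((k, l) :: s)) - mu N M.+2 ((k, l) :: s)))).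
  apply: bO_Gam => k l kM lM; apply: bO_Z; apply: (@bO_cavX M.+2 ((k, l) :: s)).
  by rewrite /below /= kM lM.
apply: bO_ext (bO_D h1 (bO_Z (beta ^+ 2 / 2) h2)) => N i.
rewrite /f cav0_epsQ// subr0.
have -> : (fun r : nat -> config S N => (eps2 i r a - Qp a) * Xcs i r s * dGam p q i M r) =
  fun r => Gam M (fun k l => (eps2 i r a - Qp a) * (eps2 i r (k, l) * Xcs i r ((k, l) :: s))).
  apply/funext => r; rewrite /dGam -GamZ; apply: Gam_ext => k l _ _.
  by rewrite Xcs_cons /eps2 /=; ring.
rewrite cavnu_Gam.
have -> : Gam M (fun k l => cav0 i M.+2 (fun r => (eps2 i r a - Qp a) * (eps2 i r (k, l) * Xcs i r ((k, l) :: s)))) =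
  Gam M (fun k l => ck a (k, l) * cav0 i M.+2 (fun r => Xcs i r ((k, l) :: s))).
  by apply: Gam_ext => k l kM lM; rewrite cav0_epsQeps// !ltnS ltnW// ltnW.
set g1 := fun k l => ck a (k, l) * cav0 i M.+2 _.
set g2 := fun k l => ck a (k, l) * mu N M.+2 _.
have -> : Gam M (fun k l => ck a (k, l) * (cav0 i M.+2 (fun r => Xcs i r ((k, l) :: s)) - mu N M.+2 ((k, l) :: s))) =
   Gam M g1 - Gam M g2.
  by rewrite -GamB; apply: Gam_ext => k l _ _; rewrite /g1 /g2 mulrBr.
by rewrite mulrBr addrA subrK.
Qed.

(** First order suffices, because this term is multiplied by the inverse of [N], worth two
    orders. *)
Lemma bO_pair M a b u : (a.1 < M)%N -> (a.2 < M)%N -> below M (b :: u) ->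
  bO (size u).+1 (fun N i => nuf N M (fun r => (eps2 i r a - Qp a) * (eps2 i r b * Xcs i r u))
    - ck a b * mu N M u).
Proof.
move=> aM bM /= /andP[/andP[b1M b2M] uM].
have uM2 : below M.+2 u by apply: below_le uM; rewrite leqW.
pose f : sitefam := fun N i r => (eps2 i r a - Qp a) * (eps2 i r b * Xcs i r u).
have sf N (i : 'I_N) : supp M (f N i).
  apply: suppM; first by move=> r r' E; rewrite (supp_eps2 i aM bM E).
  by apply: suppM; [exact: supp_eps2|exact: supp_Xcs].
have df : dom M.+2 (size u) f.
  by apply: (domM (dom_epsQ _ _ _)); apply: (domM (dom_eps _ _ _)); exact: dom_Xcs.
apply: bO_ext (bO_D (bO_first sf df) (bO_Z (ck a b) (bO_cavX uM))) => N i.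
by rewrite /f cav0_epsQeps// mulrBr addrA subrK.
Qed.

(** With one site product in place of the overlap [a], [Xs] is split into its cavity version, the
    linear correction and a negligible rest; these yield the [Gam] term, the pairing sum and part of
    the error. *)
Lemma cavity_recursion M a s : (a.1 < M)%N -> (a.2 < M)%N -> below M s ->
  exists2 C : R, 0 <= C & forall N, (0 < N)%N ->
  `|mu N M (a :: s) - (N%:R^-1 * pick_sum (fun b u => ck a b * mu N M u) s
     + beta ^+ 2 / 2 * Gam M (fun k l => ck a (k, l) * mu N M.+2 ((k, l) :: s)))| <=
  C * om N ^+ (size s).+2.
Proof.
move=> aM bM sM.
have h1 := dom_nuf (domM (dom_epsQ M a.1 a.2) (dom_Xdiff2 sM)).
have h2 := bO_drift aM bM sM.
have h3 : bO (size s) (fun N i => pick_sum (fun b u =>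
    nuf N M (fun r => (eps2 i r a - Qp a) * (eps2 i r b * Xcs i r u)) - ck a b * mu N M u) s).
  apply: (@bO_pick _ _ (fun b u N i => nuf N M (fun r => (eps2 i r a - Qp a) * (eps2 i r b * Xcs i r u)) - ck a b * mu N M u)).
  move=> b u bu; rewrite -(perm_size bu); apply: bO_pair => //.
  by rewrite (below_perm M bu).
have [C C0 H] := bO_D (bO_D h1 h2) (bO_divN h3).
exists C => // N N0.
have -> : mu N M (a :: s) = nuf N M (fun r => xx r a.1 a.2 * Xs r s).
  by apply: nuf_ext => r; rewrite Xs_cons.
apply: site_average => // i; apply: le_trans (H N i); rewrite le_eqVlt; apply/orP; left; apply/eqP.
congr (`| _ |); rewrite pick_sumB -nuf_pick//.
set g2 := Gam M _; set g3 := pick_sum _ _.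
have -> : nuf N M (fun r => (epsr i r a.1 * epsr i r a.2 - Qn p q a.1 a.2) * Xs r s) =
  nuf N M (fun r => (epsr i r a.1 * epsr i r a.2 - Qn p q a.1 a.2) *
       (Xs r s - Xcs i r s - N%:R^-1 * pick_sum (fun b u => eps2 i r b * Xcs i r u) s))
  + nuf N M (fun r => (eps2 i r a - Qp a) * Xcs i r s)
  + N%:R^-1 * nuf N M (fun r => pick_sum (fun b u => (eps2 i r a - Qp a) * (eps2 i r b * Xcs i r u)) s).
  rewrite -nufZ// -!nufD//; apply: nuf_ext => r.
  by rewrite pick_sumZ /eps2 /Qp; ring.
ring.
Qed.
End Orders.

(** * The covariance system *)

Section KernelAlgebra.
Context {R : realType}.
Implicit Types (M k l u v : nat) (y e : nat -> nat -> R).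

Lemma eqn_ltF M k : (k < M)%N -> ((M == k) = false) * ((M.+1 == k) = false).
Proof. by move=> kM; split; apply: gtn_eqF => //; rewrite ltnS ltnW. Qed.

Lemma Gam_row M k y : (k < M)%N ->
  Gam M (fun u v => (u == k)%:R * y u v) = \sum_(v < M.+1) (y k v - y k M.+1).
Proof.
move=> kM; rewrite /Gam (bigD1 (Ordinal kM))//= [X in _ + X]big1 ?addr0.
  by apply: eq_bigr => v _; rewrite eqxx !(eqn_ltF kM) !mul1r !mul0r subr0 addr0.
move=> u /negbTE uk; apply: big1 => v _.
by rewrite -(inj_eq val_inj) /= in uk; rewrite uk !(eqn_ltF kM) !mul0r !subr0 addr0.
Qed.

Lemma Gam_col M k y : (k < M)%N ->
  Gam M (fun u v => (v == k)%:R * y u v) = \sum_(u < M) (y u k - y M k).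
Proof.
move=> kM; apply: eq_bigr => u _; have kM1 : (k < M.+1)%N by rewrite ltnS ltnW.
rewrite (bigD1 (Ordinal kM1))//= [X in _ + X]big1 ?addr0.
  by rewrite eqxx !(eqn_ltF kM) !mul1r !mul0r subr0 addr0.
move=> v /negbTE vk.
by rewrite -(inj_eq val_inj) /= in vk; rewrite vk !(eqn_ltF kM) !mul0r !subr0 addr0.
Qed.

Lemma Gam_entry M k l y : (k < M)%N -> (l < M)%N ->
  Gam M (fun u v => (u == k)%:R * ((v == l)%:R * y u v)) = y k l.
Proof.
move=> kM lM; rewrite Gam_row//; have lM1 : (l < M.+1)%N by rewrite ltnS ltnW.
rewrite (bigD1 (Ordinal lM1))//= [X in _ + X]big1 ?addr0.
  by rewrite eqxx !(eqn_ltF lM) mul1r mul0r subr0.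
move=> v /negbTE vk.
by rewrite -(inj_eq val_inj) /= in vk; rewrite vk !(eqn_ltF lM) !mul0r subr0.
Qed.

Lemma Gam_diag M y :
  Gam M (fun u v => (u == v)%:R * y u v) = \sum_(u < M) (y u u - y M M).
Proof.
apply: eq_bigr => u _; have uM := ltn_ord u; rewrite big_ord_recr /= eqxx !(eq_sym (u : nat)) !(eqn_ltF uM).
have uM1 : (u < M.+1)%N by rewrite ltnS ltnW.
rewrite (bigD1 u)//= [X in _ + X + _]big1 => [|v vu].
  rewrite eqxx (eqn_ltF uM) (_ : (M == M.+1) = false); last by rewrite ltn_eqF.
  by rewrite !mul0r !mul1r; ring.
rewrite !(eq_sym _ (v : nat)) in vu *.
have -> : ((v : nat) == u) = false by apply/negbTE.
rewrite [(v : nat) == M]eq_sym (eqn_ltF (ltn_ord v)) (_ : (M == M.+1) = false); last by rewrite ltn_eqF.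
by rewrite !mul0r; ring.
Qed.

Lemma Gam_diag_entry M k y : (k < M)%N ->
  Gam M (fun u v => (u == v)%:R * ((u == k)%:R * y u v)) = y k k.
Proof.
move=> kM; rewrite Gam_diag (bigD1 (Ordinal kM))//= [X in _ + X]big1 ?addr0.
  by rewrite eqxx !(eqn_ltF kM) mul1r mul0r subr0.
move=> u /negbTE uk; rewrite -(inj_eq val_inj) /= in uk.
by rewrite uk (eqn_ltF kM) !mul0r subr0.
Qed.

(* [rowex], [diagex] and [Gam M e] are the only nonlocal quantities entering the linear system, see [Gam_Ker]. *)
Definition rowex M e k : R := \sum_(v < M) (e k v - e k M).
Definition diagex M e : R := \sum_(u < M) (e u u - e M M).

Definition KerT (I3 G A I5 E K4 DD : R) M e k l : R :=
  if k != l then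
    I3 * Gam M e + 2 * G * (rowex M e k + rowex M e l) + 2 * A * e k l
    + (I5 - I3) * diagex M e + (E - 2 * G) * (e k k + e l l)
  else I5 * Gam M e + 2 * E * rowex M e k + (K4 - I5) * diagex M e + (DD - 2 * E) * e k k.

(** The kernel is a sum of indicators, each of which reduces [Gam] to a row, the diagonal or one
    entry. Since the two new replicas look alike to an old one, the row sums may stop at [v < M]. *)
Lemma Gam_Ker I3 G A I5 E K4 DD M e k l : (k < M)%N -> (l < M)%N ->
  (forall u v, e u v = e v u) -> (forall u, (u < M)%N -> e u M.+1 = e u M) ->
  Gam M (fun u v => Ker I3 G A I5 E K4 DD k l u v * e u v) = KerT I3 G A I5 E K4 DD M e k l.
Proof.
move=> kM lM es eM.
have row j : (j < M)%N -> Gam M (fun u v => (u == j)%:R * e u v) = rowex M e j.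
  by move=> jM; rewrite Gam_row// big_ord_recr /= eM// subrr addr0.
have col j : (j < M)%N -> Gam M (fun u v => (v == j)%:R * e u v) = rowex M e j.
  by move=> jM; rewrite Gam_col//; apply: eq_bigr => u _; rewrite es (es M).
rewrite /KerT; case: (eqVneq k l) => [<-|kl] /=.
  transitivity (I5 * Gam M e + E * (Gam M (fun u v => (u == k)%:R * e u v) + Gam M (fun u v => (v == k)%:R * e u v))
    + (K4 - I5) * Gam M (fun u v => (u == v)%:R * e u v)
    + (DD - 2 * E) * Gam M (fun u v => (u == v)%:R * ((u == k)%:R * e u v))).
    rewrite -!GamD -!GamZ -!GamD; apply: Gam_ext => u v _ _.
    by rewrite /Ker eqxx /=; ring.
  by rewrite row// col// Gam_diag Gam_diag_entry// /diagex; ring.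
transitivity (I3 * Gam M e + G * (Gam M (fun u v => (u == k)%:R * e u v) + Gam M (fun u v => (u == l)%:R * e u v)
    + Gam M (fun u v => (v == k)%:R * e u v) + Gam M (fun u v => (v == l)%:R * e u v))
  + A * (Gam M (fun u v => (u == k)%:R * ((v == l)%:R * e u v)) + Gam M (fun u v => (u == l)%:R * ((v == k)%:R * e u v)))
  + (I5 - I3) * Gam M (fun u v => (u == v)%:R * e u v)
  + (E - 2 * G) * (Gam M (fun u v => (u == v)%:R * ((u == k)%:R * e u v)) + Gam M (fun u v => (u == v)%:R * ((u == l)%:R * e u v)))).
  rewrite -!GamD -!GamZ -!GamD; apply: Gam_ext => u v _ _.
  by rewrite /Ker kl; ring.
rewrite !row// !col// !Gam_entry// Gam_diag !Gam_diag_entry// (es l k) /diagex; ring.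
Qed.

Lemma sum_eqn M i : (i < M)%N -> \sum_(v < M) ((v : nat) == i)%:R = 1 :> R.
Proof.
move=> iM; rewrite (bigD1 (Ordinal iM))//= eqxx big1 ?addr0// => v /negbTE.
by rewrite -(inj_eq val_inj) /= => ->.
Qed.

Lemma sum_eqnl M i : (i < M)%N -> \sum_(v < M) (i == v)%:R = 1 :> R.
Proof. by move=> iM; rewrite -[RHS](sum_eqn iM); apply: eq_bigr => v _; rewrite eq_sym. Qed.

(** Linear combination by hand: once each hypothesis is supplied with its coefficient [c], a ring or
    field identity remains. *)
Lemma eq_lincomb (l r a b c : R) : l = r -> a = b + c * (l - r) -> a = b.
Proof. by move=> -> ->; rewrite subrr mulr0 addr0. Qed.

Lemma eqn_excl (a b c : nat) : a != b -> (c == a)%:R * (c == b)%:R = 0 :> R.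
Proof. by case: (eqVneq c a) => [->|_] ab; rewrite ?(negbTE ab) ?mulr0 ?mul0r. Qed.

Lemma Ker_sym (I3 G A I5 E K4 DD : R) k l u v :
  Ker I3 G A I5 E K4 DD k l u v = Ker I3 G A I5 E K4 DD u v k l.
Proof.
rewrite /Ker !(eq_sym k) !(eq_sym l).
case: (eqVneq u v) => [<-|uv] /=; case: (eqVneq l k) => [<-|kl] /=.
- ring.
- have /(congr1 (fun z => 2 * A * z)) /= := eqn_excl u kl; lra.
- have /(congr1 (fun z => 2 * A * z)) /= := eqn_excl l uv; rewrite !(eq_sym l); lra.
ring.
Qed.

Lemma Ker_symr (I3 G A I5 E K4 DD : R) k l u v :
  Ker I3 G A I5 E K4 DD k l u v = Ker I3 G A I5 E K4 DD k l v u.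
Proof.
rewrite /Ker; case: (eqVneq u v) => [->//|uv]; case: (eqVneq k l) => [_|kl] /=; ring.
Qed.

Section CovarianceForm.
Variables (A0 A1 A2 C0 C1 B0 B1 : R).
Variables (M i j : nat).
Hypotheses (iM : (i < M)%N) (jM : (j < M)%N).
Let e u v := Ker A0 A1 A2 C0 C1 B0 B1 i j u v.

Let ltF := (eqn_ltF iM, eqn_ltF jM).

Lemma Gam_cst (c : R) : Gam M (fun _ _ => c) = 0.
Proof. by rewrite /Gam big1// => u _; rewrite big1// => v _; ring. Qed.

Lemma rowex_covN k : i != j -> (k < M)%N -> rowex M e k =
  2 * A1 + C0 - A0 + (A2 + C1 - 2 * A1) * ((k == i)%:R + (k == j)%:R).
Proof.
move=> ij kM.
transitivity (\sum_(v < M) (A1 * ((v : nat) == i)%:R + A1 * ((v : nat) == j)%:R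
   + A2 * (k == i)%:R * ((v : nat) == j)%:R + A2 * (k == j)%:R * ((v : nat) == i)%:R
   + ((C0 - A0) + (C1 - 2 * A1) * ((k == i)%:R + (k == j)%:R)) * (k == v)%:R)).
  apply: eq_bigr => v _; rewrite /e /Ker ij !ltF [k == M]eq_sym !(eqn_ltF kM) /=; ring.
by rewrite !big_split /= -!mulr_sumr !sum_eqn// sum_eqnl//; ring.
Qed.

Lemma rowex_covE k : i = j -> (k < M)%N -> rowex M e k =
  C1 + B0 - C0 + (B1 - 2 * C1) * (k == i)%:R.
Proof.
move=> ij kM.
transitivity (\sum_(v < M) (C1 * ((v : nat) == i)%:R
   + ((B0 - C0) + (B1 - 2 * C1) * (k == i)%:R) * (k == v)%:R)).
  apply: eq_bigr => v _; rewrite /e /Ker ij eqxx !ltF [k == M]eq_sym !(eqn_ltF kM) /=; ring.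
by rewrite !big_split /= -!mulr_sumr sum_eqn// sum_eqnl//; ring.
Qed.

Lemma diagex_covN : i != j -> diagex M e = 2 * C1.
Proof.
move=> ij; transitivity (\sum_(u < M) (C1 * ((u : nat) == i)%:R + C1 * ((u : nat) == j)%:R)).
  apply: eq_bigr => u _; rewrite /e /Ker ij !eqxx !ltF /=.
  have /(congr1 (fun z => 2 * A2 * z)) /= := eqn_excl u ij; lra.
by rewrite !big_split /= -!mulr_sumr !sum_eqn//; ring.
Qed.

Lemma diagex_covE : i = j -> diagex M e = B1.
Proof.
move=> ij; transitivity (\sum_(u < M) (B1 * ((u : nat) == i)%:R)).
  apply: eq_bigr => u _; rewrite /e /Ker ij !eqxx !ltF /=; ring.
by rewrite -!mulr_sumr !sum_eqn//; ring.
Qed.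

Lemma Gam_covN : i != j -> Gam M e = 2 * (A2 + C1 - 2 * A1).
Proof.
move=> ij; pose o (u v : nat) : R := 1.
transitivity (Gam M (fun _ _ => A0) + A1 * (Gam M (fun u v => (u == i)%:R * o u v) + Gam M (fun u v => (u == j)%:R * o u v)
    + Gam M (fun u v => (v == i)%:R * o u v) + Gam M (fun u v => (v == j)%:R * o u v))
  + A2 * (Gam M (fun u v => (u == i)%:R * ((v == j)%:R * o u v)) + Gam M (fun u v => (u == j)%:R * ((v == i)%:R * o u v)))
  + (C0 - A0) * Gam M (fun u v => (u == v)%:R * o u v)
  + (C1 - 2 * A1) * (Gam M (fun u v => (u == v)%:R * ((u == i)%:R * o u v)) + Gam M (fun u v => (u == v)%:R * ((u == j)%:R * o u v)))).
  rewrite -!GamD -!GamZ -!GamD; apply: Gam_ext => u v _ _.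
  by rewrite /e /Ker ij /o /=; ring.
rewrite Gam_cst !Gam_entry// !Gam_diag_entry// !Gam_row// !Gam_col// Gam_diag /o.
by rewrite !big1; try (by move=> *; rewrite subrr); ring.
Qed.

Lemma Gam_covE : i = j -> Gam M e = B1 - 2 * C1.
Proof.
move=> ij; pose o (u v : nat) : R := 1.
transitivity (Gam M (fun _ _ => C0) + C1 * (Gam M (fun u v => (u == i)%:R * o u v)
    + Gam M (fun u v => (v == i)%:R * o u v))
  + (B0 - C0) * Gam M (fun u v => (u == v)%:R * o u v)
  + (B1 - 2 * C1) * Gam M (fun u v => (u == v)%:R * ((u == i)%:R * o u v))).
  rewrite -!GamD -!GamZ -!GamD; apply: Gam_ext => u v _ _.
  by rewrite /e /Ker ij eqxx /o /=; ring.
rewrite Gam_cst !Gam_diag_entry// !Gam_row// !Gam_col// Gam_diag /o.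
by rewrite !big1; try (by move=> *; rewrite subrr); ring.
Qed.

Variables (I3 G A I5 E K4 DD n1 kap : R).
Hypothesis hA2 : A2 = A * n1 + kap * (2 * A * A2).
Hypothesis hA1 : A1 = G * n1 + kap * (2 * G * (A2 + C1 - 2 * A1) + 2 * A * A1 + (E - 2 * G) * C1).
Hypothesis hA0 : A0 = I3 * n1 + kap * (I3 * (2 * (A2 + C1 - 2 * A1)) + 4 * G * (2 * A1 + C0 - A0)
  + 2 * A * A0 + (I5 - I3) * (2 * C1) + (E - 2 * G) * (2 * C0)).
Hypothesis hC1 : C1 = E * n1 + kap * (2 * G * (B1 - 2 * C1) + 2 * A * C1 + (E - 2 * G) * B1).
Hypothesis hC0 : C0 = I5 * n1 + kap * (I3 * (B1 - 2 * C1) + 4 * G * (C1 + B0 - C0) + 2 * A * C0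
  + (I5 - I3) * B1 + (E - 2 * G) * (2 * B0)).
Hypothesis hC1' : C1 = E * n1 + kap * (2 * E * (A2 + C1 - 2 * A1) + (DD - 2 * E) * C1).
Hypothesis hC0' : C0 = I5 * n1 + kap * (I5 * (2 * (A2 + C1 - 2 * A1)) + 2 * E * (2 * A1 + C0 - A0)
  + (K4 - I5) * (2 * C1) + (DD - 2 * E) * C0).
Hypothesis hB1 : B1 = DD * n1 + kap * (2 * E * (B1 - 2 * C1) + (DD - 2 * E) * B1).
Hypothesis hB0 : B0 = K4 * n1 + kap * (I5 * (B1 - 2 * C1) + 2 * E * (C1 + B0 - C0)
  + (K4 - I5) * B1 + (DD - 2 * E) * B0).

(** Each hypothesis is the coefficient of one indicator pattern in this identity. A pair with equal
    entries against one with distinct entries can occur on either side, hence two equations for [C1]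
    and two for [C0]: the unprimed ones belong to [i = j], [k != l], the primed ones to [i != j],
    [k = l]. *)
Lemma cov_fixpoint k l : (k < M)%N -> (l < M)%N ->
  e k l = n1 * Ker I3 G A I5 E K4 DD k l i j
    + kap * Gam M (fun u v => Ker I3 G A I5 E K4 DD k l u v * e u v).
Proof.
move=> kM lM; rewrite Gam_Ker//; last 2 first.
- by move=> u v; exact: Ker_symr.
- move=> u uM; rewrite /e /Ker [u == M]eq_sym [u == M.+1]eq_sym !ltF !(eqn_ltF uM).
  by [].
rewrite /KerT (_ : Ker I3 G A I5 E K4 DD k l i j = Ker I3 G A I5 E K4 DD i j k l); last exact: Ker_sym.
case: (eqVneq i j) => [ij|ij]; rewrite ?(Gam_covE ij) ?(diagex_covE ij) ?(Gam_covN ij) ?(diagex_covN ij).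
  case: (eqVneq k l) => [<-|kl] /=; rewrite !(rowex_covE ij)// /e /Ker ij !eqxx /= -ij.
    move: (k == i)%:R => x.
    by apply: (@eq_lincomb _ _ _ _ 1 hB0); apply: (@eq_lincomb _ _ _ _ x hB1); ring.
  rewrite (negbTE kl) /=; move: (k == i)%:R (l == i)%:R => x y.
  by apply: (@eq_lincomb _ _ _ _ 1 hC0); apply: (@eq_lincomb _ _ _ _ (x + y) hC1); ring.
case: (eqVneq k l) => [<-|kl] /=; rewrite !(rowex_covN ij)// /e /Ker ij !eqxx /=.
  have := eqn_excl k ij; move: (k == i)%:R (k == j)%:R => x y xy.
  (* The product of the incompatible indicators [k == i] and [k == j] is removed first; the rest is
     matched pattern by pattern. *)
  apply: (@eq_lincomb _ _ _ _ (2 * A2 * (1 - kap * (DD - 2 * E)) - 2 * A * n1) xy).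
  by apply: (@eq_lincomb _ _ _ _ 1 hC0'); apply: (@eq_lincomb _ _ _ _ (x + y) hC1'); ring.
rewrite (negbTE kl) /=; have := eqn_excl l ij; have := eqn_excl k ij.
move: (k == i)%:R (k == j)%:R (l == i)%:R (l == j)%:R => x y z t xy zt.
apply: (@eq_lincomb _ _ _ _ (- kap * (E - 2 * G) * 2 * A2) xy).
apply: (@eq_lincomb _ _ _ _ (- kap * (E - 2 * G) * 2 * A2) zt).
apply: (@eq_lincomb _ _ _ _ 1 hA0); apply: (@eq_lincomb _ _ _ _ (x + y + z + t) hA1).
by apply: (@eq_lincomb _ _ _ _ (x * t + y * z) hA2); ring.
Qed.
End CovarianceForm.
End KernelAlgebra.

(** * The closed-form variances solve the covariance system *)

Section PaperConstants.
Context {R : realType} (S : nat) (beta h D p q : R) (N : nat).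
Hypothesis N0 : (0 < N)%N.
Local Notation cM := (cM S beta h D p q).
Local Notation cM3 := (cM3 S beta h D p q).
Hypothesis M0 : cM != 0.
Hypothesis M30 : cM3 != 0.
Local Notation A2 := (A2sq S beta h D p q N).
Local Notation A1 := (A1sq S beta h D p q N).
Local Notation A0 := (A0sq S beta h D p q N).
Local Notation B1 := (B1sq S beta h D p q N).
Local Notation B0 := (B0sq S beta h D p q N).
Local Notation C1 := (C1sq S beta h D p q N).
Local Notation C0 := (C0sq S beta h D p q N).
Local Notation A := (cA S beta h D p q).
Local Notation DD := (cDD S beta h D p q).
Local Notation G := (cG S beta h D p q).
Local Notation E := (cE S beta h D p q).
Local Notation I3 := (cI3 S beta h D p q).
Local Notation I5 := (cI5 S beta h D p q).
Local Notation K4 := (cK4 S beta h D p q).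
Local Notation n1 := (N%:R^-1 : R).
Local Notation kap := (beta ^+ 2 / 2).

(** Consequently M_3 is [1 - beta ^+ 2 * A], the factor in the denominator of [A2sq], and M_1 is
    [1 - beta ^+ 2 * (A - 2 * G)]. *)
Lemma cF_AG : cF S beta h D p q = A + G.
Proof. by rewrite cF_E !cE_; ring. Qed.

Let Nn0 : N%:R != 0 :> R. Proof. by rewrite pnatr_eq0 -lt0n. Qed.

Let M3E : cM3 = 1 - beta ^+ 2 * A.
Proof. by rewrite /Defs.cM3 cF_AG; ring. Qed.

Let ME : cM = (1 - beta ^+ 2 * (A - 2 * G)) * (1 - beta ^+ 2 / 2 * DD) + beta ^+ 4 * E ^+ 2.
Proof. by rewrite /Defs.cM /cM1 /cM2 cF_AG; ring. Qed.

Let M20 : cM * 2 != 0. Proof. by rewrite mulf_neq0// pnatr_eq0. Qed.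

Ltac nz := repeat (apply/andP; split); try (first [exact: M0|exact: M30|exact: Nn0
  |(move: M30; rewrite M3E; congr (is_true (_ != 0)); ring)|(move: M0; rewrite ME; congr (is_true (_ != 0)); ring)
  |(move: M20; rewrite ME; congr (is_true (_ != 0)); field)]).

Let A2E : A2 = A * n1 / (1 - beta ^+ 2 * A).
Proof. by rewrite /A2sq /NR; field; nz. Qed.

Let A1E : A1 = (G * (1 - beta ^+ 2 / 2 * DD) + beta ^+ 2 / 2 * E ^+ 2) * n1 / (cM * cM3).
Proof. by rewrite /A1sq /cM2 /NR; field; nz. Qed.

Let B1E : B1 = (DD * (1 - beta ^+ 2 * (A - 2 * G)) - 2 * beta ^+ 2 * E ^+ 2) * n1 / cM.
Proof. by rewrite /B1sq /cM1 cF_AG /NR; field; nz. Qed.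

Let C1E : C1 = E * n1 / cM.
Proof. by rewrite /C1sq /NR; field; nz. Qed.

Lemma A2_eq : A2 = A * n1 + kap * (2 * A * A2).
Proof. by rewrite A2E; field; nz. Qed.

Lemma A1_eq : A1 = G * n1 + kap * (2 * G * (A2 + C1 - 2 * A1) + 2 * A * A1 + (E - 2 * G) * C1).
Proof. by rewrite A1E A2E C1E ME M3E; field; nz. Qed.

Lemma C1_eq : C1 = E * n1 + kap * (2 * G * (B1 - 2 * C1) + 2 * A * C1 + (E - 2 * G) * B1).
Proof. by rewrite B1E C1E ME; field; nz. Qed.

Lemma C1_eq' : C1 = E * n1 + kap * (2 * E * (A2 + C1 - 2 * A1) + (DD - 2 * E) * C1).
Proof. by rewrite A1E A2E C1E ME M3E; field; nz. Qed.

Lemma B1_eq : B1 = DD * n1 + kap * (2 * E * (B1 - 2 * C1) + (DD - 2 * E) * B1).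
Proof. by rewrite B1E C1E ME; field; nz. Qed.

Let C0M : cM * C0 = beta ^+ 2 / 2 * ((1 - beta ^+ 2 / 2 * DD) * I5 + beta ^+ 2 * E * K4) * B1
  + beta ^+ 2 * ((1 - beta ^+ 2 / 2 * DD) * (2 * G - I3) + beta ^+ 2 * E * (E - I5)) * C1
  + n1 * ((1 - beta ^+ 2 / 2 * DD) * I5 + beta ^+ 2 * E * K4).
Proof. by rewrite /C0sq /cM2 /NR; field; nz. Qed.

Let B0M : cM * B0 = beta ^+ 2 / 2 * ((1 - beta ^+ 2 * (A - 2 * G)) * K4 - beta ^+ 2 * E * I5) * B1
  + beta ^+ 2 * ((1 - beta ^+ 2 * (A - 2 * G)) * (E - I5) - beta ^+ 2 * E * (2 * G - I3)) * C1
  + n1 * ((1 - beta ^+ 2 * (A - 2 * G)) * K4 - beta ^+ 2 * E * I5).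
Proof. by rewrite /B0sq /cM1 cF_AG /NR; field; nz. Qed.

Let A0M : cM * A0 = beta ^+ 2 * (beta ^+ 2 * E * K4 + (1 - beta ^+ 2 / 2 * DD) * I5) * C1
  + 2 * beta ^+ 2 * (beta ^+ 2 * E * (E - I5) + (1 - beta ^+ 2 / 2 * DD) * (2 * G - I3)) * A1
  + beta ^+ 2 * (beta ^+ 2 * E * I5 + (1 - beta ^+ 2 / 2 * DD) * I3) * A2
  + n1 * (beta ^+ 2 * E * I5 + (1 - beta ^+ 2 / 2 * DD) * I3).
Proof. by rewrite /A0sq /cM2 /NR; field; nz. Qed.

(** The remaining equations form two systems of determinant M: [m2 B0 + beta^2 E C0 = rB] with
    [m1 C0 - beta^2 E B0 = rC], and [m1 A0 - beta^2 E C0 = rA] with [m2 C0 + beta^2 E A0 = rC']. The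
    closed forms are their solutions by Cramer's rule. *)
Let m1 := 1 - beta ^+ 2 * (A - 2 * G).
Let m2 := 1 - kap * DD.
Let rA := I3 * n1 + kap * (2 * I3 * A2 + (8 * G - 4 * I3) * A1 + 2 * I5 * C1).
Let rB := K4 * n1 + kap * (K4 * B1 + 2 * (E - I5) * C1).
Let rC := I5 * n1 + kap * (I5 * B1 + (4 * G - 2 * I3) * C1).
Let rC' := I5 * n1 + kap * (2 * I5 * A2 + 4 * (E - I5) * A1 + 2 * K4 * C1).

Lemma B0_eq : B0 = K4 * n1 + kap * (I5 * (B1 - 2 * C1) + 2 * E * (C1 + B0 - C0)
  + (K4 - I5) * B1 + (DD - 2 * E) * B0).
Proof.
(* The coefficients are those of the equation [m2 B0 + beta^2 E C0 = rB], multiplied by M. *)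
apply: (mulfI M0); apply: (@eq_lincomb _ _ _ _ _ m2 B0M).
apply: (@eq_lincomb _ _ _ _ _ (beta ^+ 2 * E) C0M); apply: (@eq_lincomb _ _ _ _ _ (- rB) ME).
by rewrite /m2 /rB; field.
Qed.

Lemma C0_eq : C0 = I5 * n1 + kap * (I3 * (B1 - 2 * C1) + 4 * G * (C1 + B0 - C0) + 2 * A * C0
  + (I5 - I3) * B1 + (E - 2 * G) * (2 * B0)).
Proof.
apply: (mulfI M0); apply: (@eq_lincomb _ _ _ _ _ m1 C0M).
apply: (@eq_lincomb _ _ _ _ _ (- (beta ^+ 2 * E)) B0M); apply: (@eq_lincomb _ _ _ _ _ (- rC) ME).
by rewrite /m1 /rC; field.
Qed.

(* The paper's C_0^2 solves two different equations; this second closed form is what makes the system for (A_0^2, C_0^2) consistent. *)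
Let C0M' : cM * C0 = m1 * rC' - beta ^+ 2 * E * rA.
Proof.
by rewrite C0M /m1 /rC' /rA A1E A2E B1E C1E ME M3E; field; nz.
Qed.

Lemma A0_eq : A0 = I3 * n1 + kap * (I3 * (2 * (A2 + C1 - 2 * A1)) + 4 * G * (2 * A1 + C0 - A0)
  + 2 * A * A0 + (I5 - I3) * (2 * C1) + (E - 2 * G) * (2 * C0)).
Proof.
apply: (mulfI M0); apply: (@eq_lincomb _ _ _ _ _ m1 A0M).
apply: (@eq_lincomb _ _ _ _ _ (- (beta ^+ 2 * E)) C0M'); apply: (@eq_lincomb _ _ _ _ _ (- rA) ME).
by rewrite /m1 /rA /rC'; field.
Qed.

Lemma C0_eq' : C0 = I5 * n1 + kap * (I5 * (2 * (A2 + C1 - 2 * A1)) + 2 * E * (2 * A1 + C0 - A0)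
  + (K4 - I5) * (2 * C1) + (DD - 2 * E) * C0).
Proof.
apply: (mulfI M0); apply: (@eq_lincomb _ _ _ _ _ m2 C0M').
apply: (@eq_lincomb _ _ _ _ _ (beta ^+ 2 * E) A0M); apply: (@eq_lincomb _ _ _ _ _ (- rC') ME).
by rewrite /m1 /m2 /rC' /rA; field.
Qed.
End PaperConstants.

(** * Uniqueness for the limiting linear system *)

Section Uniqueness.
Context {R : realType} (S : nat) (beta h D p q : R).
Local Notation A := (cA S beta h D p q).
Local Notation DD := (cDD S beta h D p q).
Local Notation G := (cG S beta h D p q).
Local Notation E := (cE S beta h D p q).
Local Notation I3 := (cI3 S beta h D p q).
Local Notation I5 := (cI5 S beta h D p q).
Local Notation K4 := (cK4 S beta h D p q).
Local Notation kap := (beta ^+ 2 / 2).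
Local Notation m1 := (1 - beta ^+ 2 * (A - 2 * G)).
Local Notation m2 := (1 - kap * DD).
Hypothesis M0 : cM S beta h D p q != 0.
Hypothesis M30 : cM3 S beta h D p q != 0.

Let M3E : cM3 S beta h D p q = 1 - beta ^+ 2 * A.
Proof. by rewrite /Defs.cM3 cF_AG; ring. Qed.

Let ME : cM S beta h D p q = m1 * m2 + beta ^+ 4 * E ^+ 2.
Proof. by rewrite /Defs.cM /cM1 /cM2 cF_AG; ring. Qed.

Lemma bO_unZ o (c : R) (u : nat -> R) : c != 0 -> bO o (fun N _ => c * u N) -> bO o (fun N _ => u N).
Proof.
move=> c0 H; apply: bO_ext (bO_Z c^-1 H) => N _.
by rewrite mulKf.
Qed.

(* Applied with determinant M both for the differences and for the values at new replicas. *)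
Lemma bO_solve2 o (a b c d : R) (x y : nat -> R) : a * d - b * c != 0 ->
  bO o (fun N _ => a * x N + b * y N) -> bO o (fun N _ => c * x N + d * y N) ->
  bO o (fun N _ => x N) /\ bO o (fun N _ => y N).
Proof.
move=> det h1 h2; split; apply: (bO_unZ det).
  by apply: bO_ext (bO_B (bO_Z d h1) (bO_Z b h2)) => N _; ring.
by apply: bO_ext (bO_B (bO_Z a h2) (bO_Z c h1)) => N _; ring.
Qed.

Section Fixed.
(** Replicas below [n] are the old ones, [n] and [n.+1] are fresh replicas for which the equations
    [er] are also available, and [M], [M.+1] are those created by [Gam]. Two fresh replicas give an
    equation both for a fresh diagonal pair and for a pair of distinct fresh replicas. *)
Variables (n o : nat) (e : nat -> nat -> nat -> R).
Local Notation M := n.+2.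
Local Notation ker N := (KerT I3 G A I5 E K4 DD M (fun u v => e u v N)).
Local Notation small f := (bO o (fun N _ => f N)).
Hypothesis es : forall N k l, e k l N = e l k N.
Hypothesis ef : forall N a b k l, (n <= a)%N -> (n <= b)%N -> (a < M.+2)%N -> (b < M.+2)%N ->
  e (sw a b k) (sw a b l) N = e k l N.
Hypothesis er : forall k l, (k < M)%N -> (l < M)%N -> small (fun N => e k l N - kap * ker N k l).

Let swn a b k : (k < n)%N -> (n <= a)%N -> (n <= b)%N -> sw a b k = k.
Proof. by move=> kn na nb; rewrite /sw !ltn_eqF// (leq_trans kn). Qed.

Let P N := e M M N.
Let Q N := e M M.+1 N.
Let nM : (n <= M)%N. Proof. by rewrite leqW// leqW. Qed.
Let nM2 : (n < M.+2)%N. Proof. by rewrite !ltnS !leqW. Qed.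
Let n1M2 : (n.+1 < M.+2)%N. Proof. by rewrite !ltnS !leqW. Qed.
Let nn1 : (n <= n.+1)%N. Proof. exact: leqnSn. Qed.
Let MM2 : (M < M.+2)%N. Proof. exact: leqW. Qed.

Let eM N k v : (k < n)%N -> (n <= v)%N -> (v < M.+2)%N -> e k v N = e k M N.
Proof.
move=> kn nv vM; rewrite -(ef N k M nv nM)//.
by rewrite (swn kn nv nM) /sw eqxx; case: eqP => // ->.
Qed.

Let eMl N k v : (k < n)%N -> (n <= v)%N -> (v < M.+2)%N -> e v k N = e k M N.
Proof. by move=> *; rewrite es eM. Qed.

Let eP N v : (n <= v)%N -> (v < M.+2)%N -> e v v N = P N.
Proof.
move=> nv vM; rewrite -(ef N v v nv nM)//.
by rewrite /sw eqxx.
Qed.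

(** Two transpositions of fresh replicas carry [(u, v)] to [(M.+1, M)], hence to [Q] by symmetry. *)
Let eQ N u v : (n <= u)%N -> (u < M.+2)%N -> (n <= v)%N -> (v < M.+2)%N -> u != v -> e u v N = Q N.
Proof.
move=> nu uM nv vM uv.
rewrite -(ef N u v nu nM uM (leqW (leqnn M.+1))) {1}/sw eqxx.
have : sw u M v != M.
  rewrite /sw (eq_sym v u) (negbTE uv); case: (eqVneq v M) uv => [->//|//].
have : (n <= sw u M v < M.+2)%N.
  by rewrite /sw; case: ifP => _; [rewrite nM ltnS leqW|case: ifP => _; rewrite ?nu ?nv].
move: (sw u M v) => w /andP[nw wM] wnM.
rewrite -(ef N M w (leqW nM) nw (ltnSn _) wM).
have -> : sw M.+1 w M = M by rewrite /sw ltn_eqF// eq_sym (negbTE wnM).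
by rewrite /sw eqxx; case: eqP => // ->.
Qed.

(** Differences against values in which replicas are replaced by fresh ones. The global sums cancel
    in them, so the system is triangular: first [ww], then [zz] and [dd] together, finally [P] and
    [Q]. *)
Let ww k l N := e k l N - e k M N - (e l M N - Q N).
Let zz l N := e l M N - Q N.
Let dd l N := e l l N - P N.
Let rho k N := rowex M (fun u v => e u v N) k.

Let rho_old N k : (k < n)%N -> rho k N = \sum_(v < n) (e k v N - e k M N).
Proof.
move=> kn; rewrite /rho /rowex !big_ord_recr /= (@eM N k n)// (@eM N k n.+1)//.
by rewrite !subrr !addr0.
Qed.

Let rho_n N : rho n N = \sum_(v < n) zz v N + P N - Q N.
Proof.
rewrite /rho /rowex !big_ord_recr /= eP//.
rewrite (@eQ N n M)//; last by rewrite ltn_eqF.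
rewrite (@eQ N n n.+1)//; last by rewrite ltn_eqF.
rewrite subrr addr0 addrA; congr (_ + _ - _); apply: eq_bigr => v _.
by rewrite /zz (@eMl N v n).
Qed.

Let rho_n1 N : rho n.+1 N = rho n N.
Proof.
rewrite rho_n /rho /rowex !big_ord_recr /= eP//.
rewrite (@eQ N n.+1 M)//; last by rewrite ltn_eqF.
rewrite (@eQ N n.+1 n)//; last by rewrite gtn_eqF.
rewrite subrr addr0 addrA; congr (_ + _ - _); apply: eq_bigr => v _.
by rewrite /zz (@eMl N v n.+1).
Qed.

Let diagexE N : diagex M (fun u v => e u v N) = \sum_(u < n) dd u N.
Proof. by rewrite /diagex !big_ord_recr /= !eP// !subrr !addr0. Qed.

(** The rows of the fresh replicas [n] and [n.+1] vanish, and the old rows reduce to second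
    differences. *)
Let GamE N : Gam M (fun u v => e u v N) =
  \sum_(u < n) (\sum_(v < n) (e u v N - e u M N - e v M N + Q N) + Q N - P N).
Proof.
have key u : (n <= u)%N -> (u < M)%N ->
    \sum_(l < M.+1) (e u l N - e u M.+1 N - e M l N + e M M.+1 N) = 0.
  move=> nu uM; have uM2 : (u < M.+2)%N by rewrite ltnS ltnW// ltnS ltnW.
  rewrite !big_ord_recr /= big1 => [|v _]; last first.
    by rewrite (@eMl N v u)// (@eMl N v M)// (@eQ N u M.+1)// ?ltn_eqF// 1?ltnW// -/(Q N); ring.
  rewrite (@eQ N u M.+1)// ?ltn_eqF// 1?ltnW// (@eQ N u M)// ?ltn_eqF//.
  rewrite -/(Q N) -/(P N) (@eQ N M n)// ?gtn_eqF// ?ltnS// (@eQ N M n.+1)// ?gtn_eqF//.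
  have : (u == n) || (u == n.+1).
    move: nu uM; rewrite leq_eqVlt eq_sym => /orP[->//|nu]; rewrite ltnS => un1.
    by rewrite [u == n.+1]eqn_leq nu un1 orbT.
  case/orP => /eqP ->; rewrite !eP//.
    by rewrite (@eQ N n n.+1)// ?ltn_eqF//; ring.
  by rewrite (@eQ N n.+1 n)// ?gtn_eqF//; ring.
rewrite /Gam [in LHS]big_ord_recr /= key// addr0 big_ord_recr /= key// addr0.
apply: eq_bigr => u _; rewrite !big_ord_recr /= -/(P N) -/(Q N).
rewrite (@eQ N M n)// ?gtn_eqF// ?ltnS// (@eQ N M n.+1)// ?gtn_eqF//.
rewrite (@eM N u n)// (@eM N u n.+1)// (@eM N u M.+1)// 1?ltnW//.
rewrite (eq_bigr (fun v : 'I_n => e u v N - e u M N - e v M N + Q N)); last first.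
  by move=> v _; rewrite (@eMl N v M)// (@eM N u M.+1)// ltnW.
ring.
Qed.

Let s0 N := Gam M (fun u v => e u v N).
Let s1 N := diagex M (fun u v => e u v N).

Let erN k l : (k < M)%N -> (l < M)%N -> k != l -> small (fun N => e k l N - kap * (I3 * s0 N
  + 2 * G * (rho k N + rho l N) + 2 * A * e k l N + (I5 - I3) * s1 N + (E - 2 * G) * (e k k N + e l l N))).
Proof. by move=> kM lM kl; apply: bO_ext (er kM lM) => N _; rewrite /KerT kl. Qed.

Let erD k : (k < M)%N -> small (fun N => e k k N - kap * (I5 * s0 N
  + 2 * E * rho k N + (K4 - I5) * s1 N + (DD - 2 * E) * e k k N)).
Proof. by move=> kM; apply: bO_ext (er kM kM) => N _; rewrite /KerT eqxx. Qed.

Let nM0 : (n < M)%N. Proof. exact: leqW. Qed.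
Let lM0 l : (l < n)%N -> (l < M)%N. Proof. by move=> ln; rewrite ltnS leqW// ltnW. Qed.
Let rr l N := rho l N - rho n N.

(** The equations at [(k, l)] and [(k, n)] are subtracted; both global sums and the row sum of [k]
    cancel. *)
Let off_fresh k l : (k < n)%N -> (l < n)%N -> k != l ->
  small (fun N => (1 - beta ^+ 2 * A) * (e k l N - e k M N)
    - kap * (2 * G * rr l N + (E - 2 * G) * dd l N)).
Proof.
move=> kn ln kl; have h1 := erN (lM0 kn) (lM0 ln) kl.
have h2 := erN (lM0 kn) nM0 (negbT (ltn_eqF kn)).
apply: bO_ext (bO_B h1 h2) => N _.
by rewrite (@eM N k n)// (@eP N n)// /rr /dd; field.
Qed.

Let fresh_row l : (l < n)%N ->
  small (fun N => (1 - beta ^+ 2 * A) * zz l N - kap * (2 * G * rr l N + (E - 2 * G) * dd l N)).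
Proof.
move=> ln; have h1 := erN (lM0 ln) nM0 (negbT (ltn_eqF ln)).
have h2 := erN nM0 (ltnSn n.+1) (negbT (ltn_eqF (ltnSn n))).
apply: bO_ext (bO_B h1 h2) => N _.
by rewrite rho_n1 (@eM N l n)// (@eQ N n n.+1)// ?ltn_eqF// (@eP N n)// (@eP N n.+1)// /zz /rr /dd; field.
Qed.

(** The right-hand sides of [off_fresh] and [fresh_row] depend on [l] only and cancel, leaving the
    factor M_3. *)
Let small_w k l : (k < n)%N -> (l < n)%N -> k != l -> small (ww k l).
Proof.
move=> kn ln kl; apply: (@bO_unZ _ (1 - beta ^+ 2 * A)); first by rewrite -M3E.
by apply: bO_ext (bO_B (off_fresh kn ln kl) (fresh_row ln)) => N _; rewrite /ww /zz; ring.
Qed.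

Let small_d0 l : (l < n)%N -> small (fun N => (1 - kap * (DD - 2 * E)) * dd l N - beta ^+ 2 * E * rr l N).
Proof.
move=> ln; apply: bO_ext (bO_B (erD (lM0 ln)) (erD nM0)) => N _.
by rewrite (@eP N n)// /dd /rr; field.
Qed.

Let sum_small (F : nat -> nat -> R) : (forall v, (v < n)%N -> small (F v)) ->
  small (fun N => \sum_(v < n) F v N).
Proof. by move=> H; apply: bO_sum => v; exact: H. Qed.

Let small_wsum l : (l < n)%N -> small (fun N => \sum_(v < n) ww l v N - ww l l N).
Proof.
move=> ln; have H : small (fun N => \sum_(v < n) (if (v : nat) == l then 0 else ww l v N)).
  apply: (@sum_small (fun v N => if v == l then 0 else ww l v N)) => v vn.
  by case: (eqVneq v l) => [_|vl]; [exact: bO_0|apply: small_w; rewrite // eq_sym].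
apply: bO_ext H => N _; rewrite (bigD1 (Ordinal ln))//= [in RHS](bigD1 (Ordinal ln))//= eqxx add0r addrAC subrr add0r.
by apply: eq_bigr => v; rewrite -(inj_eq val_inj) /= => /negbTE ->.
Qed.

(** As [ww] is negligible off the diagonal, the row sum collapses to its diagonal term. This removes
    the number of replicas from the system. *)
Let small_r0 l : (l < n)%N -> small (fun N => rr l N - dd l N + 2 * zz l N).
Proof.
move=> ln; apply: bO_ext (small_wsum ln) => N _; rewrite /rr rho_old// rho_n.
rewrite (eq_bigr (fun v : 'I_n => (e l v N - e l M N) - zz v N)); last by move=> v _; rewrite /ww /zz.
by rewrite sumrB /dd /zz /ww; ring.
Qed.

(** Inserting [small_r0] closes the equations for [zz l] and [dd l], with determinant M. *)
Let small_zd l : (l < n)%N -> small (zz l) /\ small (dd l).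
Proof.
move=> ln; apply: (@bO_solve2 o m1 (- (kap * E)) (4 * kap * E) m2).
- by move: M0; rewrite ME; congr (is_true (_ != 0)); field.
- apply: bO_ext (bO_D (fresh_row ln) (bO_Z (kap * (2 * G)) (small_r0 ln))) => N _.
  by field.
- apply: bO_ext (bO_D (small_d0 ln) (bO_Z (beta ^+ 2 * E) (small_r0 ln))) => N _.
  by field.
Qed.

Let small_rho : small (fun N => rho n N - (P N - Q N)).
Proof.
apply: bO_ext (sum_small (fun v vn => (small_zd vn).1)) => N _.
by rewrite rho_n; ring.
Qed.

Let small_s1 : small s1.
Proof. by apply: bO_ext (sum_small (fun v vn => (small_zd vn).2)) => N _; rewrite /s1 diagexE. Qed.

Let small_s0 : small s0.
Proof.
have H u : (u < n)%N -> small (fun N => \sum_(v < n) (e u v N - e u M N - e v M N + Q N) + Q N - P N).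
  move=> un; case: (small_zd un) => sz sd.
  apply: bO_ext (bO_D (small_wsum un) (bO_D (bO_Z (-2) sz) sd)) => N _.
  rewrite (eq_bigr (fun v : 'I_n => e u v N - e u M N - e v M N + Q N)); last first.
    by move=> v _; rewrite /ww; ring.
  by rewrite /ww /zz /dd; ring.
by apply: bO_ext (sum_small H) => N _; rewrite /s0 GamE.
Qed.

(** With all differences and global sums negligible, the equations at [(n, n.+1)] and [(n, n)] close
    on [Q] and [P], again with determinant M. *)
Let small_PQ : small Q /\ small P.
Proof.
apply: (@bO_solve2 o m1 (- (beta ^+ 2 * E)) (beta ^+ 2 * E) m2).
- move: M0; rewrite ME; congr (is_true (_ != 0)); ring.
- have hh := erN nM0 (ltnSn n.+1) (negbT (ltn_eqF (ltnSn n))).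
  apply: bO_ext (bO_D (bO_D hh (bO_Z (4 * kap * G) small_rho)) (bO_D (bO_Z (kap * I3) small_s0) (bO_Z (kap * (I5 - I3)) small_s1))) => N _.
  by rewrite rho_n1 (@eQ N n n.+1)// ?ltn_eqF// (@eP N n)// (@eP N n.+1)//; field.
- have hh := erD nM0.
  apply: bO_ext (bO_D (bO_D hh (bO_Z (beta ^+ 2 * E) small_rho)) (bO_D (bO_Z (kap * I5) small_s0) (bO_Z (kap * (K4 - I5)) small_s1))) => N _.
  by rewrite (@eP N n)//; field.
Qed.

Lemma small_solution k l : (k < n)%N -> (l < n)%N -> small (e k l).
Proof.
move=> kn ln; case: small_PQ => sQ sP; case: (eqVneq k l) => [<-|kl].
  by apply: bO_ext (bO_D (small_zd kn).2 sP) => N _; rewrite /dd; ring.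
apply: bO_ext (bO_D (bO_D (small_w kn ln kl) (bO_D (small_zd ln).1 (small_zd kn).1)) sQ) => N _.
by rewrite /ww /zz; ring.
Qed.
End Fixed.
End Uniqueness.

(** * Comparison with the Wick recursion *)

Section Wick.
Context {R : realType} {T : eqType} (K : T -> T -> R).
Implicit Types (s u : seq T).

(* [n] is fuel bounding the number of factors. *)
Fixpoint wickn n s : R :=
  match n, s with
  | _, [::] => 1
  | 0, _ :: _ => 0
  | n'.+1, a :: s' => pick_sum (fun b u => K a b * wickn n' u) s'
  end.

Definition wick s : R := wickn (size s) s.

Lemma wickn_size n m s : (size s <= n)%N -> (size s <= m)%N -> wickn n s = wickn m s.
Proof.
elim: n m s => [|n IH] [|m] [|a s] //= sn sm.
apply: pick_sum_ext => b u /perm_size /= su; congr (_ * _).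
by apply: IH; rewrite ltnW// su.
Qed.

Lemma wick_cons a s : wick (a :: s) = pick_sum (fun b u => K a b * wick u) s.
Proof.
apply: pick_sum_ext => b u /perm_size /= su; congr (_ * _).
by apply: wickn_size => //; rewrite -[leqRHS]/(size s) -su.
Qed.
End Wick.

Lemma pick_sum_Gam {R : realType} {T : eqType} M (y : T -> seq T -> nat -> nat -> R) s :
  pick_sum (fun b u => Gam M (y b u)) s = Gam M (fun k l => pick_sum (fun b u => y b u k l) s).
Proof.
elim: s y => [|c s IH] y /=; first by rewrite Gam_cst.
by rewrite GamD; congr (_ + _); apply: (IH (fun b u => y b (c :: u))).
Qed.

(** * Overlap moments and Gaussian moments agree to leading order *)

Section Moments.
Context {R : realType} (S : nat) (h D beta p q : R).
Hypothesis S1 : (1 <= S)%N.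
Hypothesis fp : fixed_point S beta h D p q.
Hypothesis b0 : 0 < beta.
Hypothesis b1 : beta <= 1.
Hypothesis bht : beta ^+ 2 * htC S <= 1 / 2.
Hypothesis M0 : cM S beta h D p q != 0.
Hypothesis M30 : cM3 S beta h D p q != 0.
Local Notation ck := (ck S h D beta p q).
Local Notation mu := (mu S h D beta p q).
Local Notation kap := (beta ^+ 2 / 2).
Implicit Types (s u : seq (nat * nat)) (a b : nat * nat).

Definition covk N a b : R :=
  Ker (A0sq S beta h D p q N) (A1sq S beta h D p q N) (A2sq S beta h D p q N)
    (C0sq S beta h D p q N) (C1sq S beta h D p q N) (B0sq S beta h D p q N)
    (B1sq S beta h D p q N) a.1 a.2 b.1 b.2.

Definition gam N s : R := wick (covk N) s.

Lemma covk_fixpoint N M a b : (0 < N)%N -> (a.1 < M)%N -> (a.2 < M)%N -> (b.1 < M)%N -> (b.2 < M)%N ->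
  covk N a b = N%:R^-1 * ck a b + kap * Gam M (fun k l => ck a (k, l) * covk N (k, l) b).
Proof.
move=> N0 a1 a2 b1M b2M.
have := @cov_fixpoint _ _ _ _ _ _ _ _ M b.1 b.2 b1M b2M _ _ _ _ _ _ _ _ _
  (A2_eq N0 M30) (A1_eq N0 M0 M30) (A0_eq N0 M0 M30) (C1_eq N0 M0) (C0_eq N0 M0)
  (C1_eq' N0 M0 M30) (C0_eq' N0 M0 M30) (B1_eq N0 M0) (B0_eq N0 M0) a.1 a.2 a1 a2.
rewrite /= -(Ker_sym _ _ _ _ _ _ _ a.1) => H.
rewrite /covk [LHS]H; congr (_ + _ * _); apply: Gam_ext => k l _ _.
by rewrite [X in _ * X = _]Ker_sym.
Qed.

(** The covariance that pairs [a] with [b] is expanded by [covk_fixpoint]. In the [Gam] part,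
    summing over [b] rebuilds a Wick sum with first factor [(k, l)]. *)
Lemma gam_recursion N M a s : (0 < N)%N -> (a.1 < M)%N -> (a.2 < M)%N -> below M s ->
  gam N (a :: s) = N%:R^-1 * pick_sum (fun b u => ck a b * gam N u) s
     + kap * Gam M (fun k l => ck a (k, l) * gam N ((k, l) :: s)).
Proof.
move=> N0 a1 a2 sM; rewrite /gam wick_cons.
set kp := kap; transitivity (pick_sum (fun b u => N%:R^-1 * (ck a b * gam N u)
    + kp * Gam M (fun k l => ck a (k, l) * (covk N (k, l) b * gam N u))) s).
  apply: pick_sum_ext => b u bu.
  have /= /andP[/andP[b1M b2M] _] : below M (b :: u) by rewrite (below_perm M bu).
  rewrite (covk_fixpoint N0 a1 a2 b1M b2M) -/kp -/(gam N u) mulrDl -(mulrA N%:R^-1) -(mulrA kp).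
  congr (_ + _ * _); rewrite mulrC -GamZ; apply: Gam_ext => k l _ _; by ring.
rewrite pick_sumD !pick_sumZ pick_sum_Gam; congr (_ + _ * _).
by apply: Gam_ext => k l _ _; rewrite pick_sumZ wick_cons.
Qed.

Lemma mu_below N M M' s : (0 < N)%N -> below M s -> (M <= M')%N -> mu N M' s = mu N M s.
Proof. by move=> N0 sM MM; apply: nuf_supp => //; exact: supp_Xs. Qed.

Lemma xx_sym N (r : nat -> config S N) k l : xx p q r k l = xx p q r l k.
Proof.
rewrite /xx /ovr /Qn eq_sym; congr (_ * _ - _).
by apply: eq_bigr => j _; rewrite mulrC.
Qed.

Lemma mu_sym N M k l s : mu N M ((k, l) :: s) = mu N M ((l, k) :: s).
Proof.
by apply: nuf_ext => r; rewrite !Xs_cons /= xx_sym.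
Qed.

Lemma gam_sym N k l s : gam N ((k, l) :: s) = gam N ((l, k) :: s).
Proof.
rewrite /gam !wick_cons; apply: pick_sum_ext => b u _; congr (_ * _).
by rewrite /covk Ker_sym Ker_symr Ker_sym.
Qed.

Lemma sw_below n (a b k : nat) : (k < n)%N -> (n <= a)%N -> (n <= b)%N -> sw a b k = k.
Proof. by move=> kn na nb; rewrite /sw !ltn_eqF// (leq_trans kn). Qed.

Lemma swK (a b : nat) : involutive (sw a b).
Proof.
move=> k; rewrite /sw; case: (eqVneq k a) => [->|ka].
  by rewrite eqxx; case: eqP.
by case: (eqVneq k b) => [->|kb]; rewrite ?eqxx// (negbTE ka) (negbTE kb).
Qed.

Lemma sw_inj (a b k l : nat) : (sw a b k == sw a b l) = (k == l).
Proof. exact: (inj_eq (inv_inj (@swK a b))). Qed.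

Lemma mu_swap N M n (a b : nat) k l s : (0 < N)%N -> below n s -> (n <= a)%N -> (n <= b)%N ->
  (a < M)%N -> (b < M)%N -> mu N M ((sw a b k, sw a b l) :: s) = mu N M ((k, l) :: s).
Proof.
move=> N0 sn na nb aM bM; rewrite /mu -[RHS](nuf_swap beta h D N0 _ aM bM).
apply: nuf_ext => r; rewrite !Xs_cons /=; congr (_ * _).
  by rewrite /xx /ovr /Qn sw_inj.
apply: (supp_Xs p q sn) => j jn.
by rewrite /= (sw_below jn).
Qed.

Lemma gam_swap N n (a b : nat) k l s : below n s -> (n <= a)%N -> (n <= b)%N ->
  gam N ((sw a b k, sw a b l) :: s) = gam N ((k, l) :: s).
Proof.
move=> sn na nb; rewrite /gam !wick_cons; apply: pick_sum_ext => c u cu; congr (_ * _).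
have /= /andP[/andP[c1 c2] _] : below n (c :: u) by rewrite (below_perm n cu).
have E x z : (x < n)%N -> (x == sw a b z) = (x == z).
  by move=> xn; rewrite -[x in LHS](sw_below xn na nb) sw_inj.
by rewrite /covk /Ker /= sw_inj !E.
Qed.

(** Induction on the number of factors. The first factor is left free, and the difference of the two
    recursions is the homogeneous system solved by [small_solution]. *)
Lemma moments_close M s : below M s -> bO (size s).+1 (fun N _ => mu N M s - gam N s).
Proof.
move: {2}(size s) (leqnn (size s)) => m; elim: m M s => [|m IH] M [|a s] // sm sM.
1,2: apply: bO_ext (bO_0 1) => N i; rewrite /gam /wick /= /mu.
1,2: rewrite (_ : (fun r => _) = fun=> 1) ?(nuf_cst S beta h D (ordN0 i)) ?subrr//.
1,2: by apply/funext => r; rewrite /Xs big_nil.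
rewrite ltnS -/(size s) in sm; rewrite [size _]/=.
move: sM => /andP[/andP[a1 a2] sM].
(* The value 0 at [N = 0] makes the symmetries hold for every [N]. [M.+4] replicas hold the old
   ones, two fresh ones and the two created by [Gam]. *)
pose e k l N := if N is 0 then 0 else mu N M.+4 ((k, l) :: s) - gam N ((k, l) :: s).
have eE k l N (i : 'I_N) : e k l N = mu N M.+4 ((k, l) :: s) - gam N ((k, l) :: s).
  by have := ordN0 i; case: N {i}.
have es N k l : e k l N = e l k N by rewrite /e mu_sym gam_sym.
have ef N (a' b : nat) k l : (M <= a')%N -> (M <= b)%N -> (a' < M.+4)%N -> (b < M.+4)%N ->
    e (sw a' b k) (sw a' b l) N = e k l N.
  move=> *; case: N => // N; rewrite /e (@mu_swap _ _ M)// (@gam_swap _ M)//.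
have sM2 : below M.+2 s by apply: below_le sM; rewrite leqW// leqW.
suff H k l : (k < M.+2)%N -> (l < M.+2)%N -> bO (size s).+2 (fun N _ => e k l N - kap *
    KerT (cI3 S beta h D p q) (cG S beta h D p q) (cA S beta h D p q) (cI5 S beta h D p q)
      (cE S beta h D p q) (cK4 S beta h D p q) (cDD S beta h D p q) M.+2 (fun u v : nat => e u v N) k l).
  have := small_solution M0 M30 es ef H a1 a2.
  apply: bO_ext => N i; rewrite (eE _ _ _ i) -surjective_pairing; congr (_ - _).
  by apply: mu_below; rewrite ?(ordN0 i)// ?leqW//= a1 a2.
move=> kM lM.
have h1 : bO (size s).+2 (fun N _ => mu N M.+2 ((k, l) :: s)
   - (N%:R^-1 * pick_sum (fun b u => ck (k, l) b * mu N M.+2 u) s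
     + kap * Gam M.+2 (fun k' l' => ck (k, l) (k', l') * mu N M.+4 ((k', l') :: s)))).
  have [C C0 HC] := cavity_recursion fp b0 b1 bht (a := (k, l)) kM lM sM2.
  by exists C => // N i; apply: HC; exact: ordN0 i.
(* The pairing terms have two factors fewer; the induction hypothesis and the inverse of [N] give
   order [(size s).+2]. *)
have h2 : bO (size s) (fun N (_ : 'I_N) => pick_sum (fun b u => ck (k, l) b * (mu N M.+2 u - gam N u)) s).
  apply: (@bO_pick _ _ _ (fun b u N _ => ck (k, l) b * (mu N M.+2 u - gam N u))) => b u bu.
  apply: bO_Z; rewrite -(perm_size bu) /=; apply: IH; first by rewrite (leq_trans _ sm)// -(perm_size bu) ltnW// ltnS.
  by have /= /andP[_] : below M.+2 (b :: u) by rewrite (below_perm _ bu).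
apply: bO_ext (bO_D h1 (bO_divN h2)) => N i; have N0 := ordN0 i.
rewrite -(@Gam_Ker _ _ _ _ _ _ _ _ M.+2 (fun u v : nat => e u v N))//; last first.
  have l2 : (M <= M.+2)%N by lia.
  have l3 : (M <= M.+3)%N by lia.
  move=> u uM; rewrite -[RHS](ef N M.+2 M.+3 u M.+2 l2 l3)//.
  by rewrite /sw eqxx !ltn_eqF// ltnW.
rewrite (eE _ _ _ i) (gam_recursion (M := M.+2) (a := (k, l)) N0 kM lM sM2).
have -> : Gam M.+2 (fun u v : nat => Ker (cI3 S beta h D p q) (cG S beta h D p q) (cA S beta h D p q) (cI5 S beta h D p q)
      (cE S beta h D p q) (cK4 S beta h D p q) (cDD S beta h D p q) k l u v * e u v N) =
  Gam M.+2 (fun k' l' => ck (k, l) (k', l') * mu N M.+4 ((k', l') :: s))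
  - Gam M.+2 (fun k' l' => ck (k, l) (k', l') * gam N ((k', l') :: s)).
  by rewrite -GamB; apply: Gam_ext => w v _ _; rewrite (eE _ _ _ i) -mulrBr.
have -> : pick_sum (fun b u => ck (k, l) b * (mu N M.+2 u - gam N u)) s =
  pick_sum (fun b u => ck (k, l) b * mu N M.+2 u) s - pick_sum (fun b u => ck (k, l) b * gam N u) s.
  by rewrite -pick_sumB; apply: pick_sum_ext => b u _; rewrite mulrBr.
rewrite (@mu_below N M.+2 M.+4)//; [by ring|by rewrite /= kM lM|by lia].
Qed.
End Moments.

(** * Gaussian moments *)

Lemma pick_sum_sum {R : realType} {T : eqType} (I : finType) (F : I -> T -> seq T -> R) s :
  pick_sum (fun b u => \sum_i F i b u) s = \sum_i pick_sum (F i) s.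
Proof.
elim: s F => [|c s IH] F /=; first by rewrite big1.
by rewrite big_split /=; congr (_ + _); apply: (IH (fun i b u => F i b (c :: u))).
Qed.

Lemma pick_sum_map {R : realType} {T U : eqType} (f : T -> U) (F : U -> seq U -> R) s :
  pick_sum F (map f s) = pick_sum (fun b u => F (f b) (map f u)) s.
Proof.
elim: s F => [|c s IH] F //=; congr (_ + _).
exact: (IH (fun b u => F b (f c :: u))).
Qed.

Lemma wick_map {R : realType} {T U : eqType} (f : T -> U) (K : U -> U -> R) s :
  wick K (map f s) = wick (fun a b => K (f a) (f b)) s.
Proof.
move: {2}(size s) (leqnn (size s)) => m; elim: m s => [|m IH] [|a s] // sm.
rewrite /= !wick_cons pick_sum_map; apply: pick_sum_ext => b u bu; congr (_ * _).
by apply: IH; have := perm_size bu; move: sm => /=; lia.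
Qed.

Section GaussianMoments.
Context {R : realType} {T : eqType} (n : nat) (lf : T -> 'I_n -> R).
Implicit Types (s u : seq T) (v : 'I_n -> R).

Definition linf a v : R := \sum_i lf a i * v i.

Lemma plip_linf a : plip (linf a).
Proof. by apply: plip_sum => i; apply: plipZ; exact: plip_coord. Qed.

Lemma plip_prod_linf s : plip (fun v => \prod_(a <- s) linf a v).
Proof. by apply: plip_prod => a; exact: plip_linf. Qed.

Lemma plip_pick (F : T -> seq T -> ('I_n -> R) -> R) s : (forall b u, plip (F b u)) ->
  plip (fun v => pick_sum (fun b u => F b u v) s).
Proof.
elim: s F => [|c s IH] F H /=; first exact: plip_cst.
by apply: plipD => //; exact: (IH (fun b u => F b (c :: u))).
Qed.

Lemma gexp_pick (F : T -> seq T -> ('I_n -> R) -> R) s : (forall b u, plip (F b u)) ->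
  gexp (fun v => pick_sum (fun b u => F b u v) s) = pick_sum (fun b u => gexp (F b u)) s.
Proof.
elim: s F => [|c s IH] F H /=; first exact: gexp_cst.
rewrite gexpD//; first by congr (_ + _); apply: (IH (fun b u => F b (c :: u))).
by apply: (plip_pick (F := fun b u => F b (c :: u))).
Qed.

Lemma linf_shift a i t v : linf a (shiftv i t v) = linf a v + t * lf a i.
Proof.
rewrite /linf /shiftv (eq_bigr (fun j => lf a j * v j + (if j == i then t * lf a j else 0))).
  by rewrite big_split /= -big_mkcond /= big_pred1_eq.
by move=> j _; case: ifP => _; ring.
Qed.

Lemma pderiv_prod_linf i s :
  pderiv i (fun v => \prod_(a <- s) linf a v)
    (fun v => pick_sum (fun b u => lf b i * \prod_(a <- u) linf a v) s).
Proof.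
elim: s => [|c s [C [k [C0 H]]]] /=.
  by exists 0, 0%N; split=> // v t _; rewrite !big_nil mulr0 subr0 subrr normr0 !mul0r.
have [D1 [d1 [D10 H1]]] := plip_pgn (plip_linf c).
have [D2 [d2 [D20 H2]]] := plip_pgn (plip_pick s (fun b u => plipZ (lf b i) (plip_prod_linf u))).
exists (C * (D1 + `|lf c i|) + D2 * `|lf c i|), (k + d1 + d2)%N.
split; first by rewrite addr_ge0 ?mulr_ge0 ?addr_ge0.
move=> v t t1; rewrite !big_cons linf_shift.
have -> : pick_sum (fun b u => lf b i * \prod_(a <- c :: u) linf a v) s =
    linf c v * pick_sum (fun b u => lf b i * \prod_(a <- u) linf a v) s.
  by rewrite -pick_sumZ; apply: pick_sum_ext => b u _; rewrite big_cons mulrCA.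
move: (H v t t1) (H1 v) (H2 v); set F1 := \prod_(a <- s) linf a (shiftv _ _ _).
set F0 := \prod_(a <- s) linf a v; set F' := pick_sum _ s; set x := linf c v; set l := lf c i.
move=> h h1 h2.
have -> : (x + t * l) * F1 - x * F0 - t * (l * F0 + x * F') =
  (F1 - F0 - t * F') * (x + t * l) + t ^+ 2 * (F' * l) by ring.
have w1 : 1 <= wt v by exact: wt_ge1.
have wX m : 1 <= wt v ^+ m by exact: exprn_ege1.
have w0 m : 0 <= wt v ^+ m by rewrite (le_trans ler01).
have xl : `|x + t * l| <= (D1 + `|l|) * wt v ^+ d1.
  rewrite mulrDl (le_trans (ler_normD _ _))// lerD// normrM.
  by rewrite (le_trans (ler_piMl _ t1))// ler_peMr.
rewrite (le_trans (ler_normD _ _))// (normrM _ (x + _)) (normrM (t ^+ 2)) (normrM F') normrX real_normK ?num_real//.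
rewrite !mulrDl lerD//.
  apply: (@le_trans _ _ (C * t ^+ 2 * wt v ^+ k * ((D1 + `|l|) * wt v ^+ d1))); first by rewrite ler_pM.
  rewrite !exprD [leRHS](_ : _ = C * t ^+ 2 * wt v ^+ k * ((D1 + `|l|) * wt v ^+ d1) * wt v ^+ d2); last by ring.
  rewrite ler_peMr//; apply: mulr_ge0; last by apply: mulr_ge0 => //; exact: addr_ge0.
  by apply: mulr_ge0 => //; apply: mulr_ge0 => //; exact: sqr_ge0.
apply: (@le_trans _ _ (t ^+ 2 * (D2 * wt v ^+ d2 * `|l|))).
  by rewrite ler_wpM2l ?sqr_ge0// ler_wpM2r.
rewrite !exprD [leRHS](_ : _ = t ^+ 2 * (D2 * wt v ^+ d2 * `|l|) * (wt v ^+ k * wt v ^+ d1)); last by ring.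
have t0 : 0 <= t ^+ 2 by exact: sqr_ge0.
rewrite ler_peMr//; first by apply: mulr_ge0 => //; apply: mulr_ge0 => //; exact: mulr_ge0.
by rewrite (le_trans (wX k))// ler_peMr.
Qed.

(** Integrating the coordinates of the first form by parts contracts it with each other factor in
    turn, which is the recursion [wick_cons]. *)
Lemma gauss_wick s : gexp (fun v => \prod_(a <- s) linf a v) =
  wick (fun a b => \sum_i lf a i * lf b i) s.
Proof.
move: {2}(size s) (leqnn (size s)) => m; elim: m s => [|m IH] [|a s] // sm.
1,2: rewrite /wick /= -[RHS](gexp_cst (n := n)); congr gexp; by apply/funext => v; rewrite big_nil.
rewrite wick_cons (_ : (fun v => _) = fun v => \sum_i lf a i * (v i * \prod_(b <- s) linf b v)); last first.
  by apply/funext => v; rewrite big_cons /linf big_distrl; apply: eq_bigr => i _ /=; rewrite mulrA.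
rewrite gexp_sum; last first.
  by move=> i; apply/plipZ/plipM; [exact: plip_coord|exact: plip_prod_linf].
transitivity (\sum_i pick_sum (fun b u => lf a i * lf b i * wick (fun a b => \sum_i lf a i * lf b i) u) s).
  apply: eq_bigr => i _; rewrite gexpZ; last by apply: plipM; [exact: plip_coord|exact: plip_prod_linf].
  rewrite (gexp_ibp (plip_prod_linf s) _ (pderiv_prod_linf i s)); last first.
    by apply: (plip_pick s) => b u; apply: plipZ; exact: plip_prod_linf.
  rewrite gexp_pick; last by move=> b u; apply: plipZ; exact: plip_prod_linf.
  rewrite -pick_sumZ; apply: pick_sum_ext => b u bu.
  rewrite gexpZ ?mulrA; last exact: plip_prod_linf.
  by rewrite IH//; have := perm_size bu; move: sm => /=; lia.
rewrite -pick_sum_sum; apply: pick_sum_ext => b u _.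
by rewrite mulr_suml.
Qed.
End GaussianMoments.

(** * Small inverse temperature and conclusion *)

Section SmallBeta.
Context {R : realType} (S : nat) (beta h D p q : R).
Local Notation mom := (Defs.mom S beta h D p q).
Let K : R := S%:R ^+ 4.

Let K0 : 0 <= K. Proof. exact: exprn_ge0. Qed.

(** All constants have total degree four in the spin; shorter products are padded with [mom 0],
    which is 1. *)
Let b4 (j k l m : nat) x : (j + k + l + m)%N = 4%N -> `|mom j x * mom k x * mom l x * mom m x| <= K.
Proof.
move=> E; rewrite /K -E !exprD.
have := mom_bound S beta h D p q j x; have := mom_bound S beta h D p q k x.
have := mom_bound S beta h D p q l x; have := mom_bound S beta h D p q m x.
move: (mom j x) (mom k x) (mom l x) (mom m x) => a b c d *.
by rewrite !normrM !ler_pM ?mulr_ge0.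
Qed.

Ltac pl := repeat first [exact: plip1_mom | apply: plipX | apply: plipN | apply: plipM | apply: plipD | exact: plip_cst].

Lemma cA_bound : `|cA S beta h D p q| <= 4 * K.
Proof.
apply: gavg1_bound1; first by rewrite /plip1; pl.
move=> x; have := @b4 2 2 0 0 x erefl; have := @b4 2 1 1 0 x erefl; have := @b4 1 1 1 1 x erefl.
rewrite !mom0 !mulr1 !ler_norml => /andP[? ?] /andP[? ?] /andP[? ?]; apply/andP; split; nra.
Qed.

Lemma cG_bound : `|cG S beta h D p q| <= 2 * K.
Proof.
apply: gavg1_bound1; first by rewrite /plip1; pl.
move=> x; have := @b4 2 1 1 0 x erefl; have := @b4 1 1 1 1 x erefl.
rewrite !mom0 !mulr1 !ler_norml => /andP[? ?] /andP[? ?]; apply/andP; split; nra.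
Qed.

Lemma cDD_bound : `|cDD S beta h D p q| <= 2 * K.
Proof.
apply: gavg1_bound1; first by rewrite /plip1; pl.
move=> x; have := @b4 2 2 0 0 x erefl; have := @b4 4 0 0 0 x erefl.
rewrite !mom0 !mulr1 !ler_norml => /andP[? ?] /andP[? ?]; apply/andP; split; nra.
Qed.

Hypothesis b0 : 0 < beta.
Hypothesis bK : beta ^+ 2 * K <= 1 / 16.

Lemma cM3_neq0 : cM3 S beta h D p q != 0.
Proof.
rewrite gt_eqF// /cM3 cF_AG addrK.
have := ler_wpM2l (sqr_ge0 beta) cA_bound.
have := ler_wpM2l (sqr_ge0 beta) (ler_norm (cA S beta h D p q)).
move: bK; lra.
Qed.

(** The hypothesis [bK] gives M_1 at least [1 / 2] and M_2 at least [15 / 16], and the remaining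
    term of M is a square times [beta ^+ 4]. *)
Lemma cM_neq0 : cM S beta h D p q != 0.
Proof.
rewrite gt_eqF// /cM ltr_pwDl//; last first.
  by apply: mulr_ge0; [exact: exprn_ge0 (ltW b0)|exact: sqr_ge0].
have A1 := ler_wpM2l (sqr_ge0 beta) cA_bound.
have A2 := ler_wpM2l (sqr_ge0 beta) (ler_norm (cA S beta h D p q)).
have G1 := ler_wpM2l (sqr_ge0 beta) cG_bound.
have G2 := ler_wpM2l (sqr_ge0 beta) (ler_norm (- cG S beta h D p q)).
rewrite normrN in G2.
have D1 := ler_wpM2l (sqr_ge0 beta) cDD_bound.
have D2 := ler_wpM2l (sqr_ge0 beta) (ler_norm (cDD S beta h D p q)).
rewrite mulr_gt0// /cM1 /cM2 ?cF_AG; move: bK; lra.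
Qed.
End SmallBeta.

Section Assembly.
Context {R : realType}.

Definition rep {n} (a : pairsLe n) : nat * nat := ((val a).1 : nat, (val a).2 : nat).

Definition expand {I : finType} (mm : I -> nat) : seq I := flatten [seq nseq (mm a) a | a <- enum I].

Lemma size_expand (I : finType) (mm : I -> nat) : size (expand mm) = (\sum_a mm a)%N.
Proof.
rewrite size_flatten /shape -map_comp sumnE big_map big_enum /=.
by apply: eq_bigr => a _; rewrite size_nseq.
Qed.

Lemma prod_expand (I : finType) (mm : I -> nat) (F : I -> R) :
  \prod_(a <- expand mm) F a = \prod_a F a ^+ mm a.
Proof.
rewrite /expand big_flatten big_map big_enum /=; apply: eq_bigr => a _.
by rewrite big_nseq iter_mulr_1.
Qed.

Lemma card_setI_sum (T : finType) (A B : {set T}) : #|A :&: B| = (\sum_(x in A) (x \in B))%N.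
Proof.
rewrite -sum1_card (eq_bigl (fun x => (x \in A) && (x \in B))) ?big_mkcondr//.
by move=> x; rewrite inE.
Qed.

Lemma sum_set2 (T : finType) (k l : T) (F : T -> nat) : k != l ->
  (\sum_(x in [set k; l]) F x = F k + F l)%N.
Proof. by move=> kl; rewrite big_setU1 ?big_set1// inE. Qed.

Lemma eq_set2 n (k l u v : 'I_n) : (k < l)%N -> (u < v)%N ->
  ([set k; l] == [set u; v]) = (k == u) && (l == v).
Proof.
move=> kl uv; apply/eqP/andP => [/setP H|[/eqP -> /eqP ->]//].
have := H k; have := H l; have := H u; rewrite !inE !eqxx ?orbT /=.
move=> /orP[] /eqP e1; move=> /esym/orP[] /eqP e2; move=> /esym/orP[] /eqP e3; subst; rewrite ?eqxx//;
  by [move: kl uv; rewrite ?ltnn//; lia].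
Qed.

(** For ordered pairs the intersection counts become sums of indicators. The crossed coincidence
    [u = l], [v = k] is excluded when both pairs are strictly increasing, so the symmetric term of
    [Ker] reduces to equality of the pairs. *)
Lemma eta_cov_Ker (S : nat) (beta h D p q : R) N n (a b : pairsLe n) :
  eta_cov S beta h D p q N a b = covk S h D beta p q N (rep a) (rep b).
Proof.
case: a => -[k l] /= kl; case: b => -[u v] /= uv.
rewrite /eta_cov /isdiag /inter /Defs.pset /covk /rep /Ker /=.
rewrite !(inj_eq val_inj).
have kl' : k != l -> (k < l)%N by move=> H; rewrite ltn_neqAle kl andbT.
have uv' : u != v -> (u < v)%N by move=> H; rewrite ltn_neqAle uv andbT.
have sy (x y : 'I_n) : (x == y) = (y == x) by exact: eq_sym.
case: (eqVneq k l) => [<-|nkl]; case: (eqVneq u v) => [<-|nuv] /=.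
- rewrite !finset.setUid card_setI_sum big_set1 inE (sy u k); case: (k == u) => /=; ring.
- rewrite finset.setUid card_setI_sum big_set1 !inE (sy u k) (sy v k).
  case: (eqVneq k u) nuv => [->|_] nuv; first by rewrite (negbTE nuv) /=; ring.
  by case: (k == v) => /=; ring.
- rewrite finset.setUid card_setI_sum sum_set2// !inE (sy u k) (sy u l).
  case: (eqVneq k u) nkl => [->|_] nkl; first by rewrite sy (negbTE nkl) /=; ring.
  by case: (l == u) => /=; ring.
rewrite eq_set2 ?kl' ?uv'// card_setI_sum sum_set2// !inE (sy u k) (sy u l) (sy v k) (sy v l).
have x1 : (u == k) && (u == l) = false.
  by apply/negbTE/negP => /andP[/eqP -> e]; rewrite e in nkl.
have x2 : (u == k) && (v == k) = false.
  by apply/negbTE/negP => /andP[/eqP e /eqP e']; rewrite e e' eqxx in nuv.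
have x3 : (u == l) && (v == l) = false.
  by apply/negbTE/negP => /andP[/eqP e /eqP e']; rewrite e e' eqxx in nuv.
have x4 : (v == k) && (v == l) = false.
  by apply/negbTE/negP => /andP[/eqP -> e]; rewrite e in nkl.
have x5 : (u == l) && (v == k) = false.
  apply/negbTE/negP => /andP[/eqP e /eqP e']; have := kl' nkl; have := uv' nuv.
  by rewrite e e'; lia.
move: x1 x2 x3 x4 x5; rewrite (sy u k) (sy u l) (sy v k) (sy v l).
by case: (k == u); case: (l == u); case: (k == v); case: (l == v) => //= _ _ _ _ _; ring.
Qed.

End Assembly.

Theorem theorem1p3 (R : realType) (S : nat) (h D : R) :
  (1 <= S)%N -> 0 <= h ->
  exists beta' : R, 0 < beta' /\
  forall beta : R, 0 < beta -> beta < beta' ->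
  forall p q : R, fixed_point S beta h D p q ->
  forall (n : nat) (mm : pairsLe n -> nat), (1 <= n)%N ->
  exists C : R, forall (N : nat) (L : pairsLe n -> pairsLe n -> R),
    (2 <= N)%N ->
    (forall a b : pairsLe n,
        \sum_(c : pairsLe n) L a c * L b c = eta_cov S beta h D p q N a b) ->
    `| @nu R S N n beta h D
          (fun rho => \prod_(a : pairsLe n)
                        (overlap rho (val a).1 (val a).2 - Qkl p q a) ^+ mm a)
       - gexpT (fun g : pairsLe n -> R =>
                  \prod_(a : pairsLe n) (\sum_(c : pairsLe n) L a c * g c) ^+ mm a) |
    <= C / Num.sqrt (N%:R) ^+ (\sum_(a : pairsLe n) mm a).+1.
Proof.
(* The three summands of [W] ensure [beta <= 1], the contraction condition [bht], and the bound [bK]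
   that keeps M and M_3 away from zero. *)
move=> S1 h0; pose W : R := 1 + 2 * htC S + 16 * S%:R ^+ 4.
have H0 : 0 <= htC S :> R.
  by rewrite /htC; apply: mulr_ge0; [apply: mulr_ge0 => //; exact: sqr_ge0|exact: firstC_ge0].
have K0 : 0 <= S%:R ^+ 4 :> R by exact: exprn_ge0.
have W0 : 1 <= W by rewrite /W; lra.
have W1 : 0 < W by rewrite (lt_le_trans ltr01).
exists W^-1; split; first by rewrite invr_gt0.
move=> beta b0 bW p q fp n mm n1.
have bW1 : beta * W < 1 by rewrite -ltr_pdivlMr// mul1r.
have b1 : beta <= 1 by rewrite (le_trans _ (ltW bW1))// ler_peMr// ltW.
have b2 : beta ^+ 2 <= beta by rewrite expr2 ler_piMr// ltW.
have bht : beta ^+ 2 * htC S <= 1 / 2.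
  apply: (le_trans (ler_wpM2r H0 b2)); have := mulr_ge0 (ltW b0) K0.
  move: bW1; rewrite /W; lra.
have bK : beta ^+ 2 * S%:R ^+ 4 <= 1 / 16.
  apply: (le_trans (ler_wpM2r K0 b2)); have := mulr_ge0 (ltW b0) H0.
  move: bW1; rewrite /W; lra.
pose t := map (@rep n) (expand mm).
have tn : below n t.
  by apply/allP => _ /mapP[a _ ->]; rewrite /= !ltn_ord.
have [C C0 HC] := moments_close S1 fp b0 b1 bht (cM_neq0 h D p q b0 bK) (cM3_neq0 h D p q bK) tn.
exists C => N L N2 HL; have N0 : (0 < N)%N by exact: ltnW.
(* The site in [bO] serves here only as a witness that [N] is positive. *)
have := HC N (Ordinal N0); rewrite /om exprVn size_map size_expand.
congr (is_true (`|_ - _| <= _)).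
- rewrite /mu (nuf_cavnu beta h D p q (Ordinal N0)); apply/esym; apply: nu_cavnu => rho.
  rewrite /Xs big_map prod_expand; apply: eq_bigr => a _; congr (_ ^+ _).
  rewrite /xx /ovr /overlap /Qkl /Qn /isdiag /= (inj_eq val_inj); congr (_ * _ - _).
  by apply: eq_bigr => j _; rewrite !exn_ord.
- rewrite /gam wick_map /gexpT.
  pose lf (a : pairsLe n) (i : 'I_#|(pairsLe n : finType)|) := L a (enum_val i).
  (* The matrix [L] enters only through the covariance, so the constant is the same for every choice
     of [L]. *)
  have E (a b : pairsLe n) : \sum_i lf a i * lf b i = covk S h D beta p q N (rep a) (rep b).
    rewrite -eta_cov_Ker -HL (reindex (@enum_rank (pairsLe n : finType)))/=; last exact: onW_bij (enum_rank_bij _).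
    by apply: eq_bigr => c _; rewrite /lf enum_rankK.
  transitivity (wick (fun a b => \sum_i lf a i * lf b i) (expand mm)).
    by congr wick; apply/funext => a; apply/funext => b; rewrite E.
  rewrite -gauss_wick; congr gexp; apply/funext => v; rewrite prod_expand.
  apply: eq_bigr => a _; congr (_ ^+ _).
  rewrite /linf (reindex (@enum_rank (pairsLe n : finType)))/=; last exact: onW_bij (enum_rank_bij _).
  by apply: eq_bigr => c _; rewrite /lf enum_rankK.
Qed.
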